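(* Let $\xi(x)=\sum_{p\ge 2}\alpha_p x^p$ be a mixture with $\alpha_2>0$. Then there exists $\beta_\xi\in\left(0,\frac{1}{\sqrt{2\alpha_2}}\right]$ such that for every $\beta$ with $0<\beta<\beta_\xi$, letting $$s^2=-\frac12\log\left(1-2\alpha_2\beta^2\right),$$ the free energy $F_N$ at inverse temperature $\beta$ satisfies $$F_N-N\frac{\beta^2}{2}\xi(1)\ \longrightarrow\ \mathcal{N}\left(-\tfrac12 s^2,\ s^2\right)\quad\text{in distribution, as } N\to\infty.$$ Moreover, if $\xi(x)=\alpha_2x^2$, then this holds with $\beta_\xi=\frac{1}{\sqrt{2\alpha_2}}$.
   Context: A mixture is a non-zero power series $\xi(x)=\sum_{p\ge2}\alpha_p x^p$ (sum over integers $p\ge 2$) with $\alpha_p\ge0$ for all $p$ and radius of convergence greater than one. For $N\ge1$, the mixed $p$-spin Hamiltonian $H_N$ with mixture $\xi$ is a centered Gaussian process indexed by the sphere $\{\sigma\in\mathbb{R}^N:|\sigma|=\sqrt N\}$, defined under a probability $\mathbb{P}_N$ with expectation $\mathbb{E}_N$, with covariance $$\mathbb{E}_N[H_N(\sigma)H_N(\sigma')]=N\xi\left(\frac{\sigma\cdot\sigma'}{N}\right).$$ Let $E$ denote expectation with respect to the uniform probability measure on $\sigma\in\{\pm1\}^N$. For an inverse temperature $\beta\ge0$, the partition function and free energy are the random variables $$Z_N=E[\exp(\beta H_N(\sigma))],\qquad F_N=\log Z_N .$$ $\mathcal{N}(\mu,\sigma^2)$ denotes the normal distribution with mean $\mu$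 and variance $\sigma^2$. *)

(* Defs.v *)
From HB Require Import structures.
From mathcomp Require Import all_boot all_order all_algebra.
From mathcomp Require Import all_classical all_reals all_analysis.
From mathcomp Require Import measurable_realfun measurable_fun_approximation.

Set Implicit Arguments.
Unset Strict Implicit.
Unset Printing Implicit Defensive.

Import Order.TTheory GRing.Theory Num.Theory.
Import numFieldNormedType.Exports.

Local Open Scope classical_set_scope.
Local Open Scope ring_scope.

Section mixtures.
Context {R : realType}.
Implicit Type a : nat -> R.

Definition convergence_radius a : \bar R :=
  ereal_sup [set `|x|%:E | x in [set x : R | cvgn (pseries a x)]].

(* A mixture is represented by its coefficient sequence; its value at [x] is
   [mixture_fun a x], which is meaningful inside the disc of convergence, in
   particular on [-1, 1]. *)
Definition is_mixture a : Prop :=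
  [/\ forall p, (p < 2)%N -> a p = 0,
      forall p, 0 <= a p,
      exists p, a p != 0
    & (1 < convergence_radius a)%E].

Definition mixture_fun a (x : R) : R := limn (pseries a x).

End mixtures.

Section gaussian.
Context {R : realType}.

(* Normal law with mean [m] and variance [v], degenerate case [v = 0] included:
   the library's [normal_prob m 0] is not a Dirac mass. *)
Definition gaussian_law (m v : R) (A : set R) : \bar R :=
  if v == 0 then \d_m A else normal_prob m (Num.sqrt v) A.

Definition is_gaussian d (T : measurableType d) (P : probability T R)
    (Y : T -> R) : Prop :=
  exists m v : R, 0 <= v /\
    forall A : set R, measurable A -> P (Y @^-1` A) = gaussian_law m v A.

Definition gaussian_process (I : Type) d (T : measurableType d)
    (P : probability T R) (X : I -> {RV P >-> R}) : Prop :=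
  forall (n : nat) (t : 'I_n -> I) (a : 'I_n -> R),
    is_gaussian P (fun w => \sum_(k < n) a k * X (t k) w).

End gaussian.

Definition cvg_in_distribution (R : realType) (d : nat -> measure_display)
    (T : forall N, measurableType (d N)) (P : forall N, probability (T N) R)
    (X : forall N, {RV (P N) >-> R}) (mu : probability (measurableTypeR R) R) : Prop :=
  forall f : R -> R, continuous f -> (exists M : R, forall x, `|f x| <= M) ->
    ('E_(P N)[f \o X N] @[N --> \oo] --> 'E_mu[f])%E.

Section sphere.
Context {R : realType}.

Definition dot n (u v : 'rV[R]_n) : R := \sum_(i < n) u 0 i * v 0 i.

(* The norm [`| _ |] of the library on matrices is the sup norm. *)
Definition euclidean_norm n (u : 'rV[R]_n) : R := Num.sqrt (dot u u).

Definition sphere N : Type :=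
  {u : 'rV[R]_N | euclidean_norm u == Num.sqrt N%:R}.

Definition spin_row N (s : {ffun 'I_N -> bool}) : 'rV[R]_N :=
  \row_(i < N) (-1) ^+ s i.

Lemma spin_row_norm N (s : {ffun 'I_N -> bool}) :
  euclidean_norm (spin_row s) == Num.sqrt N%:R.
Proof.
apply/eqP; congr Num.sqrt; rewrite /dot.
under eq_bigr do rewrite !mxE -expr2 sqrr_sign.
by rewrite sumr_const card_ord.
Qed.

(* [spin_point] is a bijection from [{ffun 'I_N -> bool}] to {+1, -1}^N. *)
Definition spin_point N (s : {ffun 'I_N -> bool}) : sphere N :=
  exist _ (spin_row s) (spin_row_norm s).

End sphere.
Arguments sphere : clear implicits.

Section model.
Context {R : realType}.

Definition mixed_p_spin (a : nat -> R) N d (T : measurableType d)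
    (P : probability T R) (H : sphere R N -> {RV P >-> R}) : Prop :=
  [/\ gaussian_process H,
      forall s, ('E_P[H s] = 0)%E
    & forall s s', 'E_P[H s \* H s']%E =
        (N%:R * mixture_fun a (dot (val s) (val s') / N%:R))%:E].

Definition uniform_mean (S : finType) (f : S -> R) : R :=
  (\sum_(s : S) f s) / #|S|%:R.

Section free_energy.
Variables (N : nat) (d : measure_display) (T : measurableType d).
Variables (P : probability T R) (beta : R) (H : sphere R N -> {RV P >-> R}).

Definition partition_function (w : T) : R :=
  uniform_mean (fun s : {ffun 'I_N -> bool} =>
    expR (beta * H (spin_point s) w)).

Definition free_energy (w : T) : R := ln (partition_function w).

Lemma measurable_partition_function : measurable_fun setT partition_function.
Proof.
apply: measurable_funM; last exact: measurable_cst.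
apply: measurable_sum => s.
apply: measurableT_comp; first exact: measurable_expR.
apply: measurable_funM; first exact: measurable_cst.
exact: measurable_funPT.
Qed.

HB.instance Definition _ :=
  isMeasurableFun.Build _ _ T R partition_function measurable_partition_function.

Lemma measurable_free_energy : measurable_fun setT free_energy.
Proof.
exact: measurableT_comp (@measurable_ln R) measurable_partition_function.
Qed.

HB.instance Definition _ :=
  isMeasurableFun.Build _ _ T R free_energy measurable_free_energy.

End free_energy.

(* The laws of the [H N] are determined by the coefficients [a], so that the
   underlying probability spaces are quantified over. Nothing is assumed of the
   irrelevant index [N = 0]. *)
Definition free_energy_clt (a : nat -> R) (beta : R) : Prop :=
  forall (d : nat -> measure_display) (T : forall N, measurableType (d N))
    (P : forall N, probability (T N) R)
    (H : forall N, sphere R N -> {RV (P N) >-> R}),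
  (forall N, (0 < N)%N -> mixed_p_spin a (H N)) ->
  let s2 := - 2^-1 * ln (1 - 2 * a 2%N * beta ^+ 2) in
  cvg_in_distribution
    (fun N => free_energy beta (H N)
       \- cst (N%:R * (beta ^+ 2 / 2) * mixture_fun a 1) : {RV (P N) >-> R})
    (normal_prob (- 2^-1 * s2) (Num.sqrt s2)).

End model.

(* Main.v *)
(* Let [W t] be the mean over the hypercube of [exp (sqrt t * H s - t * N * xi 1 / 2)], so
   that [F_N - N * (beta^2 / 2) * xi 1 = ln (W (beta^2))]. By Lindeberg's method, run along
   [t <= beta^2], the Laplace transform of [W (beta^2)] differs from that of a log-normal
   variable of parameter [s^2 = - ln (1 - 2 * a 2 * beta^2) / 2] by at most a multiple of
   [sup_t E |D t|], where [D t] is the mean over two replicas of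
   [w t s * w t s' * (N * xi R - c t)], [w] denotes the normalised Boltzmann weight and
   [c = a 2 / (1 - 2 * a 2 * t)] is the derivative of [s^2].
   For [t] close to [0], [E (D t)^2] is an average over four replicas, which tends to [0] by
   the central limit theorem for overlaps. Second moments blow up before
   [t = 1 / (2 * xi 1)], but [E |D t|] does not: [w t] is approximated by Lagrange
   extrapolation from weights close to [t = 0], with an error controlled by the analyticity of
   the kernel [exp (sqrt (t * t') * N * xi R)] and the positivity of the covariance, as long
   as [2 * t * xi 1 < 1]. Hence [beta_xi = 1 / sqrt (2 * xi 1)], which is
   [1 / sqrt (2 * a 2)] when [xi] is pure. *)

Require Import Defs.
From HB Require Import structures.
From mathcomp Require Import all_boot all_order all_algebra.
From mathcomp Require Import all_classical all_reals all_analysis.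
From mathcomp Require Import measurable_realfun qpoly ring lra.

Set Implicit Arguments.
Unset Strict Implicit.
Unset Printing Implicit Defensive.

Import Order.TTheory GRing.Theory Num.Theory.
Import numFieldNormedType.Exports.

Local Open Scope classical_set_scope.
Local Open Scope ring_scope.

(** * Expectations *)

(** Laplace transforms serve as test functions because [expR (- lam * W)] has bounded derivatives on
    the half-line where [W] lives: remainders then cost only polynomial moments of the increments,
    and the factor is dropped wherever it multiplies [D t], which leaves [E |D t|]. The obstacle is
    that [E (D t)^2] involves four replicas, hence six overlaps. The extrapolation never leaves two
    replicas: for a finite family of points [z = sqrt t], both terms of the deviation are positive
    semidefinite forms in coefficients attached to the points, the first because a covariance is,
    the second because [c] has nonnegative Taylor coefficients. By Cauchy-Schwarz the variation of
    such a form is controlled by its value at the difference of the coefficients, whose mean is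
    explicit. That mean is a power series in the products [z * z'], so it is small as soon as all
    the moments of the coefficients at the points are. Mixed pairs of points [z], [z'] then occur,
    with the centring [c (z * z')]. *)

Section expectation.
Context {R : realType} {d : measure_display} {T : measurableType d}.
Variable P : probability T R.
Implicit Types f g : T -> R.

Definition Ex f : R := (\int[P]_w f w)%R.
Definition L1 f := P.-integrable setT (EFin \o f).

Lemma L1_meas f : L1 f -> measurable_fun setT f.
Proof. by move=> /integrableP[/measurable_EFinP]. Qed.

Lemma L1_cst c : L1 (fun=> c).
Proof. exact: (@finite_measure_integrable_cst _ _ _ P setT c). Qed.

Lemma L1D f g : L1 f -> L1 g -> L1 (fun w => f w + g w).
Proof.
move=> f1 g1; apply: (eq_integrable measurableT _ _ _ (integrableD measurableT f1 g1)).
by move=> w _ /=; rewrite EFinD.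
Qed.

Lemma L1Z c f : L1 f -> L1 (fun w => c * f w).
Proof.
move=> f1; apply: (eq_integrable measurableT _ _ _ (integrableZl measurableT c f1)).
by move=> w _ /=; rewrite EFinM.
Qed.

Lemma L1B f g : L1 f -> L1 g -> L1 (fun w => f w - g w).
Proof.
move=> f1 g1; have := L1D f1 (L1Z (-1) g1).
by under eq_fun do rewrite mulN1r.
Qed.

Lemma L1_sum (I : Type) (r : seq I) (Q : pred I) (F : I -> T -> R) :
  (forall i, L1 (F i)) -> L1 (fun w => \sum_(i <- r | Q i) F i w).
Proof.
move=> F1; elim: r => [|i r ih].
  by under eq_fun do rewrite big_nil; exact: L1_cst.
under eq_fun do rewrite big_cons.
by case: (Q i) => //; exact: L1D.
Qed.

Lemma L1_norm f : L1 f -> L1 (fun w => `|f w|).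
Proof. exact: integrable_norm. Qed.

Lemma L1_dom g f : measurable_fun setT f -> (forall w, `|f w| <= g w) ->
  L1 g -> L1 f.
Proof.
move=> mf fg g1; apply: (le_integrable measurableT _ _ g1); first exact/measurable_EFinP.
by move=> w _ /=; rewrite lee_fin (le_trans (fg w))// ler_norm.
Qed.

Lemma L1_bounded c f : measurable_fun setT f -> (forall w, `|f w| <= c) -> L1 f.
Proof. by move=> mf fc; apply: L1_dom fc (L1_cst c). Qed.

Lemma Ex_cst c : Ex (fun=> c) = c.
Proof.
by rewrite /Ex Rintegral_cst//= probability_setT mulr1.
Qed.

Lemma ExD f g : L1 f -> L1 g -> Ex (fun w => f w + g w) = Ex f + Ex g.
Proof. by move=> f1 g1; rewrite /Ex RintegralD. Qed.

Lemma ExB f g : L1 f -> L1 g -> Ex (fun w => f w - g w) = Ex f - Ex g.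
Proof. by move=> f1 g1; rewrite /Ex RintegralB. Qed.

Lemma ExZ c f : L1 f -> Ex (fun w => c * f w) = c * Ex f.
Proof. by move=> f1; rewrite /Ex RintegralZl. Qed.

Lemma Ex_sum (I : Type) (r : seq I) (Q : pred I) (F : I -> T -> R) :
  (forall i, L1 (F i)) ->
  Ex (fun w => \sum_(i <- r | Q i) F i w) = \sum_(i <- r | Q i) Ex (F i).
Proof.
move=> F1; elim: r => [|i r ih].
  by under eq_fun do rewrite big_nil; rewrite big_nil Ex_cst.
under eq_fun do rewrite big_cons.
rewrite big_cons -ih; case: (Q i) => //.
by rewrite ExD//; exact: L1_sum.
Qed.

Lemma Ex_le f g : L1 f -> L1 g -> (forall w, f w <= g w) -> Ex f <= Ex g.
Proof. by move=> f1 g1 fg; apply: le_Rintegral. Qed.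

Lemma Ex_ge0 f : (forall w, 0 <= f w) -> 0 <= Ex f.
Proof. by move=> f0; apply: Rintegral_ge0. Qed.

Lemma Ex_normr f : L1 f -> `|Ex f| <= Ex (fun w => `|f w|).
Proof. by move=> f1; apply: le_normr_Rintegral. Qed.

Lemma Ex_normr_le g f : measurable_fun setT f -> (forall w, `|f w| <= g w) ->
  L1 g -> `|Ex f| <= Ex g.
Proof.
move=> mf fg g1; have f1 := L1_dom mf fg g1.
by apply: (le_trans (Ex_normr f1)); apply: Ex_le => //; exact: L1_norm.
Qed.

Lemma Ex_EFin f : L1 f -> (\int[P]_w (f w)%:E)%E = (Ex f)%:E.
Proof. by move=> f1; rewrite /Ex /Rintegral fineK//; exact: integrable_fin_num. Qed.

(** Integrate [2 * e * |f| <= f^2 + e^2] in place of Cauchy-Schwarz. When [e = 0], the mean of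
    [|f|], assumed positive for a contradiction, takes the role of [e]. *)
Lemma Ex_normr_le_sqrt f e : L1 f -> L1 (fun w => f w ^+ 2) -> 0 <= e ->
  Ex (fun w => f w ^+ 2) <= e ^+ 2 -> Ex (fun w => `|f w|) <= e.
Proof.
move=> f1 f2; rewrite le_eqVlt => /predU1P[<-|e0] fe; last first.
  have : Ex (fun w => 2 * e * `|f w|) <= Ex (fun w => f w ^+ 2 + e ^+ 2).
    apply: Ex_le; [exact/L1Z/L1_norm|exact/L1D/L1_cst|move=> w].
    rewrite -(real_normK (num_real (f w))).
    have := sqr_ge0 (`|f w| - e); nra.
  rewrite ExZ ?ExD ?Ex_cst//; [|exact: L1_cst|exact: L1_norm].
  nra.
rewrite leNgt; apply/negP => E0.
set E := Ex _ in E0.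
have : Ex (fun w => 2 * E * `|f w|) <= Ex (fun w => f w ^+ 2 + E ^+ 2).
  apply: Ex_le; [exact/L1Z/L1_norm|exact/L1D/L1_cst|move=> w].
  rewrite -(real_normK (num_real (f w))).
  have := sqr_ge0 (`|f w| - E); nra.
rewrite ExZ ?ExD ?Ex_cst//; [|exact: L1_cst|exact: L1_norm].
rewrite -/E; move: fe; rewrite expr0n /=; nra.
Qed.

Lemma Ex_dominated (F : nat -> T -> R) f g :
  (forall n, measurable_fun setT (F n)) -> measurable_fun setT f ->
  (forall w, F n w @[n --> \oo] --> f w) ->
  L1 g -> (forall n w, `|F n w| <= g w) ->
  Ex (F n) @[n --> \oo] --> Ex f.
Proof.
move=> mF mf Ff g1 Fg.
have [|||||i _ c] := @dominated_convergence _ T R P setT measurableT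
   (fun n w => (F n w)%:E) (fun w => (f w)%:E) (fun w => (g w)%:E).
- by move=> n; exact/measurable_EFinP.
- exact/measurable_EFinP.
- by apply/aeW => w _; apply: cvg_EFin; [exact: nearW|exact: Ff].
- exact: g1.
- by apply/aeW => w n _; rewrite lee_fin; exact: Fg.
have Fn n : L1 (F n) by apply: L1_dom (Fg n) g1.
have {}c : (Ex (F n))%:E @[n --> \oo] --> (Ex f)%:E.
  rewrite -Ex_EFin//; apply: cvg_trans c; apply: near_eq_cvg.
  by apply: nearW => n; rewrite -Ex_EFin.
exact: (fine_cvg c).
Qed.

End expectation.

Section product_expectation.
Context {R : realType} {d1 d2 : measure_display}.
Context {T1 : measurableType d1} {T2 : measurableType d2}.
Variables (P1 : probability T1 R) (P2 : probability T2 R).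

(** Integrability of every section, and not of almost every one, makes the inner integral a real
    number throughout. *)
Lemma Ex_fubini (f : T1 * T2 -> R) : L1 (P1 \x P2)%E f ->
  (forall x, L1 P2 (fun y => f (x, y))) ->
  Ex (P1 \x P2)%E f = Ex P1 (fun x => Ex P2 (fun y => f (x, y))).
Proof.
move=> f1 fx; rewrite /Ex /Rintegral -(integral12_prod_meas1 f1) /fubini_F/=.
by congr fine; apply: eq_integral => x _; rewrite Ex_EFin.
Qed.

Lemma L1_prod (g : T1 -> R) (h : T2 -> R) : L1 P1 g -> L1 P2 h ->
  L1 (P1 \x P2)%E (fun z => g z.1 * h z.2).
Proof.
move=> g1 h1.
have m : measurable_fun setT (fun z : T1 * T2 => g z.1 * h z.2).
  apply: measurable_funM.
    exact: measurableT_comp (L1_meas g1) measurable_fst.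
  exact: measurableT_comp (L1_meas h1) measurable_snd.
have m' : measurable_fun setT (EFin \o (fun z : T1 * T2 => g z.1 * h z.2)).
  exact/measurable_EFinP.
apply/(integrable12ltyP P1 P2 m').
under eq_integral => x _.
  under eq_integral => y _ do rewrite /= normrM EFinM.
  rewrite ge0_integralZl//; last first.
    by apply/measurable_EFinP/measurableT_comp => //; exact: L1_meas h1.
  rewrite Ex_EFin; last exact: L1_norm.
  rewrite -EFinM.
  over.
rewrite /=.
have -> : (\int[P1]_x (`|g x| * Ex P2 (fun y => `|h y|))%:E)%E =
  (Ex P1 (fun x => `|g x| * Ex P2 (fun y => `|h y|)))%:E.
  apply: Ex_EFin; under eq_fun do rewrite mulrC.
  exact/L1Z/L1_norm.
by rewrite ltry.
Qed.

Lemma Ex_prod (g : T1 -> R) (h : T2 -> R) : L1 P1 g -> L1 P2 h ->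
  Ex (P1 \x P2)%E (fun z => g z.1 * h z.2) = Ex P1 g * Ex P2 h.
Proof.
move=> g1 h1; rewrite Ex_fubini/=; first last.
- by move=> x; exact: L1Z.
- exact: L1_prod.
under eq_fun do rewrite ExZ//.
by under eq_fun do rewrite mulrC; rewrite ExZ// mulrC.
Qed.

End product_expectation.

(** * Normal integrals *)

Section density.
Context {R : realType} {d : measure_display} {T : measurableType d}.
Variables (mu nu : {measure set T -> \bar R}) (p : T -> R).
Hypotheses (mp : measurable_fun setT p) (p0 : forall x, 0 <= p x).
Hypothesis nuE : forall A, measurable A -> nu A = (\int[mu]_(x in A) (p x)%:E)%E.
Import HBNNSimple.

Let integral_density_indic (E : set T) : measurable E ->
  (\int[nu]_x (\1_E x)%:E = \int[mu]_x (\1_E x * p x)%:E)%E.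
Proof.
move=> mE; rewrite integral_indic//= setIT nuE// integral_mkcond.
apply: eq_integral => x _; rewrite patchE indicE.
by case: (x \in E); rewrite ?mul1r ?mul0r.
Qed.

Let integral_density_nnsfun (f : {nnsfun T >-> R}) :
  (\int[nu]_x (f x)%:E = \int[mu]_x (f x * p x)%:E)%E.
Proof.
under [LHS]eq_integral do rewrite fimfunE -fsumEFin//.
rewrite [LHS]ge0_integral_fsum//; last 2 first.
  - by move=> r; exact/measurable_EFinP/measurableT_comp.
  - by move=> n x _; rewrite EFinM nnfun_muleindic_ge0.
under [RHS]eq_integral.
  move=> x xD; rewrite fimfunE EFinM -fsumEFin// ge0_mule_fsuml; last first.
    by move=> r; rewrite EFinM nnfun_muleindic_ge0.
  over.
rewrite [RHS]ge0_integral_fsum//; last 2 first.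
  - move=> r; apply: emeasurable_funM; last exact/measurable_EFinP.
    by apply/measurable_EFinP; exact/measurableT_comp.
  - move=> n x _; rewrite mule_ge0//; last by rewrite lee_fin p0.
    by rewrite EFinM nnfun_muleindic_ge0.
apply: eq_fsbigr => r rf.
have r0 : 0 <= r.
  by move: rf; rewrite inE => -[x _ <-].
under eq_integral do rewrite EFinM.
rewrite ge0_integralZl//; last exact/measurable_EFinP/measurable_indic.
rewrite integral_density_indic//.
under [RHS]eq_integral do rewrite -EFinM -mulrA EFinM.
rewrite ge0_integralZl//.
- apply/measurable_EFinP/measurable_funM; first exact: measurable_indic.
  exact: mp.
- by move=> x _; rewrite lee_fin mulr_ge0.
Qed.

(** Indicators, then simple functions, then monotone convergence: the density is only known through
    the measure of sets. *)
Lemma integral_density (f : T -> R) : measurable_fun setT f ->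
  (forall x, 0 <= f x) ->
  (\int[nu]_x (f x)%:E = \int[mu]_x (f x * p x)%:E)%E.
Proof.
move=> mf f0.
have mef : measurable_fun setT (EFin \o f) by exact/measurable_EFinP.
pose f_ := nnsfun_approx measurableT mef.
have ef0 x : (0 <= (EFin \o f) x)%E by rewrite lee_fin.
have cf x : ((f_ n x)%:E @[n --> \oo] --> (f x)%:E)%E.
  by apply: cvg_nnsfun_approx => // y _; exact: ef0.
transitivity (limn (fun n => (\int[nu]_x (f_ n x)%:E)%E)).
  rewrite -monotone_convergence//=.
  - by apply: eq_integral => x _; apply/esym/cvg_lim => //; exact: cf.
  - by move=> n; exact/measurable_EFinP/measurable_funTS.
  - by move=> n x _; rewrite lee_fin.
  - by move=> x _ a b ab; rewrite lee_fin; exact/lefP/nd_nnsfun_approx.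
transitivity (limn (fun n => (\int[mu]_x (f_ n x * p x)%:E)%E)).
  by congr (limn _); apply/funext => n; exact: integral_density_nnsfun.
rewrite -monotone_convergence//=.
- apply: eq_integral => x _; apply/cvg_lim => //.
  rewrite EFinM; under eq_fun do rewrite EFinM.
  by apply: cvgeZr => //; exact: cf.
- by move=> n; apply/measurable_EFinP/measurable_funM.
- by move=> n x _; rewrite lee_fin mulr_ge0.
- move=> x _ a b ab; rewrite lee_fin ler_wpM2r//.
  exact/lefP/nd_nnsfun_approx.
Qed.

End density.

Section normal_density.
Context {R : realType}.
Local Notation mu := (@lebesgue_measure R).

Lemma integral_normal (m s : R) (f : R -> R) : measurable_fun setT f ->
  (forall x, 0 <= f x) ->
  (\int[normal_prob m s]_x (f x)%:E =
   \int[mu]_x (f x * normal_pdf m s x)%:E)%E.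
Proof.
move=> mf f0.
apply: (@integral_density R _ (measurableTypeR R) mu (normal_prob m s)
  (normal_pdf m s)) => //.
- exact: measurable_normal_pdf.
- exact: normal_pdf_ge0.
Qed.

End normal_density.

Section normal_expectation.
Context {R : realType}.
Implicit Types (f : R -> R) (m s u b c h : R).
Local Notation mu := (@lebesgue_measure R).

Lemma normal_pdf_affine m s x : 0 < s ->
  s * normal_pdf m s (m + s * x) = normal_pdf 0 1 x.
Proof.
move=> s0; rewrite !normal_pdfE ?gt_eqF// /normal_peak /normal_fun.
rewrite mulrA; congr (_ * expR _); last first.
  by rewrite subr0; field; rewrite gt_eqF.
rewrite -mulrnAr sqrtrM ?sqr_ge0// sqrtr_sqr gtr0_norm// invfM mulrA.
by rewrite divff ?gt_eqF// mul1r expr1n mul1r.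
Qed.

Lemma integral_normal_affine m s f : 0 < s -> continuous f ->
  (forall x, 0 <= f x) ->
  (\int[normal_prob m s]_x (f x)%:E =
   \int[normal_prob 0 1]_x (f (m + s * x))%:E)%E.
Proof.
move=> s0 cf f0.
have mf : measurable_fun setT f by exact: continuous_measurable_fun.
have dF (x : R) : is_derive x 1 (fun x => m + s * x) s.
  have h : is_derive x 1 (cst m \+ s \*: (@idfun R)) (0 + s *: 1).
    exact: is_deriveD.
  by rewrite add0r /= [X in is_derive _ _ _ X]mulr1 in h.
have F'E : (fun x : R => m + s * x)^`()%classic = cst s.
  by apply/funext => x; rewrite derive1E (@derive_val _ _ _ _ _ _ _ (dF x)).
have cF : continuous (fun x : R => m + s * x).
  by move=> x; apply: cvgD; [exact: cvg_cst|apply: cvgM; [exact: cvg_cst|exact: cvg_id]].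
have mfF := measurableT_comp mf (continuous_measurable_fun cF).
apply: etrans (integral_normal m s mf f0) _.
apply: etrans _ (esym (integral_normal 0 1 mfF (fun x => f0 (m + s * x)))).
rewrite (@increasing_ge0_integration_by_substitutionT _ (fun x => m + s * x)).
- apply: eq_integral => x _; rewrite F'E /=; congr EFin.
  by rewrite !fctE /= -(normal_pdf_affine m x s0); ring.
- by move=> x y xy; rewrite ltrD2l ltr_pM2l.
- by rewrite F'E => x; exact: cvg_cst.
- by rewrite F'E; exact: is_cvg_cst.
- by rewrite F'E; exact: is_cvg_cst.
- by move=> x; case: (dF x).
- apply: (@cvg_comp _ _ _ (fun x => s * x) (fun x => m + x)); last exact: cvg_addrl_Ny.
  by apply: gt0_cvgMrNy => //; exact: cvg_id.
- apply: (@cvg_comp _ _ _ (fun x => s * x) (fun x => m + x)); last exact: cvg_addrl.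
  by apply: gt0_cvgMry => //; exact: cvg_id.
- move=> x; apply: cvgM; first exact: cf.
  by apply: continuous_normal_pdf; rewrite gt_eqF.
- by move=> x; rewrite mulr_ge0// normal_pdf_ge0.
Qed.

End normal_expectation.

(** * Taylor bounds with explicit constants *)

Section elementary.
Context {R : realType}.
Implicit Types (f : R -> R) (x y h l C : R).

(** The bounds on [sin] and [cos] and the cubic remainder of [expR] come from it, each from a bound
    on the derivative. *)
Lemma normr_increment_le f (df : R -> R) B x :
  (forall y, is_derive y 1 f (df y)) -> (forall y, `|y| <= `|x| -> `|df y| <= B) ->
  `|f x - f 0| <= B * `|x|.
Proof.
move=> fdf dfB.
have cf : continuous f.
  move=> y; apply/differentiable_continuous/derivable1_diffP.
  by case: (fdf y).
have [x0|x0] := leP 0 x.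
  have [c] := MVT_segment x0 (fun y _ => fdf y) (continuous_subspaceT cf).
  rewrite in_itv/= => /andP[c0 cx] ->; rewrite subr0 normrM ler_wpM2r//.
  by apply: dfB; rewrite !ger0_norm.
have [c] := MVT_segment (ltW x0) (fun y _ => fdf y) (continuous_subspaceT cf).
rewrite in_itv/= => /andP[xc c0].
rewrite -[f x - _]opprB normrN => ->; rewrite sub0r normrM normrN ler_wpM2r//.
by apply: dfB; rewrite !ler0_norm ?lerN2// ltW.
Qed.

(** A quadratic remainder gives the derivative of a mean with no differentiation under the integral
    sign; [gauss_cos] applies it to a characteristic function. *)
Lemma is_derive_quadratic f x l C :
  (forall h, `|h| <= 1 -> `|f (x + h) - f x - h * l| <= C * h ^+ 2) ->
  is_derive x 1 f l.
Proof.
move=> fC.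
have C0 : 0 <= C.
  have := fC 1; rewrite normr1 lexx expr1n mulr1 => /(_ isT).
  exact: le_trans.
suff c : h^-1 *: (f (h *: 1 + x) - f x) @[h --> 0^'] --> l.
  by apply: DeriveDef; [apply/cvgP: c|exact: cvg_lim c].
apply/cvgrPdist_le => /= e e0.
near=> h.
have h0 : h != 0 by near: h; exact: nbhs_dnbhs_neq.
have h1 : `|h| <= Num.min 1 (e / (C + 1)).
  near: h; apply: dnbhs0_le.
  by rewrite lt_min ltr01 divr_gt0// ltr_wpDl.
have := fC h; rewrite (le_trans h1) ?ge_min ?lexx// => /(_ isT) H.
have {h1} h1 : `|h| <= e / (C + 1) by rewrite (le_trans h1)// ge_min lexx orbT.
rewrite [h *: 1]mulr1 [h + x]addrC -[l](mulKf h0).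
have -> : h^-1 * (h * l) - h^-1 *: (f (x + h) - f x) =
  - (h^-1 * (f (x + h) - f x - h * l)) by rewrite /GRing.scale/=; ring.
rewrite normrN normrM normfV ler_pdivrMl ?normr_gt0//.
apply: (le_trans H); rewrite -(real_normK (num_real h)) expr2 mulrA [leRHS]mulrC.
rewrite ler_wpM2r//.
move: h1; rewrite ler_pdivlMr ?ltr_wpDl//; have := normr_ge0 h; nra.
Unshelve. all: by end_near. Qed.

Lemma expR_norm_ge1 x : 1 <= expR `|x|.
Proof. by rewrite -expR0 ler_expR. Qed.

Lemma expR_norm_le x : expR `|x| <= expR x + expR (- x).
Proof.
have [x0|x0] := leP 0 x; first by rewrite ger0_norm// lerDl expR_ge0.
by rewrite ltr0_norm// lerDr expR_ge0.
Qed.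

Lemma normr_expRB1_le x : `|expR x - 1| <= `|x| * expR `|x|.
Proof.
have h1 := expR_ge1Dx x; have h2 := expR_ge1Dx (- x).
have h3 := expR_gt0 x; have e := expRxMexpNx_1 x.
have [x0|x0] := leP 0 x.
  rewrite (ger0_norm x0) ger0_norm; first by nra.
  by rewrite subr_ge0 -expR0 ler_expR.
have := expR_norm_ge1 x.
rewrite (ltr0_norm x0) ler0_norm; first by nra.
by rewrite subr_le0 -expR0 ler_expR ltW.
Qed.

Lemma normr_expRB2_le x : `|expR x - 1 - x| <= x ^+ 2 * expR `|x|.
Proof.
have h1 := expR_ge1Dx x; have h2 := expR_ge1Dx (- x).
have h3 := expR_gt0 x; have e := expRxMexpNx_1 x.
have := normr_expRB1_le x.
rewrite -(real_normK (num_real x)).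
have : x * (expR x - 1) <= `|x| * `|expR x - 1| by rewrite -normrM ler_norm.
rewrite (@ger0_norm _ (expR x - 1 - x)); last lra.
have := normr_ge0 x; nra.
Qed.

Lemma normr_expRB3_le x :
  `|expR x - 1 - x - x ^+ 2 / 2| <= `|x| ^+ 3 * expR `|x|.
Proof.
have := @normr_increment_le (fun x => expR x - 1 - x - x ^+ 2 / 2)
  (fun x => expR x - 1 - x) (x ^+ 2 * expR `|x|) x.
rewrite expR0 subrr subr0 expr0n /= mul0r subr0 subr0 => H.
apply: (le_trans (H _ _)).
- move=> y.
  have h : is_derive y 1 (expR - cst 1 - id - 2^-1 *: (id * id))
     (expR y - 0 - 1 - 2^-1 *: (y *: 1 + y *: 1)).
    exact: is_deriveB.
  have -> : (fun x => expR x - 1 - x - x ^+ 2 / 2) =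
      expR - cst 1 - id - 2^-1 *: (id * id).
    by apply/funext => z; rewrite !fctE/= expr2 /GRing.scale/= mulrC.
  by apply: is_derive_eq; rewrite /GRing.scale/=; field.
- move=> y yx; apply: (le_trans (normr_expRB2_le y)).
  rewrite -!(real_normK (num_real y)) -(real_normK (num_real x)).
  by rewrite ler_pM ?exprn_ge0 ?expR_ge0// ?ler_expR// lerXn2r// nnegrE.
- by rewrite -(real_normK (num_real x)) -mulrA [expR _ * _]mulrC mulrA -exprSr.
Qed.

Lemma normr_expR_sub_le x y :
  `|expR x - expR y| <= `|x - y| * (expR x + expR y).
Proof.
wlog xy : x y / y <= x => [H|].
  have [yx|/ltW xy] := leP y x; first exact: H.
  by rewrite distrC [`|x - y|]distrC [expR x + _]addrC; exact: H.
rewrite !ger0_norm ?subr_ge0 ?ler_expR//.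
have -> : expR y = expR x * expR (- (x - y)) by rewrite -expRD; congr expR; ring.
have := expR_ge1Dx (- (x - y)); have := expR_gt0 x; have := expR_gt0 (- (x - y)).
have : 0 <= x - y by rewrite subr_ge0.
move: (x - y) (expR x) => u E u0 F0 E0 F1.
have h1 : 0 <= E * (expR (- u) - (1 - u)) by apply: mulr_ge0; [exact: ltW|rewrite subr_ge0].
have h2 : 0 <= u * (E * expR (- u)) by rewrite !mulr_ge0// ltW.
nra.
Qed.

Lemma sin_norm_le x : `|sin x| <= `|x|.
Proof.
have := @normr_increment_le sin cos 1 x; rewrite sin0 subr0 mul1r; apply.
by move=> y _; exact: cos_max.
Qed.

Lemma cosB1_norm_le x : `|cos x - 1| <= x ^+ 2.
Proof.
have := @normr_increment_le cos (fun x => - sin x) `|x| x.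
rewrite cos0 -expr2 real_normK ?num_real//; apply.
by move=> y yx; rewrite normrN (le_trans (sin_norm_le y)).
Qed.

Lemma sinB_norm_le x : `|sin x - x| <= 2 * x ^+ 2.
Proof.
have [x1|/ltW x1] := leP `|x| 1; last first.
  apply: (le_trans (ler_normB _ _)); rewrite -(real_normK (num_real x)).
  by have := sin_norm_le x; nra.
have := @normr_increment_le (fun x => sin x - x) (fun x => cos x - 1) (x ^+ 2) x.
rewrite sin0 subrr subr0 => H; apply: (le_trans (H _ _)).
- move=> y yx; rewrite (le_trans (cosB1_norm_le _))//.
  by rewrite -(real_normK (num_real y)) -(real_normK (num_real x)) lerXn2r ?nnegrE.
- by rewrite mulrC ler_wpM2r ?sqr_ge0//; lra.
Qed.

Lemma sqr_le_expR x : 0 <= x -> x ^+ 2 <= 4 * expR x.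
Proof.
move=> x0; have := expR_ge1Dx (x / 2); have -> : expR x = expR (x / 2) ^+ 2.
  by rewrite expr2 -expRD; congr expR; field.
nra.
Qed.

End elementary.

(** * Laplace transform and characteristic function of the normal law *)

Section standard_normal.
Context {R : realType}.
Implicit Types (u b c h th m s : R).
Local Notation mu := (@lebesgue_measure R).
Local Notation gam := (normal_prob 0 1 : probability (measurableTypeR R) R).

Lemma continuous_expRM u : continuous (fun x : R => expR (u * x)).
Proof.
move=> x; apply: continuous_cvg; first exact: continuous_expR.
by apply: cvgM; [exact: cvg_cst|exact: cvg_id].
Qed.

Lemma continuous_sinMD b c : continuous (fun x : R => sin (b * x + c)).
Proof.
move=> x; apply: (@cvg_comp _ _ _ (fun x : R => b * x + c) sin _ (nbhs (b * x + c)));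
  last exact: continuous_sin.
by apply: cvgD; [apply: cvgM; [exact: cvg_cst|exact: cvg_id]|exact: cvg_cst].
Qed.

Lemma continuous_cosMD b c : continuous (fun x : R => cos (b * x + c)).
Proof.
move=> x; apply: (@cvg_comp _ _ _ (fun x : R => b * x + c) cos _ (nbhs (b * x + c)));
  last exact: continuous_cos.
by apply: cvgD; [apply: cvgM; [exact: cvg_cst|exact: cvg_id]|exact: cvg_cst].
Qed.

Lemma continuous_expRsqr u : continuous (fun x : R => expR (u * x ^+ 2)).
Proof.
move=> x; apply: continuous_cvg; first exact: continuous_expR.
by apply: cvgM; [exact: cvg_cst|exact: exprn_continuous].
Qed.

Lemma normal_peakE s : 0 < s -> s * normal_peak s = normal_peak 1.
Proof.
move=> s0; rewrite /normal_peak expr1n mul1r -mulrnAr sqrtrM ?sqr_ge0//.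
by rewrite sqrtr_sqr gtr0_norm// invfM mulrA divff ?mul1r ?gt_eqF.
Qed.

Lemma ge0_Ex {d} {T : measurableType d} (P : probability T R) (f : T -> R) r :
  measurable_fun setT f -> (forall x, 0 <= f x) ->
  (\int[P]_x (f x)%:E = r%:E)%E -> L1 P f /\ Ex P f = r.
Proof.
move=> mf f0 fr; split; last by rewrite /Ex /Rintegral fr.
apply/integrableP; split; first exact/measurable_EFinP.
under eq_integral do rewrite /= ger0_norm//.
by rewrite fr ltry.
Qed.

Lemma normal_expR m s u : 0 < s ->
  L1 (normal_prob m s : probability (measurableTypeR R) R) (fun y => expR (u * y)) /\
  Ex (normal_prob m s : probability (measurableTypeR R) R) (fun y => expR (u * y)) =
    expR (u * m + u ^+ 2 * s ^+ 2 / 2).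
Proof.
move=> s0.
have me := continuous_measurable_fun (@continuous_expRM u).
apply: ge0_Ex => //.
rewrite integral_normal//.
under eq_integral => x _.
  have -> : expR (u * x) * normal_pdf m s x =
      expR (u * m + u ^+ 2 * s ^+ 2 / 2) * normal_pdf (m + u * s ^+ 2) s x.
    rewrite !normal_pdfE ?gt_eqF// /normal_fun mulrCA [RHS]mulrCA.
    congr (_ * _); rewrite -!expRD; congr expR; field.
    by rewrite gt_eqF.
  rewrite EFinM; over.
rewrite ge0_integralZl//=.
- by rewrite integral_normal_pdf mule1.
- by apply/measurable_EFinP; exact: measurable_normal_pdf.
- by move=> x _; rewrite lee_fin normal_pdf_ge0.
Qed.

Lemma gauss_expR u : L1 gam (fun y => expR (u * y)) /\
  Ex gam (fun y => expR (u * y)) = expR (u ^+ 2 / 2).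
Proof.
have [h1 h2] := normal_expR 0 u ltr01; split=> //.
by rewrite h2 mulr0 add0r expr1n mulr1.
Qed.

(** Laplace transform of the square of a standard normal variable; at [al * t] its logarithm is the
    limiting variance. *)
Definition kth th := (Num.sqrt (1 - 2 * th))^-1.

Lemma gauss_expRsqr th : th < 2^-1 ->
  L1 gam (fun y => expR (th * y ^+ 2)) /\
  Ex gam (fun y => expR (th * y ^+ 2)) = kth th.
Proof.
move=> th2.
have q0 : 0 < 1 - 2 * th by lra.
have s0 : 0 < kth th by rewrite invr_gt0 sqrtr_gt0.
have me := continuous_measurable_fun (@continuous_expRsqr th).
apply: ge0_Ex => //.
rewrite integral_normal//.
have k2 : kth th ^+ 2 = (1 - 2 * th)^-1 by rewrite exprVn sqr_sqrtr// ltW.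
under eq_integral => x _.
  have -> : expR (th * x ^+ 2) * normal_pdf 0 1 x =
      kth th * normal_pdf 0 (kth th) x.
    rewrite !normal_pdfE ?gt_eqF// /normal_fun mulrCA [RHS]mulrA normal_peakE//.
    congr (_ * _); rewrite -!expRD; congr expR; rewrite k2 !subr0; field.
    by rewrite gt_eqF.
  rewrite EFinM; over.
rewrite ge0_integralZl//=.
- by rewrite integral_normal_pdf mule1.
- by apply/measurable_EFinP; exact: measurable_normal_pdf.
- by move=> x _; rewrite lee_fin normal_pdf_ge0.
- by rewrite lee_fin ltW.
Qed.

Lemma L1_gauss_sin b c h : L1 gam (fun y => expR (h * y) * sin (b * y + c)).
Proof.
apply: (@L1_dom _ _ _ gam (fun y => expR (h * y))); last exact: (gauss_expR h).1.
  apply: measurable_funM; apply: continuous_measurable_fun.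
    exact: continuous_expRM.
  exact: continuous_sinMD.
by move=> y; rewrite normrM ger0_norm ?expR_ge0// ler_piMr ?expR_ge0// sin_max.
Qed.

Lemma L1_gauss_cos b c : L1 gam (fun y => cos (b * y + c)).
Proof.
apply: (@L1_bounded _ _ _ gam 1); last by move=> y; exact: cos_max.
by apply: continuous_measurable_fun => x; exact: continuous_cosMD.
Qed.

Lemma L1_gauss_sin0 b c : L1 gam (fun y => sin (b * y + c)).
Proof.
apply: (@L1_bounded _ _ _ gam 1); last by move=> y; exact: sin_max.
by apply: continuous_measurable_fun => x; exact: continuous_sinMD.
Qed.

(* The Cameron-Martin shift of the standard normal law. *)
Lemma gauss_expR_sin b c h :
  Ex gam (fun y => expR (h * y) * sin (b * y + c)) =
  expR (h ^+ 2 / 2) * (cos (b * h) * Ex gam (fun y => sin (b * y + c)) +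
                       sin (b * h) * Ex gam (fun y => cos (b * y + c))).
Proof.
(* [1 + sin] replaces [sin] because the density and substitution lemmas are for nonnegative
   functions; the contribution of [1] is subtracted at the end. *)
have E1 : Ex gam (fun y => expR (h * y) * (1 + sin (b * y + c))) =
    expR (h ^+ 2 / 2) * Ex gam (fun y => 1 + sin (b * (h + y) + c)).
  have cs : continuous (fun x : R => 1 + sin (b * x + c)).
    by move=> x; apply: cvgD; [exact: cvg_cst|exact: continuous_sinMD].
  have s0 x : 0 <= 1 + sin (b * x + c) by have := sin_geN1 (b * x + c); lra.
  have ms := continuous_measurable_fun cs.
  have me := continuous_measurable_fun (@continuous_expRM h).
  rewrite /Ex /Rintegral integral_normal//=; last exact: measurable_funM.
  under eq_integral => x _.
    have -> : expR (h * x) * (1 + sin (b * x + c)) * normal_pdf 0 1 x =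
      expR (h ^+ 2 / 2) * ((1 + sin (b * x + c)) * normal_pdf h 1 x).
      rewrite !normal_pdfE ?oner_neq0// /normal_fun.
      rewrite [LHS](_ : _ = (1 + sin (b * x + c)) * normal_peak 1 *
        (expR (h * x) * expR (- (x - 0) ^+ 2 / (1 ^+ 2 *+ 2)))); last by ring.
      rewrite [RHS](_ : _ = (1 + sin (b * x + c)) * normal_peak 1 *
        (expR (h ^+ 2 / 2) * expR (- (x - h) ^+ 2 / (1 ^+ 2 *+ 2)))); last by ring.
      by congr (_ * _); rewrite -!expRD; congr expR; field.
    rewrite EFinM; over.
  rewrite ge0_integralZl//=; last 2 first.
  - by apply/measurable_EFinP/measurable_funM => //; exact: measurable_normal_pdf.
  - by move=> x _; rewrite lee_fin mulr_ge0 ?normal_pdf_ge0.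
  rewrite -integral_normal// (integral_normal_affine h ltr01)//.
  under eq_integral do rewrite mul1r.
  have L : L1 gam (fun y : R => 1 + sin (b * (h + y) + c)).
    apply: L1D; first exact: L1_cst.
    under eq_fun do rewrite mulrDr addrAC addrC addrA.
    under eq_fun do rewrite -addrA.
    exact: L1_gauss_sin0.
  by rewrite [X in fine (_ * X)](Ex_EFin L).
have [L0 E0] := gauss_expR h.
have Ls := L1_gauss_sin b c h.
move: E1; under [in X in X = _]eq_fun do rewrite mulrDr mulr1.
rewrite ExD// E0.
under [in X in _ = X]eq_fun => y.
  have -> : 1 + sin (b * (h + y) + c) =
      1 + (cos (b * h) * sin (b * y + c) + sin (b * h) * cos (b * y + c)).
    rewrite (_ : b * (h + y) + c = b * h + (b * y + c)); last by ring.
    by rewrite sinD; ring.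
  over.
have L2 := L1_gauss_sin0 b c; have L3 := L1_gauss_cos b c.
rewrite ExD ?Ex_cst; [|exact: L1_cst|by apply: L1D; exact: L1Z].
rewrite ExD ?ExZ//; [|exact: L1Z|exact: L1Z].
by move=> H; apply: (addrI (expR (h ^+ 2 / 2))); rewrite H mulrDr mulr1.
Qed.

(** The mean [phi b] solves [phi' = - b * phi], so that [phi b * expR (b^2 / 2)] is constant.
    Instead of integrating by parts, the increment of [cos (b y + c)] when [b] becomes [b + h] is
    compared with [- (expR (h y) - 1) * sin (b y + c)]: both agree to first order in [h], and the
    Cameron-Martin shift computes the mean of the latter. *)
Lemma gauss_cos b c :
  Ex gam (fun y => cos (b * y + c)) = expR (- (b ^+ 2 / 2)) * cos c.
Proof.
pose phi b := Ex gam (fun y => cos (b * y + c)).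
pose S b := Ex gam (fun y => sin (b * y + c)).
have phi1 b' : `|phi b'| <= 1.
  rewrite -[leRHS](Ex_cst gam 1); apply: Ex_normr_le => //.
  - by apply: continuous_measurable_fun => x; exact: continuous_cosMD.
  - by move=> y; exact: cos_max.
  - exact: L1_cst.
have S1 b' : `|S b'| <= 1.
  rewrite -[leRHS](Ex_cst gam 1); apply: Ex_normr_le => //.
  - by apply: continuous_measurable_fun => x; exact: continuous_sinMD.
  - by move=> y; exact: sin_max.
  - exact: L1_cst.
have dphi b' : is_derive b' 1 phi (- b' * phi b').
  (* [16 = 4 * 4]: the factor of [step] times that of [sqr_le_expR]. The two remaining factors
     [expR |y|] combine into [expR (2 * |y|)], dominated by the sum of the two exponentials. *)
  pose g (y : R) := 16 * (expR (2 * y) + expR (-2 * y)).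
  have [[La Ea] [Lb Eb]] := (gauss_expR 2, gauss_expR (-2)).
  have Lg : L1 gam g by apply/L1Z/L1D.
  apply: (is_derive_quadratic (C := Ex gam g + (2 + 3 * b' ^+ 2))) => h h1.
  have h21 : h ^+ 2 <= 1.
    by rewrite -(real_normK (num_real h)) expr_le1// ?normr_ge0.
  have h20 := sqr_ge0 h.
  have A : `|phi (b' + h) - phi b' +
      (Ex gam (fun y => expR (h * y) * sin (b' * y + c)) - S b')| <= Ex gam g * h ^+ 2.
    have L1' := L1_gauss_cos (b' + h) c; have L2 := L1_gauss_cos b' c.
    have L3 := L1_gauss_sin b' c h; have L4 := L1_gauss_sin0 b' c.
    rewrite /phi /S -!ExB// -ExD; [|exact: (L1B L1' L2)|exact: (L1B L3 L4)].
    rewrite mulrC -ExZ//; apply: Ex_normr_le; last exact: L1Z.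
      by apply: L1_meas (L1D (L1B L1' L2) (L1B L3 L4)).
    move=> y; have -> : cos ((b' + h) * y + c) - cos (b' * y + c) +
        (expR (h * y) * sin (b' * y + c) - sin (b' * y + c)) =
        cos (b' * y + c) * (cos (h * y) - 1) +
        sin (b' * y + c) * ((expR (h * y) - 1 - h * y) - (sin (h * y) - h * y)).
      rewrite (_ : (b' + h) * y + c = (b' * y + c) + h * y); last by ring.
      by rewrite cosD; ring.
    set x := h * y.
    have ex1 := expR_norm_ge1 x.
    have cx : `|cos x - 1| <= x ^+ 2 * expR `|x|.
      by apply: (le_trans (cosB1_norm_le x)); rewrite ler_peMr ?sqr_ge0.
    have sx : `|sin x - x| <= 2 * (x ^+ 2 * expR `|x|).
      by apply: (le_trans (sinB_norm_le x)); rewrite ler_pM2l// ler_peMr ?sqr_ge0.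
    have ex := normr_expRB2_le x.
    have step : `|cos (b' * y + c) * (cos x - 1) +
        sin (b' * y + c) * ((expR x - 1 - x) - (sin x - x))| <=
        4 * (x ^+ 2 * expR `|x|).
      have := ler_normB (expR x - 1 - x) (sin x - x).
      set A1 := (expR x - 1 - x); set A2 := (sin x - x) => AB.
      apply: (le_trans (ler_normD _ _)); rewrite [`|cos _ * _|]normrM [`|sin _ * _|]normrM.
      have c1 : `|cos (b' * y + c)| * `|cos x - 1| <= `|cos x - 1|.
        by rewrite ler_piMl ?cos_max.
      have s1 : `|sin (b' * y + c)| * `|A1 - A2| <= `|A1 - A2|.
        by rewrite ler_piMl ?sin_max.
      rewrite -/A1 in ex; rewrite -/A2 in sx; lra.
    apply: (le_trans step).
    have xy : `|x| <= `|y|.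
      by rewrite normrM -[leRHS]mul1r ler_wpM2r.
    have e1 : expR `|x| <= expR `|y| by rewrite ler_expR.
    have y2 : y ^+ 2 <= 4 * expR `|y|.
      by rewrite -(real_normK (num_real y)); exact: sqr_le_expR.
    have e2 : expR `|y| * expR `|y| <= expR (2 * y) + expR (-2 * y).
      have e : `|y| + `|y| = `|2 * y| by rewrite normrM normr_nat mulr_natl mulr2n.
      by rewrite -expRD e mulNr; exact: expR_norm_le.
    rewrite /x exprMn /g.
    have ey := expR_gt0 `|y|; have exx := expR_gt0 `|x|.
    have -> : 4 * (h ^+ 2 * y ^+ 2 * expR `|h * y|) =
              h ^+ 2 * (4 * (y ^+ 2 * expR `|x|)) by rewrite /x; ring.
    rewrite ler_wpM2l//.
    have : y ^+ 2 * expR `|x| <= 4 * expR `|y| * expR `|y|.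
      by rewrite ler_pM// ?sqr_ge0 ?ltW.
    lra.
  rewrite gauss_expR_sin -/(S b') -/(phi b') in A.
  set F := expR _ * _ in A.
  have B : `|F - S b' - h * (b' * phi b')| <= (2 + 3 * b' ^+ 2) * h ^+ 2.
    have hb : h ^+ 2 / 2 <= 2^-1 by lra.
    have e1 : `|expR (h ^+ 2 / 2) - 1| <= h ^+ 2.
      apply: (le_trans (normr_expRB1_le _)).
      rewrite ger0_norm ?divr_ge0//.
      have : expR (h ^+ 2 / 2) <= 2.
        have := expR_ge1Dx (- (h ^+ 2 / 2)); have := expRxMexpNx_1 (h ^+ 2 / 2).
        have := expR_gt0 (h ^+ 2 / 2); nra.
      by nra.
    have e2 := cosB1_norm_le (b' * h).
    have e3 := sinB_norm_le (b' * h).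
    have -> : F - S b' - h * (b' * phi b') =
      (expR (h ^+ 2 / 2) - 1) * (cos (b' * h) * S b' + sin (b' * h) * phi b') +
      (cos (b' * h) - 1) * S b' + (sin (b' * h) - b' * h) * phi b'.
      by rewrite /F; ring.
    have e4 : `|cos (b' * h) * S b' + sin (b' * h) * phi b'| <= 2.
      apply: (le_trans (ler_normD _ _)); rewrite !normrM.
      have := cos_max (b' * h); have := sin_max (b' * h).
      have := S1 b'; have := phi1 b'.
      have := normr_ge0 (cos (b' * h)); have := normr_ge0 (sin (b' * h)).
      have := normr_ge0 (S b'); have := normr_ge0 (phi b'); nra.
    apply: (le_trans (ler_normD _ _)).
    apply: (le_trans (lerD (ler_normD _ _) (lexx _))); rewrite !normrM.
    rewrite (_ : (2 + 3 * b' ^+ 2) * h ^+ 2 = h ^+ 2 * 2 + (b' * h) ^+ 2 * 1 +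
      2 * (b' * h) ^+ 2 * 1); last by ring.
    by rewrite !lerD// ler_pM.
  have -> : phi (b' + h) - phi b' - h * (- b' * phi b') =
    (phi (b' + h) - phi b' + (F - S b')) - (F - S b' - h * (b' * phi b')) by ring.
  apply: (le_trans (ler_normB _ _)); rewrite mulrDl; exact: lerD.
have dG (x : R) : is_derive x 1 (fun x => phi x * expR (x ^+ 2 / 2)) 0.
  have h : is_derive x 1 (phi * (expR \o (2^-1 *: (id * id))))
     (phi x *: (expR (2^-1 * (x * x)) * (2^-1 *: (x *: 1 + x *: 1))) +
      expR (2^-1 * (x * x)) *: (- x * phi x)).
    exact: is_deriveM.
  have -> : (fun x => phi x * expR (x ^+ 2 / 2)) = phi * (expR \o (2^-1 *: (id * id))).
    by apply/funext => z; rewrite !fctE/= expr2 /GRing.scale/= [_ / 2]mulrC.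
  by apply: is_derive_eq; rewrite /GRing.scale/=; field.
have := is_derive_0_is_cst b 0 dG.
rewrite expr0n /= mul0r expR0 mulr1 => H.
have phi0 : phi 0 = cos c.
  rewrite /phi; under eq_fun do rewrite mul0r add0r.
  exact: Ex_cst.
rewrite -/(phi b) -phi0 -H mulrC -mulrA -expRD subrr expR0 mulr1 //.
Qed.

End standard_normal.

(** * Gaussian vectors *)

Section gaussian_vectors.
Context {R : realType}.
Local Notation gam := (normal_prob 0 1 : probability (measurableTypeR R) R).

Lemma Ex_normal_affine (m s : R) (f : R -> R) : 0 < s -> continuous f ->
  (forall x, 0 <= f x) ->
  Ex (normal_prob m s : probability (measurableTypeR R) R) f =
  Ex gam (fun x => f (m + s * x)).
Proof.
move=> s0 cf f0.
have mf := continuous_measurable_fun cf.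
have cF : continuous (fun x : R => m + s * x).
  by move=> x; apply: cvgD; [exact: cvg_cst|apply: cvgM; [exact: cvg_cst|exact: cvg_id]].
have mfF : measurable_fun setT (fun x : R => f (m + s * x)).
  exact: measurableT_comp mf (continuous_measurable_fun cF).
exact: (congr1 fine (integral_normal_affine m s0 cf f0)).
Qed.

Lemma normal_affine_bounded (m s M : R) (f : R -> R) : 0 < s -> continuous f ->
  (forall x, `|f x| <= M) ->
  Ex (normal_prob m s : probability (measurableTypeR R) R) f =
  Ex gam (fun x => f (m + s * x)).
Proof.
move=> s0 cf fM.
have mf := continuous_measurable_fun cf.
have cF : continuous (fun x : R => m + s * x).
  by move=> x; apply: cvgD; [exact: cvg_cst|apply: cvgM; [exact: cvg_cst|exact: cvg_id]].
have mfF : measurable_fun setT (fun x : measurableTypeR R => f (m + s * x)).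
  exact: measurableT_comp mf (continuous_measurable_fun cF).
have g0 x : 0 <= f x + M by have := fM x; rewrite ler_norml => /andP[]; lra.
have cg : continuous (fun x => f x + M).
  by move=> x; apply: cvgD; [exact: cf|exact: cvg_cst].
have H := Ex_normal_affine m s0 cg g0.
have L (P : probability (measurableTypeR R) R) : L1 P f.
  by apply: (@L1_bounded _ _ _ P M f).
have L' : L1 gam (fun x : measurableTypeR R => f (m + s * x)).
  by apply: (@L1_bounded _ _ _ gam M) => // x; exact: fM.
have H1 := ExD (L (normal_prob m s)) (L1_cst _ M); have H2 := ExD L' (L1_cst _ M).
rewrite Ex_cst in H1; rewrite Ex_cst in H2.
exact: (addIr M (etrans (esym H1) (etrans H H2))).
Qed.

Definition quad (J : finType) (C : J -> J -> R) (a : J -> R) : R :=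
  \sum_i \sum_j a i * a j * C i j.

(* Centred Gaussian vectors of covariance [C], through their Laplace and Fourier transforms. *)
Definition gvec (J : finType) (C : J -> J -> R) d (T : measurableType d)
    (P : probability T R) (X : J -> T -> R) : Prop :=
  (forall j, measurable_fun setT (X j)) /\
  forall a : J -> R,
    [/\ L1 P (fun w => expR (\sum_j a j * X j w)),
        Ex P (fun w => expR (\sum_j a j * X j w)) = expR (quad C a / 2)
      & forall c, Ex P (fun w => cos (\sum_j a j * X j w + c)) =
                  expR (- (quad C a / 2)) * cos c].

Section gvec_lemmas.
Context {d : measure_display} {T : measurableType d} (P : probability T R).
Variables (J : finType).
Implicit Types (C : J -> J -> R) (X : J -> T -> R).

Lemma measurable_lin X (a : J -> R) : (forall j, measurable_fun setT (X j)) ->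
  measurable_fun setT (fun w => \sum_j a j * X j w).
Proof.
move=> mX; apply: measurable_sum => j.
by apply: measurable_funM => //; exact: measurable_cst.
Qed.

Lemma L1_cos_lin X (a : J -> R) c : (forall j, measurable_fun setT (X j)) ->
  L1 P (fun w => cos (\sum_j a j * X j w + c)).
Proof.
move=> mX; apply: (@L1_bounded _ _ _ P 1); last by move=> w; exact: cos_max.
apply: measurableT_comp.
  by apply: continuous_measurable_fun; exact: continuous_cos.
by apply: measurable_funD; [exact: measurable_lin|exact: measurable_cst].
Qed.

Lemma quadZ C (a : J -> R) k : quad (fun i j => k ^+ 2 * C i j) a = quad C (fun j => k * a j).
Proof.
rewrite /quad; apply: eq_bigr => i _; apply: eq_bigr => j _; ring.
Qed.

Lemma gvecZ C X k : gvec C P X -> gvec (fun i j => k ^+ 2 * C i j) P (fun j w => k * X j w).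
Proof.
move=> [mX gX]; split=> [j|a].
  by apply: measurable_funM => //; exact: measurable_cst.
have [g1 g2 g3] := gX (fun j => k * a j).
have e w : \sum_j a j * (k * X j w) = \sum_j k * a j * X j w.
  by apply: eq_bigr => j _; ring.
under [X in L1 _ X]eq_fun do rewrite e.
under [X in Ex _ X = expR _]eq_fun do rewrite e.
split; [exact: g1|by rewrite quadZ|move=> c].
by under [X in Ex _ X]eq_fun do rewrite e; rewrite g3 quadZ.
Qed.

End gvec_lemmas.

Section gvec_prod.
Context {d1 d2 : measure_display} {T1 : measurableType d1} {T2 : measurableType d2}.
Variables (P1 : probability T1 R) (P2 : probability T2 R) (J : finType).
Variables (C1 C2 : J -> J -> R) (X1 : J -> T1 -> R) (X2 : J -> T2 -> R).

Lemma gvecD : gvec C1 P1 X1 -> gvec C2 P2 X2 ->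
  gvec (fun i j => C1 i j + C2 i j) (P1 \x P2)%E (fun j z => X1 j z.1 + X2 j z.2).
Proof.
move=> [m1 g1] [m2 g2]; split=> [j|a].
  apply: measurable_funD.
    exact: measurableT_comp (m1 j) measurable_fst.
  exact: measurableT_comp (m2 j) measurable_snd.
have [a1 a2 a3] := g1 a; have [b1 b2 b3] := g2 a.
have e (z : T1 * T2) : \sum_j a j * (X1 j z.1 + X2 j z.2) =
    \sum_j a j * X1 j z.1 + \sum_j a j * X2 j z.2.
  by rewrite -big_split; apply: eq_bigr => j _; rewrite mulrDr.
have qD : quad (fun i j => C1 i j + C2 i j) a = quad C1 a + quad C2 a.
  rewrite /quad -big_split; apply: eq_bigr => i _; rewrite -big_split.
  by apply: eq_bigr => j _; rewrite mulrDr.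
split.
- under eq_fun do rewrite e expRD.
  exact: (L1_prod a1 b1).
- under eq_fun do rewrite e expRD.
  by rewrite (Ex_prod a1 b1) a2 b2 -expRD qD mulrDl.
- move=> c.
  under eq_fun => z.
    rewrite e.
    (* In the addition formula the sines are written as cosines shifted by [pi / 2], the only form
       that [gvec] covers. *)
    have -> : cos (\sum_j a j * X1 j z.1 + \sum_j a j * X2 j z.2 + c) =
       cos (\sum_j a j * X1 j z.1 + c) * cos (\sum_j a j * X2 j z.2 + 0) +
       (- 1) * (cos (\sum_j a j * X1 j z.1 + (c - pi / 2)) *
       cos (\sum_j a j * X2 j z.2 + - (pi / 2))).
      rewrite addr0 addrA !cosBpihalf mulN1r -cosD; congr cos; ring.
    over.
  have c1 c' := L1_cos_lin P1 a c' m1.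
  have c2 c' := L1_cos_lin P2 a c' m2.
  rewrite ExD ?ExZ; [|exact: (L1_prod (c1 _) (c2 _))|exact: (L1_prod (c1 _) (c2 _))|exact: L1Z (L1_prod (c1 _) (c2 _))].
  rewrite (Ex_prod (c1 _) (c2 _)) (Ex_prod (c1 _) (c2 _)) !a3 !b3.
  have -> : expR (- (quad (fun i j => C1 i j + C2 i j) a / 2)) =
      expR (- (quad C1 a / 2)) * expR (- (quad C2 a / 2)).
    by rewrite -expRD qD; congr expR; ring.
  rewrite cosN cos_pihalf cos0; ring.
Qed.

End gvec_prod.

(** The fully degenerate vector: all the coordinates are one and the same normal variable. Rescaled,
    it is the noise common to all configurations that the interpolation puts in place of the
    Hamiltonian. *)
Lemma gvec_gauss (J : finType) :
  gvec (fun _ _ : J => 1) gam (fun _ y => y).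
Proof.
split=> [j|a]; first exact: measurable_id.
have qE : quad (fun _ _ : J => 1) a = (\sum_j a j) ^+ 2.
  rewrite /quad expr2 mulr_suml; apply: eq_bigr => i _.
  by rewrite mulr_sumr; apply: eq_bigr => j _; rewrite mulr1.
have e (y : R) : \sum_j a j * y = (\sum_j a j) * y by rewrite mulr_suml.
have [h1 h2] := gauss_expR (\sum_j a j).
split.
- by under eq_fun do rewrite e.
- by under eq_fun do rewrite e; rewrite h2 qE.
- by move=> c; under eq_fun do rewrite e; rewrite gauss_cos qE.
Qed.


Section law.
Context {d d' : measure_display} {T : measurableType d} {T' : measurableType d'}.
Variables (P : probability T R) (Q : probability T' R) (Y : T -> T').
Hypothesis mY : measurable_fun setT Y.
Hypothesis PQ : forall A, measurable A -> P (Y @^-1` A) = Q A.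

Let ge0_integral_law (f : T' -> \bar R) : measurable_fun setT f ->
  (forall x, 0 <= f x)%E -> (\int[P]_x f (Y x) = \int[Q]_x f x)%E.
Proof.
move=> mf f0.
have := @ge0_integral_pushforward _ _ _ _ _ _ mY P setT f measurableT mf (fun x _ => f0 x).
rewrite preimage_setT => <-.
by apply: eq_measure_integral => A mA _; exact: PQ.
Qed.

Lemma L1_law (f : T' -> R) : measurable_fun setT f -> L1 Q f -> L1 P (fun x => f (Y x)).
Proof.
move=> mf /integrableP[_ fQ]; apply/integrableP; split.
  by apply/measurable_EFinP; exact: measurableT_comp mf mY.
move: fQ; rewrite -ge0_integral_law//.
by apply: measurableT_comp => //; exact/measurable_EFinP.
Qed.

Lemma ge0_Ex_law (f : T' -> R) : measurable_fun setT f -> (forall x, 0 <= f x) ->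
  Ex P (fun x => f (Y x)) = Ex Q f.
Proof.
move=> mf f0; rewrite /Ex /Rintegral; congr fine.
by apply: ge0_integral_law => //; exact/measurable_EFinP.
Qed.

Lemma Ex_law_bounded (f : T' -> R) (M : R) : measurable_fun setT f ->
  (forall x, `|f x| <= M) -> Ex P (fun x => f (Y x)) = Ex Q f.
Proof.
move=> mf fM.
have fQ : L1 Q f by exact: L1_bounded mf fM.
have fP := L1_law mf fQ.
have H : Ex P (fun x => f (Y x) + M) = Ex Q (fun y => f y + M).
  apply: (ge0_Ex_law (f := fun y => f y + M)).
    by apply: measurable_funD => //; exact: measurable_cst.
  by move=> x; have := fM x; rewrite ler_norml => /andP[]; lra.
move: H; rewrite (ExD fP (L1_cst P M)) (ExD fQ (L1_cst Q M)) !Ex_cst.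
exact: addIr.
Qed.

End law.

(** Uniqueness of a Taylor expansion of order two; it is used to read the mean and the variance off
    a Laplace transform. *)
Lemma taylor2_unique (p q C : R) :
  (forall u : R, `|u| <= 1 -> `|p * u + q * u ^+ 2| <= C * `|u| ^+ 3) -> p = 0 /\ q = 0.
Proof.
move=> H.
have C0 : 0 <= C.
  have := H 1; rewrite normr1 lexx !expr1n !mulr1 => /(_ isT).
  exact: le_trans (normr_ge0 _).
have small (r K : R) : 0 <= K ->
    (forall u, 0 < u -> u <= 1 -> `|r| <= K * u) -> r = 0.
  move=> K0 h; apply/eqP; rewrite -normr_eq0 eq_le normr_ge0 andbT.
  apply/ler_addgt0Pl => e e0; rewrite addr0.
  have u0 : 0 < Num.min 1 (e / (K + 1)) by rewrite lt_min ltr01 divr_gt0// ltr_wpDl.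
  apply: (le_trans (h _ u0 _)); first by rewrite ge_min lexx.
  apply: (@le_trans _ _ (K * (e / (K + 1)))).
    by rewrite ler_wpM2l// ge_min lexx orbT.
  by rewrite mulrA ler_pdivrMr ?ltr_wpDl//; nra.
have p0 : p = 0.
  apply: (small _ (C + `|q|)); first by rewrite addr_ge0.
  move=> u u0 u1.
  have := H u; rewrite gtr0_norm// => /(_ u1) h.
  have : `|p| * u <= C * u ^+ 3 + `|q| * u ^+ 2.
    rewrite -{1}(gtr0_norm u0) -normrM.
    have -> : p * u = (p * u + q * u ^+ 2) - q * u ^+ 2 by ring.
    apply: (le_trans (ler_normB _ _)); rewrite lerD// normrM.
    by rewrite (@ger0_norm _ (u ^+ 2)) ?sqr_ge0.
  have -> : C * u ^+ 3 + `|q| * u ^+ 2 = (C * u ^+ 2 + `|q| * u) * u by ring.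
  rewrite ler_pM2r// => h2; apply: (le_trans h2).
  rewrite mulrDl lerD2r ler_wpM2l// expr2 ler_piMl// ltW//.
split=> //; apply: (small _ C) => // u u0 u1.
have := H u; rewrite gtr0_norm// => /(_ u1); rewrite p0 mul0r add0r normrM.
rewrite (@ger0_norm _ (u ^+ 2)) ?sqr_ge0//.
have -> : C * u ^+ 3 = C * u * u ^+ 2 by ring.
by rewrite ler_pM2r// exprn_gt0.
Qed.

(** * Gaussian laws: transforms, mean and variance *)

Section is_gaussian.
Context {d : measure_display} {T : measurableType d} (P : probability T R).
Variables (Y : T -> R).
Hypothesis mY : measurable_fun setT Y.

Lemma is_gaussian_mgf_cf : is_gaussian P Y -> exists m v : R,
  [/\ forall u : R, L1 P (fun w => expR (u * Y w)),
      forall u : R, Ex P (fun w => expR (u * Y w)) = expR (u * m + u ^+ 2 * v / 2)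
    & forall c, Ex P (fun w => cos (Y w + c)) = expR (- (v / 2)) * cos (m + c)].
Proof.
move=> [m [v [v0 gY]]]; exists m, v.
have mcos c : measurable_fun setT (fun y : measurableTypeR R => cos (y + c)).
  apply: continuous_measurable_fun => x.
  apply: (@cvg_comp _ _ _ (fun x : R => x + c) cos _ (nbhs (x + c))); last exact: continuous_cos.
  by apply: cvgD; [exact: cvg_id|exact: cvg_cst].
have mexp u : measurable_fun setT (fun y : measurableTypeR R => expR (u * y)).
  exact: continuous_measurable_fun (@continuous_expRM R u).
move: gY; rewrite /gaussian_law.
case: (eqVneq v 0) => [->|v1] gY.
  pose D : probability (measurableTypeR R) R := dirac (m : measurableTypeR R).
  have PD A : measurable A -> P (Y @^-1` A) = D A by exact: gY.
  have LD (f : measurableTypeR R -> R) : measurable_fun setT f -> (\int[D]_x (f x)%:E)%E = (f m)%:E.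
    by move=> mf; rewrite integral_dirac//= ?diracT ?mul1e//; exact/measurable_EFinP.
  have ge u : L1 D (fun y : measurableTypeR R => expR (u * y)) /\
      Ex D (fun y : measurableTypeR R => expR (u * y)) = expR (u * m).
    by apply: ge0_Ex => //; exact: LD.
  split=> [u|u|c].
  - exact: (L1_law (Q := D) mY PD (mexp u) (ge u).1).
  - rewrite (ge0_Ex_law (Q := D) mY PD (mexp u))// (ge u).2 mulr0 mul0r addr0//.
  - rewrite (Ex_law_bounded (Q := D) mY PD (mcos c) (fun x => cos_max _)).
    by rewrite /Ex /Rintegral LD//= mul0r oppr0 expR0 mul1r.
have s0 : 0 < Num.sqrt v by rewrite sqrtr_gt0 lt_def v1.
pose D := (normal_prob m (Num.sqrt v) : probability (measurableTypeR R) R).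
have PD A : measurable A -> P (Y @^-1` A) = D A by exact: gY.
have ge u := normal_expR m u s0.
split=> [u|u|c].
- exact: (L1_law (Q := D) mY PD (mexp u) (ge u).1).
- by rewrite (ge0_Ex_law (Q := D) mY PD (mexp u))// (ge u).2 sqr_sqrtr.
- rewrite (Ex_law_bounded (Q := D) mY PD (mcos c) (fun x => cos_max _)).
  rewrite (@normal_affine_bounded m (Num.sqrt v) 1 (fun y => cos (y + c)) s0).
  + under eq_fun => x.
      have -> : m + Num.sqrt v * x + c = Num.sqrt v * x + (m + c) by ring.
      over.
    by rewrite gauss_cos sqr_sqrtr.
  + move=> x.
    apply: (@cvg_comp _ _ _ (fun x : R => x + c) cos _ (nbhs (x + c))); last exact: continuous_cos.
    by apply: cvgD; [exact: cvg_id|exact: cvg_cst].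
  + by move=> x; exact: cos_max.
Qed.

Lemma L1_sqr_of_expR : (forall u : R, L1 P (fun w => expR (u * Y w))) ->
  L1 P (fun w => Y w ^+ 2).
Proof.
move=> LY.
apply: (@L1_dom _ _ _ P (fun w => 4 * (expR (1 * Y w) + expR (-1 * Y w)))).
- exact: measurable_funX.
- move=> w; rewrite ger0_norm ?sqr_ge0// -(real_normK (num_real (Y w))).
  apply: (le_trans (sqr_le_expR (normr_ge0 _))); rewrite ler_pM2l//.
  by rewrite mul1r mulN1r; exact: expR_norm_le.
- by apply: L1Z; exact: L1D.
Qed.

Lemma L1_of_expR : (forall u : R, L1 P (fun w => expR (u * Y w))) -> L1 P Y.
Proof.
move=> LY; have L2 := L1_sqr_of_expR LY.
apply: (@L1_dom _ _ _ P (fun w => 1 + Y w ^+ 2)) => //; last by apply: L1D => //; exact: L1_cst.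
move=> w; rewrite -(real_normK (num_real (Y w))); have := normr_ge0 (Y w); nra.
Qed.

(** Both expressions of the Laplace transform are expanded at [u = 0] to second order with a cubic
    error, and the coefficients are compared. *)
Lemma mgf_mean_variance (m v : R) : (forall u : R, L1 P (fun w => expR (u * Y w))) ->
  (forall u : R, Ex P (fun w => expR (u * Y w)) = expR (u * m + u ^+ 2 * v / 2)) ->
  m = Ex P Y /\ v = Ex P (fun w => Y w ^+ 2) - m ^+ 2.
Proof.
move=> LY EY; have L2 := L1_sqr_of_expR LY; have L1Y := L1_of_expR LY.
(* [|y|^3 <= 27 * expR |y|] is the cube of [|y| / 3 <= expR (|y| / 3)]; a second [expR |y|] comes
   from the Taylor remainder. *)
pose g w : R := 27 * (expR (2 * Y w) + expR (-2 * Y w)).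
have Lg : L1 P g by apply: L1Z; exact: L1D.
pose K : R := `|m| + `|v|.
pose C := Ex P g + (K ^+ 3 * expR K + K ^+ 2).
suff [h1 h2] : Ex P Y - m = 0 /\ (Ex P (fun w => Y w ^+ 2) - m ^+ 2 - v) / 2 = 0.
  by split; lra.
apply: (@taylor2_unique _ _ C) => u u1.
have A : `|Ex P (fun w => expR (u * Y w)) - (1 + u * Ex P Y + u ^+ 2 / 2 * Ex P (fun w => Y w ^+ 2))|
    <= Ex P g * `|u| ^+ 3.
  rewrite -(ExZ _ L1Y) -(ExZ _ L2) -{1}(Ex_cst P 1).
  rewrite -(ExD (L1_cst P 1) (L1Z u L1Y)) -(ExD _ (L1Z _ L2)); last first.
    by apply: L1D; [exact: L1_cst|exact: L1Z].
  have LL : L1 P (fun w => 1 + u * Y w + u ^+ 2 / 2 * Y w ^+ 2).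
    by apply: L1D; [apply: L1D; [exact: L1_cst|exact: L1Z]|exact: L1Z].
  rewrite -(ExB (LY u) LL) [Ex P g * _]mulrC -(ExZ _ Lg).
  apply: Ex_normr_le; last exact: L1Z.
    exact: L1_meas (L1B (LY u) LL).
  move=> w; set y := Y w.
  have -> : expR (u * y) - (1 + u * y + u ^+ 2 / 2 * y ^+ 2) =
     expR (u * y) - 1 - u * y - (u * y) ^+ 2 / 2 by field.
  apply: (le_trans (normr_expRB3_le _)); rewrite normrM exprMn -mulrA ler_wpM2l ?exprn_ge0//.
  have e1 : expR (`|u| * `|y|) <= expR `|y| by rewrite ler_expR ler_piMl.
  have y3 : `|y| ^+ 3 <= 27 * expR `|y|.
    have h0 := normr_ge0 y; have h := expR_ge1Dx (`|y| / 3).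
    have -> : expR `|y| = expR (`|y| / 3) ^+ 3.
      by rewrite -expRM_natl; congr expR; field.
    have h1 : `|y| / 3 <= expR (`|y| / 3) by lra.
    have -> : `|y| ^+ 3 = 27 * (`|y| / 3) ^+ 3 by field.
    by rewrite ler_pM2l// lerXn2r// nnegrE ?expR_ge0// divr_ge0.
  have e2 : expR `|y| * expR `|y| <= expR (2 * y) + expR (-2 * y).
    have e : `|y| + `|y| = `|2 * y| by rewrite normrM normr_nat mulr_natl mulr2n.
    by rewrite -expRD e mulNr; exact: expR_norm_le.
  rewrite /g -/y; apply: (@le_trans _ _ (27 * expR `|y| * expR `|y|)).
    by rewrite ler_pM// ?exprn_ge0.
  by rewrite -mulrA ler_pM2l.
pose x := u * m + u ^+ 2 * v / 2.
have u0 := normr_ge0 u.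
have K0 : 0 <= K by rewrite addr_ge0.
have m0 := normr_ge0 m; have v0 := normr_ge0 v.
have uu : `|u| ^+ 2 <= `|u| by rewrite expr2 ler_piMl.
have xK : `|x| <= K * `|u|.
  apply: (le_trans (ler_normD _ _)); rewrite !normrM (@ger0_norm _ 2^-1)// -?expr2.
  by rewrite /K; nra.
have B : `|expR x - 1 - x - x ^+ 2 / 2| <= K ^+ 3 * expR K * `|u| ^+ 3.
  apply: (le_trans (normr_expRB3_le _)).
  rewrite [leRHS]mulrAC -exprMn ler_pM ?exprn_ge0 ?expR_ge0//.
    by rewrite lerXn2r ?nnegrE ?mulr_ge0.
  by rewrite ler_expR (le_trans xK)// ler_piMr.
have D : `|x ^+ 2 / 2 - u ^+ 2 * m ^+ 2 / 2| <= K ^+ 2 * `|u| ^+ 3.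
  have -> : x ^+ 2 / 2 - u ^+ 2 * m ^+ 2 / 2 = u ^+ 2 * v / 4 * (x + u * m).
    by rewrite /x; field.
  rewrite !normrM (@ger0_norm _ 4^-1)// -?expr2.
  have h : `|x + u * m| <= 2 * K * `|u|.
    apply: (le_trans (ler_normD _ _)); rewrite normrM.
    have : `|m| <= K by rewrite /K lerDl. nra.
  have vK : `|v| <= K by rewrite /K lerDr.
  apply: (@le_trans _ _ (`|u| ^+ 2 * K / 4 * (2 * K * `|u|))).
    by rewrite ler_pM ?mulr_ge0 ?exprn_ge0// ler_pM2r// ler_wpM2l ?exprn_ge0.
  have -> : `|u| ^+ 2 * K / 4 * (2 * K * `|u|) = (K ^+ 2 * `|u| ^+ 3) / 2 by field.
  have : 0 <= K ^+ 2 * `|u| ^+ 3 by rewrite mulr_ge0 ?exprn_ge0. lra.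
rewrite EY -/x in A.
have -> : (Ex P Y - m) * u + (Ex P (fun w => Y w ^+ 2) - m ^+ 2 - v) / 2 * u ^+ 2 =
  - (expR x - (1 + u * Ex P Y + u ^+ 2 / 2 * Ex P (fun w => Y w ^+ 2))) +
  ((expR x - 1 - x - x ^+ 2 / 2) + (x ^+ 2 / 2 - u ^+ 2 * m ^+ 2 / 2)).
  by rewrite /x; field.
apply: (le_trans (ler_normD _ _)); rewrite normrN.
apply: (le_trans (lerD A (ler_normD _ _))).
apply: (le_trans (lerD (lexx _) (lerD B D))).
by rewrite /C; lra.
Qed.

End is_gaussian.

Section process.
Context {d : measure_display} {T : measurableType d} (P : probability T R).

(** By definition a linear combination of the process is Gaussian, of unknown parameters. Moments of
    all orders being available, [mgf_mean_variance] identifies these with [0] and the quadratic form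
    of the covariance. *)
Lemma gvec_process (I : Type) (X : I -> {RV P >-> R}) (C : I -> I -> R) :
  gaussian_process X -> (forall s, ('E_P[X s] = 0)%E) ->
  (forall s s', 'E_P[X s \* X s']%E = (C s s')%:E) ->
  forall (J : finType) (t : J -> I),
    gvec (fun i j => C (t i) (t j)) P (fun j => X (t j)).
Proof.
move=> GX X0 XC J t.
have mX i : measurable_fun setT (X i) by exact: measurable_funPT.
have eJ (w : T) (a : J -> R) : \sum_j a j * X (t j) w =
    \sum_(k < #|J|) a (enum_val k) * X (t (enum_val k)) w.
  by rewrite [RHS](reindex enum_rank) /=;
    [apply: eq_bigr => j _; rewrite enum_rankK | exists enum_val => x _; rewrite ?enum_rankK ?enum_valK].
have lin (a : J -> R) : exists m v : R,
  [/\ forall u : R, L1 P (fun w => expR (u * (\sum_j a j * X (t j) w))),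
      forall u : R, Ex P (fun w => expR (u * (\sum_j a j * X (t j) w))) =
         expR (u * m + u ^+ 2 * v / 2)
    & forall c, Ex P (fun w => cos (\sum_j a j * X (t j) w + c)) =
         expR (- (v / 2)) * cos (m + c)].
  apply: is_gaussian_mgf_cf.
    by apply: measurable_lin => j; exact: mX.
  have := GX #|J| (fun k => t (enum_val k)) (fun k => a (enum_val k)).
  by under [X in is_gaussian _ X -> _]eq_fun do rewrite -eJ.
have LX2 j : L1 P (fun w => X (t j) w ^+ 2).
  have [m [v [h _ _]]] := lin (fun i => (i == j)%:R).
  apply: L1_sqr_of_expR => // u.
  under eq_fun => w.
    rewrite (_ : X (t j) w = \sum_i (i == j)%:R * X (t i) w); last first.
      rewrite (bigD1 j)//= eqxx mul1r big1 ?addr0// => i /negbTE ->.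
      by rewrite mul0r.
    over.
  exact: h.
have LX j : L1 P (X (t j)).
  apply: (@L1_dom _ _ _ P (fun w => 1 + X (t j) w ^+ 2)) => //.
    by move=> w; rewrite -(real_normK (num_real (X (t j) w)));
      have := normr_ge0 (X (t j) w); nra.
  by apply: L1D => //; exact: L1_cst.
have LXX i j : L1 P (fun w => X (t i) w * X (t j) w).
  apply: (@L1_dom _ _ _ P (fun w => X (t i) w ^+ 2 + X (t j) w ^+ 2)).
  - exact: measurable_funM.
  - move=> w; rewrite normrM -!(real_normK (num_real (X _ w))).
    by have := sqr_ge0 (`|X (t i) w| - `|X (t j) w|); nra.
  - exact: L1D.
have EX j : Ex P (X (t j)) = 0.
  by have := X0 (t j); rewrite unlock Ex_EFin// => -[].
have EXX i j : Ex P (fun w => X (t i) w * X (t j) w) = C (t i) (t j).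
  by have := XC (t i) (t j); rewrite unlock (Ex_EFin (LXX i j)) => -[].
split=> [j|a]; first exact: mX.
have [m [v [h1 h2 h3]]] := lin a.
have mlin : measurable_fun setT (fun w => \sum_j a j * X (t j) w).
  by apply: measurable_lin => j; exact: mX.
have [mE vE] := mgf_mean_variance mlin h1 h2.
have m0 : m = 0.
  rewrite mE Ex_sum => [|j]; last exact: L1Z.
  by rewrite big1// => j _; rewrite ExZ// EX mulr0.
have vq : v = quad (fun i j => C (t i) (t j)) a.
  rewrite vE m0 expr0n subr0 /quad.
  under eq_fun => w.
    rewrite expr2 mulr_suml; under eq_bigr do rewrite mulr_sumr.
    over.
  rewrite Ex_sum => [|i].
    apply: eq_bigr => i _; rewrite Ex_sum => [|j].
      apply: eq_bigr => j _.
      under eq_fun do rewrite mulrACA.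
      by rewrite ExZ// EXX.
    under eq_fun do rewrite mulrACA.
    exact: L1Z.
  apply: L1_sum => j; under eq_fun do rewrite mulrACA.
  exact: L1Z.
rewrite -vq; split=> [||c].
- by have := h1 1; under eq_fun do rewrite mul1r.
- by have := h2 1; under eq_fun do rewrite mul1r; rewrite m0 mulr0 add0r expr1n mul1r.
- by rewrite h3 m0 add0r.
Qed.

End process.

End gaussian_vectors.

(** * Bernstein polynomials *)

Section bernstein.
Context {R : realType}.
Implicit Types (g h : nat -> R) (x : R).

(** Conditioning on the first of [n] tosses of a coin of parameter [x]: the value at [x] is the mean
    of [g] at the number of successes. The recursion takes the place of binomial coefficients. *)
Fixpoint bernstein n g : {poly R} :=
  if n is m.+1 then 'X * bernstein m (g \o S) + (1 - 'X) * bernstein m g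
  else (g 0%N)%:P.

Lemma bernsteinS n g x : (bernstein n.+1 g).[x] =
  x * (bernstein n (g \o S)).[x] + (1 - x) * (bernstein n g).[x].
Proof. by rewrite /= !hornerE. Qed.

Lemma le_bernstein n g h x : 0 <= x <= 1 ->
  (forall k, (k <= n)%N -> g k <= h k) -> (bernstein n g).[x] <= (bernstein n h).[x].
Proof.
move=> /andP[x0 x1]; elim: n g h => [|n IH] g h gh.
  by rewrite /= !hornerE gh.
rewrite !bernsteinS lerD// ler_wpM2l ?subr_ge0//; apply: IH => k kn /=; apply: gh => //.
exact: leqW.
Qed.

(** The first two moments of the binomial law, of mean [n x] and variance [n x (1 - x)]. *)
Lemma bernstein_quad n (a b c x : R) :
  (bernstein n (fun k => a + b * k%:R + c * k%:R ^+ 2)).[x] =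
  a + b * (n%:R * x) + c * (n%:R * x * (1 - x) + (n%:R * x) ^+ 2).
Proof.
elim: n a b c => [|n IH] a b c; first by rewrite /= hornerC mulr0n; ring.
rewrite bernsteinS IH.
have -> : (fun k : nat => a + b * k%:R + c * k%:R ^+ 2) \o S =
  (fun k : nat => (a + b + c) + (b + 2 * c) * k%:R + c * k%:R ^+ 2).
  by apply/funext => k /=; rewrite -natr1; ring.
by rewrite IH -natr1; ring.
Qed.

Lemma bernstein_bounded n g x (M : R) : 0 <= x <= 1 ->
  (forall k, `|g k| <= M) -> `|(bernstein n g).[x]| <= M.
Proof.
move=> x01 gM; rewrite ler_norml.
have e r : (bernstein n (fun=> r)).[x] = r.
  have -> : (fun=> r) = (fun k : nat => r + 0 * k%:R + 0 * k%:R ^+ 2).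
    by apply/funext => k; rewrite !mul0r !addr0.
  by rewrite bernstein_quad; ring.
by rewrite -[leLHS](e (- M)) -[X in _ && (_ <= X)](e M) !le_bernstein// => k _;
  have := gM k; rewrite ler_norml => /andP[].
Qed.

(** Chebyshev's argument in terms of order: at the nodes, [f] lies between two parabolas [q (-1)]
    and [q 1] with summit [f x] up to [e], their curvature [2 * M / d^2] accounting for the nodes at
    distance [d] or more from [x]. The Bernstein polynomials of parabolas are explicit. *)
Lemma bernstein_approx n (f : R -> R) (x e d M : R) : (0 < n)%N -> 0 <= x <= 1 ->
  0 < d -> (forall y, `|f y| <= M) ->
  (forall y : R, 0 <= y <= 1 -> `|y - x| < d -> `|f y - f x| <= e) ->
  `|(bernstein n (fun k => f (k%:R / n%:R))).[x] - f x| <= e + 2 * M / d ^+ 2 / n%:R.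
Proof.
move=> n0 x01 d0 fM fe.
have nR : 0 < n%:R :> R by rewrite ltr0n.
have M0 : 0 <= M := le_trans (normr_ge0 _) (fM 0).
have K0 : 0 <= 2 * M / d ^+ 2 by apply: divr_ge0; [exact: mulr_ge0|exact: sqr_ge0].
have e0 : 0 <= e by have := fe x x01; rewrite !subrr normr0 => /(_ d0).
pose q (s : R) (k : nat) := f x + s * (e + 2 * M / d ^+ 2 * (k%:R / n%:R - x) ^+ 2).
have qE s : (bernstein n (q s)).[x] =
    f x + s * (e + 2 * M / d ^+ 2 * (x * (1 - x) / n%:R)).
  have -> : q s = fun k => (f x + s * (e + 2 * M / d ^+ 2 * x ^+ 2)) +
    (- (s * (2 * M / d ^+ 2) * (2 * x / n%:R))) * k%:R +
    (s * (2 * M / d ^+ 2) / n%:R ^+ 2) * k%:R ^+ 2.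
    by apply/funext => k; rewrite /q; field; rewrite ?gt_eqF.
  by rewrite bernstein_quad; field; rewrite !gt_eqF.
have qf k : (k <= n)%N -> `|f (k%:R / n%:R) - f x| <=
    e + 2 * M / d ^+ 2 * (k%:R / n%:R - x) ^+ 2.
  move=> kn; set y := k%:R / n%:R.
  have y01 : 0 <= y <= 1 by rewrite divr_ge0//= ler_pdivrMr// mul1r ler_nat.
  have [yx|xy] := ltP `|y - x| d.
    by rewrite (le_trans (fe y y01 yx))// lerDl mulr_ge0 ?sqr_ge0.
  apply: (@le_trans _ _ (2 * M)).
    by rewrite (le_trans (ler_normB _ _))//; have := fM y; have := fM x; lra.
  rewrite -[leLHS]add0r lerD// mulrAC ler_pdivlMr ?exprn_gt0// ler_wpM2l ?mulr_ge0//.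
  by rewrite -(real_normK (num_real (y - x))) lerXn2r// nnegrE ?normr_ge0// ltW.
have bd : 2 * M / d ^+ 2 * (x * (1 - x) / n%:R) <= 2 * M / d ^+ 2 / n%:R.
  rewrite mulrA ler_pM2r ?invr_gt0// ler_piMr//.
  by case/andP: x01 => x0 x1; nra.
have h1 : (bernstein n (q (-1))).[x] <= (bernstein n (fun k => f (k%:R / n%:R))).[x].
  apply: le_bernstein => // k kn; have := qf k kn; rewrite ler_norml /q => /andP[]; lra.
have h2 : (bernstein n (fun k => f (k%:R / n%:R))).[x] <= (bernstein n (q 1)).[x].
  apply: le_bernstein => // k kn; have := qf k kn; rewrite ler_norml /q => /andP[]; lra.
rewrite !qE in h1 h2; rewrite ler_norml; apply/andP; split; lra.
Qed.

Lemma bernstein_cvg (f : R -> R) (x M : R) : 0 <= x <= 1 ->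
  {for x, continuous f} -> (forall y, `|f y| <= M) ->
  (bernstein n (fun k => f (k%:R / n%:R))).[x] @[n --> \oo] --> f x.
Proof.
move=> x01 cf fM; apply/cvgrPdist_le => /= e e0.
have M0 : 0 <= M := le_trans (normr_ge0 _) (fM 0).
have e20 : 0 < e / 2 by rewrite divr_gt0.
have [d /= d0 fd] : \forall d \near 0^'+, forall y : R, `|y - x| < d -> `|f y - f x| <= e / 2.
  move/cvgrPdist_le : cf => /(_ _ e20) [d /= d0 H]; exists d => //= d' /= dd' d'0 y yx.
  rewrite distrC; apply: H => /=; rewrite distrC (lt_trans yx)//.
  by move: dd'; rewrite sub0r normrN gtr0_norm.
have d20 : 0 < d / 2 by rewrite divr_gt0.
have {}fd y : `|y - x| < d / 2 -> `|f y - f x| <= e / 2.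
  by apply: fd => //=; rewrite sub0r normrN gtr0_norm// ltr_pdivrMr// mulr_natr mulr2n ltrDl.
near=> n.
have n0 : (0 < n)%N by near: n; exists 1%N.
rewrite distrC; apply: (le_trans (@bernstein_approx n f x (e / 2) (d / 2) M n0 x01 d20 fM _)).
  by move=> y _; exact: fd.
set K := 2 * M / (d / 2) ^+ 2.
have K0 : 0 <= K by apply: divr_ge0; [exact: mulr_ge0|exact: sqr_ge0].
suff : K / n%:R <= e / 2 by lra.
rewrite ler_pdivrMr ?ltr0n// -ler_pdivrMl//.
near: n; exact: nbhs_infty_ger.
Unshelve. all: by end_near. Qed.

Lemma weierstrass (f : R -> R) (e : R) : continuous f -> 0 < e ->
  exists p : {poly R}, forall x : R, 0 <= x <= 1 -> `|p.[x] - f x| <= e.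
Proof.
move=> cf e0.
have e20 : 0 < e / 2 by rewrite divr_gt0.
have [d d0 fd] : exists2 d : R, 0 < d & forall x : R, 0 <= x <= 1 ->
    forall y : R, `|y - x| < d -> `|f y - f x| <= e / 2.
  have cK := @segment_compact R 0 1.
  move/compact_near_coveringP : cK.
  move=> /(_ _ (0 : R)^'+ (fun d x => forall y : R, `|y - x| < d -> `|f y - f x| <= e / 2) _).
  case.
    move=> x _; have e40 : 0 < e / 4 by rewrite divr_gt0.
    have /cvgrPdist_le/(_ _ e40)[r /= r0 H] := cf x.
    have r20 : 0 < r / 2 by rewrite divr_gt0.
    exists (ball x (r / 2), [set d | 0 < d < r / 2]) => /=.
      split; first exact: nbhsx_ballx.
      exists (r / 2) => //= d; rewrite /= sub0r normrN => dr d0.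
      by rewrite d0/=; move: dr; rewrite gtr0_norm.
    move=> [z d] /= [xz /andP[d0 dr]] y yz.
    have h1 : `|f x - f z| <= e / 4.
      by apply: H => /=; rewrite (lt_trans xz)// ltr_pdivrMr// mulr_natr mulr2n ltrDl.
    have h2 : `|f x - f y| <= e / 4.
      apply: H => /=; rewrite (_ : x - y = (x - z) - (y - z)); last by ring.
      by rewrite (le_lt_trans (ler_normB _ _))//; move: xz; rewrite /ball/=; lra.
    rewrite (_ : f y - f z = (f x - f z) - (f x - f y)); last by ring.
    by rewrite (le_trans (ler_normB _ _))//; lra.
  move=> r /= r0 H; exists (r / 2); first by rewrite divr_gt0.
  move=> x x01; apply: (H (r / 2)) => //=.
  - by rewrite sub0r normrN gtr0_norm ?divr_gt0// ltr_pdivrMr// mulr_natr mulr2n ltrDl.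
  - by rewrite divr_gt0.
have [M fM] : exists M : R, forall x : R, 0 <= x <= 1 -> `|f x| <= M.
  have [c1 _ h1] := EVT_max ler01 (continuous_subspaceT cf).
  have [c2 _ h2] := EVT_min ler01 (continuous_subspaceT cf).
  exists (`|f c1| + `|f c2|) => x x01.
  have := h1 x; rewrite in_itv/= => /(_ x01) u1; have := h2 x; rewrite in_itv/= => /(_ x01) u2.
  have := ler_norm (f c1); have := ler_norm (- f c2); rewrite normrN.
  by rewrite ler_norml; have := normr_ge0 (f c1); have := normr_ge0 (f c2); lra.
(* Composing with the projection on the segment makes the function bounded on the whole line, as
   [bernstein_approx] requires. *)
pose clamp (x : R) := Num.max 0 (Num.min 1 x).
have c01 x : 0 <= clamp x <= 1.
  by rewrite /clamp le_max lexx /= ge_max ler01 /= ge_min lexx.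
have cl x : 0 <= x <= 1 -> clamp x = x.
  by move=> /andP[x0 x1]; rewrite /clamp (min_idPr x1) (max_idPr x0).
pose f' x := f (clamp x).
have f'M x : `|f' x| <= M by exact: fM.
have M0 : 0 <= M := le_trans (normr_ge0 _) (f'M 0).
pose K := 2 * M / d ^+ 2.
have K0 : 0 <= K by apply: divr_ge0; [exact: mulr_ge0|exact: sqr_ge0].
pose n := (Num.trunc (K / (e / 2))).+1.
exists (bernstein n (fun k => f' (k%:R / n%:R))) => x x01.
have := @bernstein_approx n f' x (e / 2) d M (ltn0Sn _) x01 d0 f'M.
rewrite -{2}(cl x x01) -/(f' x) => h; rewrite -(cl x x01) -/(f' x) [clamp x]cl//.
apply: (le_trans (h _)).
  by move=> y y01 yx; rewrite /f' !cl//; exact: fd.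
rewrite -/K.
suff : K / n%:R <= e / 2 by lra.
rewrite ler_pdivrMr ?ltr0n// -ler_pdivrMl// mulrC.
by apply/ltW; apply: truncnS_gt.
Qed.

End bernstein.

(** * Laws of Gaussian vectors *)

Section trigonometric.
Context {R : realType}.
Variable J : finType.
Implicit Types (f g : (J -> R) -> R) (a x : J -> R).

Definition trig_eval (s : seq (R * (J -> R) * R)) x : R :=
  \sum_(p <- s) p.1.1 * cos (\sum_j p.1.2 j * x j + p.2).

(** Trigonometric polynomials are an algebra, by the product formula for cosines, and their means
    depend on the covariance alone: they are the test functions from which [gvec_law] starts. *)
Definition trig f := exists s, forall x, f x = trig_eval s x.

Lemma trigD f g : trig f -> trig g -> trig (fun x => f x + g x).
Proof.
move=> [s sE] [t tE]; exists (s ++ t) => x.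
by rewrite sE tE /trig_eval big_cat.
Qed.

Lemma trig_cos a c : trig (fun x => cos (\sum_j a j * x j + c)).
Proof. by exists [:: (1, a, c)] => x; rewrite /trig_eval big_seq1 mul1r. Qed.

Lemma trigZ k f : trig f -> trig (fun x => k * f x).
Proof.
move=> [s sE]; exists [seq (k * p.1.1, p.1.2, p.2) | p <- s] => x.
by rewrite sE /trig_eval big_map mulr_sumr; apply: eq_bigr => p _; rewrite mulrA.
Qed.

Lemma trig_cst k : trig (fun=> k).
Proof.
have := trigZ k (trig_cos (fun=> 0) 0).
congr trig; apply/funext => x.
by rewrite big1 ?addr0 ?cos0 ?mulr1// => j _; rewrite mul0r.
Qed.

Lemma trig_sum (I : Type) (r : seq I) (F : I -> (J -> R) -> R) :
  (forall i, trig (F i)) -> trig (fun x => \sum_(i <- r) F i x).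
Proof.
move=> FT; elim: r => [|i r IH].
  by under eq_fun do rewrite big_nil; exact: trig_cst.
by under eq_fun do rewrite big_cons; exact: trigD.
Qed.

Lemma trigM f g : trig f -> trig g -> trig (fun x => f x * g x).
Proof.
move=> [s sE] [t tE].
have -> : (fun x => f x * g x) = (fun x => \sum_(p <- s) \sum_(q <- t)
   (p.1.1 * q.1.1 / 2) *
   (cos (\sum_j (p.1.2 j + q.1.2 j) * x j + (p.2 + q.2)) +
    cos (\sum_j (p.1.2 j - q.1.2 j) * x j + (p.2 - q.2)))).
  apply/funext => x; rewrite sE tE /trig_eval mulr_suml.
  apply: eq_bigr => p _; rewrite mulr_sumr; apply: eq_bigr => q _.
  have -> : \sum_j (p.1.2 j + q.1.2 j) * x j + (p.2 + q.2) =
      (\sum_j p.1.2 j * x j + p.2) + (\sum_j q.1.2 j * x j + q.2).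
    under eq_bigr do rewrite mulrDl.
    by rewrite big_split /=; ring.
  have -> : \sum_j (p.1.2 j - q.1.2 j) * x j + (p.2 - q.2) =
      (\sum_j p.1.2 j * x j + p.2) - (\sum_j q.1.2 j * x j + q.2).
    under eq_bigr do rewrite mulrBl.
    by rewrite big_split /= sumrN; ring.
  by move: (\sum_j p.1.2 j * x j + p.2) (\sum_j q.1.2 j * x j + q.2) => A B; rewrite cosD cosB; field.
apply: trig_sum => p; apply: trig_sum => q.
by apply/trigZ/trigD; exact: trig_cos.
Qed.

Lemma trig_prod (I : Type) (r : seq I) (F : I -> (J -> R) -> R) :
  (forall i, trig (F i)) -> trig (fun x => \prod_(i <- r) F i x).
Proof.
move=> FT; elim: r => [|i r IH].
  by under eq_fun do rewrite big_nil; exact: trig_cst.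
by under eq_fun do rewrite big_cons; exact: trigM.
Qed.

Lemma trig_horner (p : {poly R}) f : trig f -> trig (fun x => p.[f x]).
Proof.
move=> fT; elim/poly_ind: p => [|p c IH].
  by under eq_fun do rewrite horner0; exact: trig_cst.
under eq_fun do rewrite hornerMXaddC.
by apply: trigD; [exact: trigM|exact: trig_cst].
Qed.

Lemma trig_sin (k : R) j : trig (fun x => sin (k * x j)).
Proof.
have := trig_cos (fun i => if i == j then k else 0) (- (pi / 2)).
congr trig; apply/funext => x; rewrite cosBpihalf; congr sin.
rewrite (bigD1 j)//= eqxx big1 ?addr0// => i /negbTE ->.
by rewrite mul0r.
Qed.

End trigonometric.

Section law_of_gaussian_vectors.
Context {R : realType}.

Lemma trig_gvec (J : finType) (C : J -> J -> R) d (T : measurableType d)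
    (P : probability T R) (X : J -> T -> R) : gvec C P X ->
  forall s, Ex P (fun w => trig_eval s (fun j => X j w)) =
    \sum_(p <- s) p.1.1 * (expR (- (quad C p.1.2 / 2)) * cos p.2).
Proof.
move=> [mX gX] s; rewrite /trig_eval Ex_sum => [|p].
  apply: eq_bigr => p _; rewrite ExZ; last exact: L1_cos_lin.
  by have [_ _ ->] := gX p.1.2.
by apply: L1Z; exact: L1_cos_lin.
Qed.

(** It expresses [psi x] through [s = (1 + sin (x / (m + 1))) / 2], which lies in [[0, 1]] where
    Bernstein polynomials apply, as long as [|x| <= m + 1]. Clamping at [sin 1 < 1] keeps [asin]
    away from the end points of its domain, hence continuous. *)
Definition sin_clamp (psi : R -> R) (m : nat) (s : R) : R :=
  psi (m.+1%:R * asin (Num.max (- sin 1) (Num.min (sin 1) (2 * s - 1)))).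

Lemma sin1_bounds : 0 < sin (1 : R) < 1.
Proof.
have s0 : 0 < sin (1 : R) by apply: sin2_gt0; rewrite ltr01 ltr1n.
rewrite s0 /= lt_neqAle sin_le1 andbT; apply/eqP => s1.
have := cos1_gt0 R; have := cos2Dsin2 (1 : R); rewrite s1 expr1n.
by move=> h c0; have := exprn_gt0 2 c0; lra.
Qed.

Lemma continuous_sin_clamp psi m : continuous psi -> continuous (sin_clamp psi m).
Proof.
move=> cpsi s; rewrite /sin_clamp.
have /andP[s0 s1] := sin1_bounds.
pose c : R := Num.max (- sin 1) (Num.min (sin 1) (2 * s - 1)).
have c1 : -1 < c < 1.
  rewrite /c lt_max ltrN2 s1 /= gt_max (lt_trans _ ltr01) ?oppr_lt0//=.
  by rewrite gt_min s1.
apply: (@cvg_comp _ _ _ (fun s : R => m.+1%:R * asin (Num.max (- sin 1) (Num.min (sin 1) (2 * s - 1)))) psi _ (nbhs (m.+1%:R * asin c))); last exact: cpsi.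
apply: cvgM; first exact: cvg_cst.
apply: (@cvg_comp _ _ _ (fun s : R => Num.max (- sin 1) (Num.min (sin 1) (2 * s - 1))) asin _ (nbhs c)); last exact: continuous_asin.
have := @continuous_max R R (cst (- sin 1)) (fun s => Num.min (sin 1) (2 * s - 1)) s; apply.
  exact: cvg_cst.
have := @continuous_min R R (cst (sin 1)) (fun s => 2 * s - 1) s; apply.
  exact: cvg_cst.
by apply: cvgB; [apply: cvgM; [exact: cvg_cst|exact: cvg_id]|exact: cvg_cst].
Qed.

Lemma sin_clampE psi m x : `|x| <= m.+1%:R ->
  sin_clamp psi m ((1 + sin (m.+1%:R^-1 * x)) / 2) = psi x.
Proof.
move=> xm; rewrite /sin_clamp.
have m0 : 0 < m.+1%:R :> R by rewrite ltr0n.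
set u := m.+1%:R^-1 * x.
have u1 : `|u| <= 1.
  by rewrite /u normrM normfV (gtr0_norm m0) ler_pdivrMl// mulr1.
have pi1 := pihalf_ge1 R.
have mono (y z : R) : - (pi / 2) <= y -> y <= z -> z <= pi / 2 -> sin y <= sin z.
  move=> y1; rewrite le_eqVlt => /predU1P[->//|yz] z1; apply/ltW.
  by rewrite ltr_sin// in_itv/=; lra.
have -> : 2 * ((1 + sin u) / 2) - 1 = sin u by field.
move: (u1); rewrite ler_norml => /andP[ul ur].
have su : sin u <= sin 1 by apply: mono; lra.
have sl : - sin 1 <= sin u by rewrite -sinN; apply: mono; lra.
rewrite (min_idPr su) (max_idPr sl) sinK; last by rewrite in_itv/=; lra.
by rewrite /u mulrA divff ?mul1r// gt_eqF.
Qed.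

Lemma cvg_bigprod (I : Type) (r : seq I) (f : nat -> I -> R) (l : I -> R) :
  (forall i, f n i @[n --> \oo] --> l i) ->
  \prod_(i <- r) f n i @[n --> \oo] --> \prod_(i <- r) l i.
Proof.
move=> fl; elim: r => [|i r IH].
  by rewrite big_nil; under eq_fun do rewrite big_nil; exact: cvg_cst.
by rewrite big_cons; under eq_fun do rewrite big_cons; exact: cvgM.
Qed.

(** Two bounded limits lead from trigonometric polynomials to [psi]: the degree [n] of a Bernstein
    polynomial in [sin (x / (m + 1))], then [m]. Products of functions of one coordinate are enough,
    since [expR (- lam * W)] factorises over the configurations. *)
Lemma gvec_law (J : finType) (C : J -> J -> R)
    d1 (T1 : measurableType d1) (P1 : probability T1 R) (X1 : J -> T1 -> R)
    d2 (T2 : measurableType d2) (P2 : probability T2 R) (X2 : J -> T2 -> R)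
    (psi : J -> R -> R) (M : R) :
  gvec C P1 X1 -> gvec C P2 X2 -> (forall j, continuous (psi j)) ->
  (forall j x, `|psi j x| <= M) ->
  Ex P1 (fun w => \prod_j psi j (X1 j w)) = Ex P2 (fun w => \prod_j psi j (X2 j w)).
Proof.
move=> g1 g2 cpsi psiM.
pose F (h : J -> R -> R) (x : J -> R) := \prod_j h j (x j).
have lim_law (h : nat -> J -> R -> R) (l : J -> R -> R) :
    (forall n j, continuous (h n j)) -> (forall j, continuous (l j)) ->
    (forall n j x, `|h n j x| <= M) ->
    (forall j x, h n j x @[n --> \oo] --> l j x) ->
    (forall n, Ex P1 (fun w => F (h n) (X1 ^~ w)) = Ex P2 (fun w => F (h n) (X2 ^~ w))) ->
    Ex P1 (fun w => F l (X1 ^~ w)) = Ex P2 (fun w => F l (X2 ^~ w)).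
  move=> ch cl hM hl he.
  have lim d (T : measurableType d) (P : probability T R) (X : J -> T -> R) : gvec C P X ->
      Ex P (fun w => F (h n) (X ^~ w)) @[n --> \oo] --> Ex P (fun w => F l (X ^~ w)).
    move=> [mX _].
    have mF h' : (forall j, continuous (h' j)) -> measurable_fun setT (fun w => F h' (X ^~ w)).
      move=> ch'; apply: measurable_prod => j _.
      apply: measurableT_comp; last exact: mX.
      by apply: continuous_measurable_fun; exact: ch'.
    apply: (@Ex_dominated _ _ _ P _ _ (fun=> \prod_(j : J) M)).
    - by move=> n; exact: mF.
    - exact: mF.
    - move=> w; rewrite /F; by apply: cvg_bigprod => j; exact: hl.
    - exact: L1_cst.
    - by move=> n w; rewrite normr_prod; apply: ler_prod => j _; rewrite normr_ge0 hM.
  have c1 := lim _ _ _ _ g1; have c2 := lim _ _ _ _ g2.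
  rewrite -(cvg_lim (@Rhausdorff R) c1) -(cvg_lim (@Rhausdorff R) c2).
  by under eq_fun do rewrite he.
pose sn m (x : R) := (1 + sin (m.+1%:R^-1 * x)) / 2.
have csn m : continuous (sn m).
  move=> x; rewrite /sn; apply: cvgM; last exact: cvg_cst.
  apply: cvgD; first exact: cvg_cst.
  apply: (@cvg_comp _ _ _ (fun x : R => m.+1%:R^-1 * x) sin _ (nbhs (m.+1%:R^-1 * x))); last exact: continuous_sin.
  by apply: cvgM; [exact: cvg_cst|exact: cvg_id].
have sn01 m x : 0 <= sn m x <= 1.
  have := sin_geN1 (m.+1%:R^-1 * x); have := sin_le1 (m.+1%:R^-1 * x).
  by rewrite /sn => *; apply/andP; split; lra.
have step m : Ex P1 (fun w => F (fun j x => sin_clamp (psi j) m (sn m x)) (X1 ^~ w)) =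
              Ex P2 (fun w => F (fun j x => sin_clamp (psi j) m (sn m x)) (X2 ^~ w)).
  apply: (lim_law (fun n j x => (bernstein n (fun k => sin_clamp (psi j) m (k%:R / n%:R))).[sn m x])).
  - move=> n j x; apply: (@cvg_comp _ _ _ (sn m) (horner (bernstein n _)) _ (nbhs (sn m x))); last exact: continuous_horner.
    exact: csn.
  - move=> j x; apply: (@cvg_comp _ _ _ (sn m) (sin_clamp (psi j) m) _ (nbhs (sn m x))); first exact: csn.
    exact: continuous_sin_clamp.
  - by move=> n j x; apply: bernstein_bounded => // k; exact: psiM.
  - move=> j x; apply: (bernstein_cvg (M := M)) => //.
      exact: continuous_sin_clamp.
    by move=> y; exact: psiM.
  - move=> n.
    have [s /funext sE] : trig (F (fun j x => (bernstein n (fun k => sin_clamp (psi j) m (k%:R / n%:R))).[sn m x])).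
      apply: trig_prod => j; apply: trig_horner.
      rewrite /sn; under eq_fun do rewrite mulrC.
      by apply/trigZ/trigD; [exact: trig_cst|exact: trig_sin].
    by rewrite sE (trig_gvec g1) (trig_gvec g2).
apply: (lim_law (fun m j x => sin_clamp (psi j) m (sn m x))) => //.
- move=> m j x; apply: (@cvg_comp _ _ _ (sn m) (sin_clamp (psi j) m) _ (nbhs (sn m x))); first exact: csn.
  exact: continuous_sin_clamp.
- by move=> m j x; exact: psiM.
- move=> j x; apply: cvg_near_cst; near=> m; apply: sin_clampE.
  apply: (@le_trans _ _ m%:R); last by rewrite ler_nat.
  near: m; exact: nbhs_infty_ger.
Unshelve. all: by end_near. Qed.

End law_of_gaussian_vectors.

(** * Lindeberg's method *)

Section uniform_means.
Context {R : realType} {S : finType}.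
Implicit Types f g : S -> R.
Local Notation avg := uniform_mean.

Lemma avgD f g : avg (fun s => f s + g s) = avg f + avg g.
Proof. by rewrite /uniform_mean big_split /= mulrDl. Qed.

Lemma avgZ k f : avg (fun s => k * f s) = k * avg f.
Proof. by rewrite /uniform_mean -mulr_sumr mulrA. Qed.

Lemma avgB f g : avg (fun s => f s - g s) = avg f - avg g.
Proof. by rewrite /uniform_mean sumrB mulrBl. Qed.

Lemma avg_cst (k : R) : (0 < #|S|)%N -> avg (fun _ : S => k) = k.
Proof.
move=> S0; rewrite /uniform_mean sumr_const -[k *+ _]mulr_natr -mulrA divff ?mulr1//.
by rewrite pnatr_eq0 -lt0n.
Qed.

Lemma avg_le f g : (forall s, f s <= g s) -> avg f <= avg g.
Proof. by move=> fg; rewrite /uniform_mean ler_wpM2r ?invr_ge0// ler_sum. Qed.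

Lemma avg_ge0 f : (forall s, 0 <= f s) -> 0 <= avg f.
Proof. by move=> f0; rewrite /uniform_mean divr_ge0// sumr_ge0. Qed.

Lemma normr_avg f : `|avg f| <= avg (fun s => `|f s|).
Proof.
rewrite /uniform_mean normrM (@ger0_norm _ (_^-1)) ?invr_ge0//.
by rewrite ler_wpM2r ?invr_ge0// ler_norm_sum.
Qed.

Lemma eq_avg f g : f =1 g -> avg f = avg g.
Proof. by move=> fg; congr (_ / _); exact: eq_bigr. Qed.

Lemma avg_mul f g : avg f * avg g = avg (fun s => avg (fun s' => f s * g s')).
Proof. by rewrite mulrC -avgZ; apply: eq_avg => s; rewrite avgZ mulrC. Qed.

Lemma avg_sqr_le f : (0 < #|S|)%N -> avg f ^+ 2 <= avg (fun s => f s ^+ 2).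
Proof.
move=> S0; rewrite -subr_ge0.
have -> : avg (fun s => f s ^+ 2) - avg f ^+ 2 = avg (fun s => (f s - avg f) ^+ 2).
  under [RHS]eq_avg => s.
    have -> : (f s - avg f) ^+ 2 = f s ^+ 2 - (2 * avg f) * f s + avg f ^+ 2 by ring.
    over.
  by rewrite avgD avgB avgZ avg_cst//; ring.
by apply: avg_ge0 => s; exact: sqr_ge0.
Qed.

Lemma avg_exp4_le f : (0 < #|S|)%N -> avg f ^+ 4 <= avg (fun s => f s ^+ 4).
Proof.
move=> S0; rewrite (exprM _ 2 2).
apply: (@le_trans _ _ (avg (fun s => f s ^+ 2) ^+ 2)).
  rewrite lerXn2r ?nnegrE ?sqr_ge0 ?avg_sqr_le//.
  by apply: avg_ge0 => s; exact: sqr_ge0.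
apply: (le_trans (avg_sqr_le _ S0)).
by apply: avg_le => s; rewrite -exprM.
Qed.

End uniform_means.

Lemma avg_exchange {R : realType} {S S' : finType} (f : S -> S' -> R) :
  uniform_mean (fun s => uniform_mean (fun s' => f s s')) =
  uniform_mean (fun s' => uniform_mean (fun s => f s s')).
Proof.
rewrite /uniform_mean -!mulr_suml exchange_big -!mulrA; congr (_ * _).
by rewrite mulrC.
Qed.

Section mean_expectation.
Context {R : realType} {S : finType} {d : measure_display} {T : measurableType d}.
Variable P : probability T R.

Lemma L1_avg (F : S -> T -> R) : (forall s, L1 P (F s)) ->
  L1 P (fun w => uniform_mean (F ^~ w)).
Proof.
move=> F1; under eq_fun do rewrite /uniform_mean mulrC.
by apply/L1Z/L1_sum.
Qed.

Lemma Ex_avg (F : S -> T -> R) : (forall s, L1 P (F s)) ->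
  Ex P (fun w => uniform_mean (F ^~ w)) = uniform_mean (fun s => Ex P (F s)).
Proof.
move=> F1; rewrite /uniform_mean; under [in LHS]eq_fun do rewrite mulrC.
rewrite ExZ; last exact: L1_sum.
by rewrite Ex_sum// mulrC.
Qed.

Lemma measurable_avg (F : S -> T -> R) : (forall s, measurable_fun setT (F s)) ->
  measurable_fun setT (fun w => uniform_mean (F ^~ w)).
Proof.
move=> mF; apply: measurable_funM; last exact: measurable_cst.
exact: measurable_sum.
Qed.

End mean_expectation.

Section reindex.
Context {R : realType}.

Lemma fiber_sum (J K : finType) (s : K -> J) (z : K -> R) (g : J -> R) :
  \sum_j (\sum_(k | s k == j) z k) * g j = \sum_k z k * g (s k).
Proof.
under eq_bigr do rewrite mulr_suml.
rewrite (exchange_big_dep xpredT)//=; apply: eq_bigr => k _.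
rewrite (big_pred1 (s k))// => j; by rewrite eq_sym.
Qed.

(** [s] may repeat coordinates, in which case coefficients add up over its fibres. Products of
    weights at replicas that may coincide are thus treated at once. *)
Lemma gvec_reindex (J K : finType) (C : J -> J -> R) d (T : measurableType d)
    (P : probability T R) (X : J -> T -> R) (s : K -> J) :
  gvec C P X -> gvec (fun k l => C (s k) (s l)) P (fun k => X (s k)).
Proof.
move=> [mX gX]; split=> [k|z]; first exact: mX.
have [h1 h2 h3] := gX (fun j => \sum_(k | s k == j) z k).
have e w : \sum_j (\sum_(k | s k == j) z k) * X j w = \sum_k z k * X (s k) w.
  exact: (fiber_sum s z (X ^~ w)).
have q : quad C (fun j => \sum_(k | s k == j) z k) = quad (fun k l => C (s k) (s l)) z.
  rewrite /quad.
  under eq_bigr => i _.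
    under eq_bigr do rewrite -mulrA.
    rewrite -mulr_sumr (fiber_sum s z (C i)); over.
  rewrite (fiber_sum s z (fun i => \sum_k z k * C i (s k))).
  by apply: eq_bigr => k _; rewrite mulr_sumr; apply: eq_bigr => l _; rewrite mulrA.
rewrite -q; split.
- by move: h1; under eq_fun do rewrite e.
- by move: h2; under eq_fun do rewrite e.
- by move=> c; have := h3 c; under eq_fun do rewrite e.
Qed.

End reindex.

Section weights.
Context {R : realType} {S : finType}.
Variables (C : S -> S -> R) (d : measure_display) (T : measurableType d).
Variables (P : probability T R) (X : S -> T -> R).
Hypothesis gX : gvec C P X.
Hypothesis Csym : forall s s', C s s' = C s' s.

Definition wt s w := expR (X s w - C s s / 2).

Lemma wt_ge0 s w : 0 <= wt s w. Proof. exact: expR_ge0. Qed.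

Lemma measurable_wt s : measurable_fun setT (wt s).
Proof.
apply: measurableT_comp; first exact: measurable_expR.
by apply: measurable_funB; [exact: gX.1|exact: measurable_cst].
Qed.

Lemma wt_exp s k :
  L1 P (fun w => wt s w ^+ k) /\
  Ex P (fun w => wt s w ^+ k) = expR ((k%:R ^+ 2 - k%:R) / 2 * C s s).
Proof.
have [h1 h2 _] := (gvec_reindex (fun _ : 'I_1 => s) gX).2 (fun=> k%:R).
have e w : wt s w ^+ k = expR (- (k%:R * C s s / 2)) * expR (\sum_(j < 1) k%:R * X s w).
  by rewrite big_ord1 /wt -expRM_natl -expRD; congr expR; ring.
under [X in L1 _ X]eq_fun do rewrite e.
under [X in Ex _ X]eq_fun do rewrite e.
split; first exact: L1Z.
by rewrite ExZ// h2 /quad !big_ord1 -expRD; congr expR; field.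
Qed.

Lemma wt_pair s s' :
  L1 P (fun w => wt s w * wt s' w) /\ Ex P (fun w => wt s w * wt s' w) = expR (C s s').
Proof.
have [h1 h2 _] := (gvec_reindex (fun i : 'I_2 => if i == ord0 then s else s') gX).2 (fun=> 1).
have e w : wt s w * wt s' w = expR (- ((C s s + C s' s') / 2)) *
   expR (\sum_(i < 2) 1 * X (if i == ord0 then s else s') w).
  by rewrite big_ord_recl big_ord1 /= /wt -!expRD; congr expR; rewrite !mul1r; field.
under [X in L1 _ X]eq_fun do rewrite e.
under [X in Ex _ X]eq_fun do rewrite e.
split; first exact: L1Z.
rewrite ExZ// h2 /quad !big_ord_recl !big_ord0 /= -expRD; congr expR.
by rewrite !mul1r (Csym s' s); field.
Qed.

Lemma wt_one s : L1 P (wt s) /\ Ex P (wt s) = 1.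
Proof.
have [h1 h2] := wt_exp s 1.
split; first by move: h1; under eq_fun do rewrite expr1.
move: h2; under eq_fun do rewrite expr1.
by move=> ->; rewrite expr1n subrr !mul0r expR0.
Qed.

End weights.

(** * Effect of a small independent Gaussian field on the Laplace transform *)

Section lindeberg.
Context {R : realType} {S : finType}.
Local Notation avg := uniform_mean.
Hypothesis S0 : (0 < #|S|)%N.

(** There is no factor [expR |h|] in the error, so that a third moment of the increment suffices.
    For [h <= 0], the growth is absorbed by [expR (- u)] because [|h| <= u]; for [h > 1], every term
    is bounded by a multiple of [h^3]. *)
Lemma expRN_taylor2 (u h : R) : 0 <= u -> 0 <= u + h ->
  `|expR (- (u + h)) - expR (- u) * (1 - h + h ^+ 2 / 2)| <= (3 + expR 1) * `|h| ^+ 3.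
Proof.
move=> u0 uh0.
have -> : expR (- (u + h)) - expR (- u) * (1 - h + h ^+ 2 / 2) =
  expR (- u) * (expR (- h) - 1 - (- h) - (- h) ^+ 2 / 2).
  by rewrite opprD expRD; field.
rewrite normrM (ger0_norm (expR_ge0 _)).
have e1 : 1 <= expR (1 : R) by have := expR_ge1Dx (1 : R); lra.
have h30 : 0 <= `|h| ^+ 3 by rewrite exprn_ge0.
have eu : expR (- u) <= 1 by rewrite -expR0 ler_expR oppr_le0.
have B := normr_expRB3_le (- h); rewrite normrN in B.
have [h0|h0] := leP h 0.
  have e : expR (- u) * expR `|h| <= 1.
    by rewrite -expRD -[leRHS]expR0 ler_expR ler0_norm//; lra.
  apply: (@le_trans _ _ (expR (- u) * (`|h| ^+ 3 * expR `|h|))).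
    by rewrite ler_wpM2l ?expR_ge0.
  have -> : expR (- u) * (`|h| ^+ 3 * expR `|h|) = (expR (- u) * expR `|h|) * `|h| ^+ 3 by ring.
  by rewrite ler_wpM2r//; lra.
apply: (@le_trans _ _ `|expR (- h) - 1 - - h - (- h) ^+ 2 / 2|).
  by rewrite ler_piMl.
have [h1|h1] := leP h 1.
  apply: (le_trans B); rewrite mulrC ler_wpM2r//.
  have : expR `|h| <= expR 1 by rewrite ler_expR gtr0_norm.
  lra.
have eh : `|expR (- h) - 1| <= 1.
  have := expR_gt0 (- h); have : expR (- h) <= 1 by rewrite -expR0 ler_expR; lra.
  by rewrite ler_norml; lra.
have hh : h <= h ^+ 3 by rewrite -[leLHS]expr1 ler_eXn2l// ltW.
have h2 : h ^+ 2 <= h ^+ 3 by rewrite ler_eXn2l// ltW.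
have : `|expR (- h) - 1 - - h - (- h) ^+ 2 / 2| <= 1 + h + h ^+ 2 / 2.
  rewrite sqrrN; move: eh; rewrite !ler_norml => /andP[a1 a2]; apply/andP.
  by have := sqr_ge0 h; split; lra.
rewrite (gtr0_norm h0); nra.
Qed.

Definition laplace (lam : R) (W : R) := expR (- (lam * W)).

Section step.
Variables (C D : S -> S -> R).
Variables (d1 d2 : measure_display) (T1 : measurableType d1) (T2 : measurableType d2).
Variables (P : probability T1 R) (Q : probability T2 R).
Variables (X : S -> T1 -> R) (Y : S -> T2 -> R) (lam c0 eta : R).
Hypotheses (gX : gvec C P X) (gY : gvec D Q Y).
Hypotheses (Csym : forall s s', C s s' = C s' s) (Dsym : forall s s', D s s' = D s' s).
Hypotheses (lam0 : 0 <= lam) (Cc : forall s, C s s <= c0) (c00 : 0 <= c0).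
Hypotheses (D0 : forall s, 0 <= D s s) (De : forall s, D s s <= eta ^+ 2).
Hypotheses (eta0 : 0 < eta) (eta1 : eta <= 1).

Local Notation w := (wt C X).
Local Notation m := (wt D Y).
Local Notation W := (fun x => avg (fun s => w s x)).

Let Delta (z : T1 * T2) : R := avg (fun s => w s z.1 * (m s z.2 - 1)).

Let W0 x : 0 <= W x. Proof. by apply: avg_ge0 => s; exact: wt_ge0. Qed.

Let WD z : W z.1 + Delta z = avg (fun s => w s z.1 * m s z.2).
Proof. by rewrite /Delta -avgD; apply: eq_avg => s; ring. Qed.

Let mW : measurable_fun setT W.
Proof. by apply: measurable_avg => s; exact: (measurable_wt gX). Qed.

Let lapW_le1 x : laplace lam (W x) <= 1.
Proof. by rewrite /laplace -expR0 ler_expR oppr_le0 mulr_ge0. Qed.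

Let mlap : measurable_fun setT (fun x => laplace lam (W x)).
Proof.
rewrite /laplace; apply: measurableT_comp; first exact: measurable_expR.
under eq_fun do rewrite -mulNr.
by apply: measurable_funM; [exact: measurable_cst|exact: mW].
Qed.

Let L1lap (f : T1 -> R) : L1 P f -> L1 P (fun x => laplace lam (W x) * f x).
Proof.
move=> f1; apply: (L1_dom _ _ (L1_norm f1)).
  by apply: measurable_funM; [exact: mlap|exact: (L1_meas f1)].
by move=> x; rewrite normrM (ger0_norm (expR_ge0 _)) ler_piMl// lapW_le1.
Qed.

Let mDelta : measurable_fun setT Delta.
Proof.
apply: measurable_avg => s; apply: measurable_funM.
  exact: measurableT_comp (measurable_wt gX s) measurable_fst.
apply: measurable_funB; last exact: measurable_cst.
exact: measurableT_comp (measurable_wt gY s) measurable_snd.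
Qed.

Let L1m s : L1 Q (fun y => m s y - 1).
Proof. by apply: L1B; [exact: (wt_one gY s).1|exact: L1_cst]. Qed.

Let Em s : Ex Q (fun y => m s y - 1) = 0.
Proof. by rewrite ExB ?Ex_cst ?(wt_one gY s).2 ?subrr//; [exact: (wt_one gY s).1|exact: L1_cst]. Qed.

Let mm_expand s s' y : (m s y - 1) * (m s' y - 1) = m s y * m s' y - m s y - m s' y + 1.
Proof. ring. Qed.

Let L1mm s s' : L1 Q (fun y => (m s y - 1) * (m s' y - 1)).
Proof.
under eq_fun do rewrite mm_expand.
apply: L1D; last exact: L1_cst.
apply: L1B; last exact: (wt_one gY s').1.
apply: L1B; [exact: (wt_pair gY Dsym s s').1|exact: (wt_one gY s).1].
Qed.

Let Emm s s' : Ex Q (fun y => (m s y - 1) * (m s' y - 1)) = expR (D s s') - 1.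
Proof.
under eq_fun do rewrite mm_expand.
have [a1 a2] := wt_pair gY Dsym s s'.
have [b1 b2] := wt_one gY s; have [c1 c2] := wt_one gY s'.
have h1 := L1B a1 b1; have h2 := L1B h1 c1.
rewrite (ExD h2 (L1_cst Q 1)) (ExB h1 c1) (ExB a1 b1) Ex_cst a2 b2 c2; ring.
Qed.

Let first_order : L1 (P \x Q)%E (fun z => laplace lam (W z.1) * Delta z) /\
  Ex (P \x Q)%E (fun z => laplace lam (W z.1) * Delta z) = 0.
Proof.
have e z : laplace lam (W z.1) * Delta z =
    avg (fun s => (laplace lam (W z.1) * w s z.1) * (m s z.2 - 1)).
  by rewrite -avgZ; apply: eq_avg => s; ring.
have l s := L1_prod (L1lap (wt_one gX s).1) (L1m s).
under [X in L1 _ X]eq_fun do rewrite e.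
under [X in Ex _ X]eq_fun do rewrite e.
split; first exact: L1_avg.
rewrite Ex_avg//; under eq_avg do rewrite (Ex_prod (L1lap (wt_one gX _).1) (L1m _)) Em mulr0.
exact: avg_cst.
Qed.

Let second_order : L1 (P \x Q)%E (fun z => laplace lam (W z.1) * Delta z ^+ 2) /\
  Ex (P \x Q)%E (fun z => laplace lam (W z.1) * Delta z ^+ 2) =
  Ex P (fun x => laplace lam (W x) *
    avg (fun s => avg (fun s' => w s x * w s' x * (expR (D s s') - 1)))).
Proof.
have e z : laplace lam (W z.1) * Delta z ^+ 2 =
    avg (fun s => avg (fun s' => (laplace lam (W z.1) * (w s z.1 * w s' z.1)) *
      ((m s z.2 - 1) * (m s' z.2 - 1)))).
  rewrite expr2 avg_mul -avgZ; apply: eq_avg => s; rewrite -avgZ; apply: eq_avg => s'.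
  ring.
have lp s s' := L1lap (wt_pair gX Csym s s').1.
have l s s' := L1_prod (lp s s') (L1mm s s').
under [X in L1 _ X]eq_fun do rewrite e.
under [X in Ex _ X = _]eq_fun do rewrite e.
split; first by apply: L1_avg => s; exact: L1_avg.
rewrite Ex_avg => [|s]; last exact: L1_avg.
have e2 x : laplace lam (W x) *
    avg (fun s => avg (fun s' => w s x * w s' x * (expR (D s s') - 1))) =
    avg (fun s => avg (fun s' => (expR (D s s') - 1) * (laplace lam (W x) * (w s x * w s' x)))).
  rewrite -avgZ; apply: eq_avg => s; rewrite -avgZ; apply: eq_avg => s'; ring.
under [in RHS]eq_fun do rewrite e2.
rewrite Ex_avg => [|s]; last by apply: L1_avg => s'; exact: L1Z.
apply: eq_avg => s; rewrite Ex_avg// Ex_avg => [|s']; last exact: L1Z.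
by apply: eq_avg => s'; rewrite (Ex_prod (lp s s') (L1mm s s')) Emm ExZ// mulrC.
Qed.

Let dcube := 2^-1 * (expR c0 * expR 1 + expR (6 * c0) * (42 * expR 6)).

(** Odd moments are avoided by [|x|^3 <= (eta * x^2 + x^4 / eta) / 2]. The second moment is of order
    [eta^2] and the fourth of order [eta^4], so both terms are of order [eta^3]. *)
Let third_order : L1 (P \x Q)%E (fun z => `|Delta z| ^+ 3) /\
  Ex (P \x Q)%E (fun z => `|Delta z| ^+ 3) <= dcube * eta ^+ 3.
Proof.
pose G (z : T1 * T2) : R := 2^-1 * (eta * avg (fun s => w s z.1 ^+ 2 * ((m s z.2 - 1) * (m s z.2 - 1))) +
   eta^-1 * avg (fun s => w s z.1 ^+ 4 * (m s z.2 - 1) ^+ 4)).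
have DG z : `|Delta z| ^+ 3 <= G z.
  have dl2 : Delta z ^+ 2 <= avg (fun s => w s z.1 ^+ 2 * ((m s z.2 - 1) * (m s z.2 - 1))).
    apply: (le_trans (avg_sqr_le _ S0)); apply: avg_le => s.
    by rewrite exprMn -expr2.
  have dl4 : Delta z ^+ 4 <= avg (fun s => w s z.1 ^+ 4 * (m s z.2 - 1) ^+ 4).
    apply: (le_trans (avg_exp4_le _ S0)); apply: avg_le => s.
    by rewrite exprMn.
  apply: (@le_trans _ _ (2^-1 * (eta * Delta z ^+ 2 + eta^-1 * Delta z ^+ 4))).
    have -> : Delta z ^+ 2 = `|Delta z| ^+ 2 by rewrite real_normK// num_real.
    have -> : Delta z ^+ 4 = `|Delta z| ^+ 4 by rewrite -normrX ger0_norm// exprn_even_ge0.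
    have -> : 2^-1 * (eta * `|Delta z| ^+ 2 + eta^-1 * `|Delta z| ^+ 4) =
      `|Delta z| ^+ 3 + 2^-1 * `|Delta z| ^+ 2 / eta * (`|Delta z| - eta) ^+ 2.
      by field; rewrite gt_eqF.
    rewrite lerDl; apply: mulr_ge0; last exact: sqr_ge0.
    by apply: divr_ge0; [apply: mulr_ge0 => //; exact: exprn_ge0|exact: ltW].
  by rewrite ler_pM2l//; apply: lerD; apply: ler_wpM2l => //; rewrite ?invr_ge0; exact: ltW.
have m4_expand s y : (m s y - 1) ^+ 4 = m s y ^+ 4 - 4 * m s y ^+ 3 + 6 * m s y ^+ 2 - 4 * m s y ^+ 1 + 1.
  ring.
have L4 s : L1 Q (fun y => (m s y - 1) ^+ 4).
  under eq_fun do rewrite m4_expand.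
  apply: L1D; last exact: L1_cst.
  apply: L1B; last by apply: L1Z; exact: (wt_exp gY s 1).1.
  apply: L1D; last by apply: L1Z; exact: (wt_exp gY s 2).1.
  apply: L1B; last by apply: L1Z; exact: (wt_exp gY s 3).1.
  exact: (wt_exp gY s 4).1.
have E4 s : Ex Q (fun y => (m s y - 1) ^+ 4) =
    expR (6 * D s s) - 4 * expR (3 * D s s) + 6 * expR (D s s) - 3.
  under eq_fun do rewrite m4_expand.
  have [a1 a2] := wt_exp gY s 4; have [b1 b2] := wt_exp gY s 3.
  have [c1 c2] := wt_exp gY s 2; have [e1 e2] := wt_exp gY s 1.
  have h1 := L1B a1 (L1Z 4 b1); have h2 := L1D h1 (L1Z 6 c1); have h3 := L1B h2 (L1Z 4 e1).
  rewrite (ExD h3 (L1_cst Q 1)) (ExB h2 (L1Z 4 e1)) (ExD h1 (L1Z 6 c1)) (ExB a1 (L1Z 4 b1)).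
  rewrite !ExZ// Ex_cst a2 b2 c2 e2.
  have -> : (4%:R ^+ 2 - 4%:R) / 2 * D s s = 6 * D s s by field.
  have -> : (3%:R ^+ 2 - 3%:R) / 2 * D s s = 3 * D s s by field.
  have -> : (2%:R ^+ 2 - 2%:R) / 2 * D s s = D s s by field.
  have -> : (1%:R ^+ 2 - 1%:R) / 2 * D s s = 0 by field.
  by rewrite expR0; ring.
have e21 : eta ^+ 2 <= 1 by rewrite expr_le1// ltW.
(* In [expR (6 q) - 4 expR (3 q) + 6 expR q - 3] the terms of order zero and one cancel. The
   second-order remainders contribute [36 + 6 = 42], the negative exponential being bounded by its
   tangent. *)
have b4 s : Ex Q (fun y => (m s y - 1) ^+ 4) <= 42 * expR 6 * eta ^+ 4.
  rewrite E4; set q := D s s.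
  have q0 : 0 <= q := D0 s; have qe : q <= eta ^+ 2 := De s.
  have q1 : q <= 1 by exact: le_trans e21.
  have := normr_expRB2_le (6 * q); have := expR_ge1Dx (3 * q).
  have := normr_expRB2_le q.
  rewrite (ger0_norm q0) (@ger0_norm _ (6 * q)) ?mulr_ge0// !ler_norml.
  move=> /andP[_ h1] h2 /andP[_ h3].
  have x1 : expR q <= expR 6 by rewrite ler_expR; lra.
  have x6 : expR (6 * q) <= expR 6 by rewrite ler_expR; lra.
  have q2 : 0 <= q ^+ 2 := sqr_ge0 q.
  have q4 : q ^+ 2 <= eta ^+ 4 by rewrite (exprM eta 2 2) lerXn2r ?nnegrE ?sqr_ge0.
  have h1' : expR q - 1 - q <= q ^+ 2 * expR 6.
    by apply: (le_trans h1); rewrite ler_wpM2l.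
  have h3' : expR (6 * q) - 1 - 6 * q <= 36 * (q ^+ 2 * expR 6).
    apply: (le_trans h3); rewrite exprMn (_ : 6 ^+ 2 = 36 :> R); last by ring.
    by rewrite -mulrA ler_wpM2l// ler_wpM2l.
  apply: (@le_trans _ _ (42 * (q ^+ 2 * expR 6))); first lra.
  rewrite -mulrA ler_wpM2l// mulrC ler_wpM2l ?expR_ge0//.
have b2 s : Ex Q (fun y => (m s y - 1) * (m s y - 1)) <= expR 1 * eta ^+ 2.
  rewrite Emm; set q := D s s.
  have q0 : 0 <= q := D0 s; have qe : q <= eta ^+ 2 := De s.
  have := normr_expRB1_le q; rewrite (ger0_norm q0) ler_norml => /andP[_ h].
  have x1 : expR q <= expR 1 by rewrite ler_expR (le_trans qe).
  have eR := expR_gt0 (1 : R).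
  by apply: (le_trans h); rewrite mulrC ler_pM ?expR_ge0.
have lA s := L1_prod (wt_exp gX s 2).1 (L1mm s s).
have lB s := L1_prod (wt_exp gX s 4).1 (L4 s).
have LG : L1 (P \x Q)%E G.
  by apply/L1Z/L1D; apply/L1Z/L1_avg.
split.
  apply: (L1_dom _ _ LG); first by apply: measurable_funX; exact: measurableT_comp mDelta.
  by move=> z; rewrite ger0_norm ?exprn_ge0.
apply: (@le_trans _ _ (Ex (P \x Q)%E G)).
  apply: Ex_le => //.
  apply: (L1_dom _ _ LG); first by apply: measurable_funX; exact: measurableT_comp mDelta.
  by move=> z; rewrite ger0_norm ?exprn_ge0.
rewrite /G ExZ; last by apply: L1D; apply/L1Z/L1_avg.
rewrite ExD; [|by apply/L1Z/L1_avg|by apply/L1Z/L1_avg].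
rewrite !ExZ; [|by apply/L1_avg|by apply/L1_avg].
rewrite (Ex_avg lA) (Ex_avg lB) /dcube -mulrA ler_pM2l// mulrDl.
have wc k s : Ex P (fun x => w s x ^+ k) <= expR ((k%:R ^+ 2 - k%:R) / 2 * c0).
  rewrite (wt_exp gX s k).2 ler_expR ler_wpM2l//.
  rewrite divr_ge0// subr_ge0 expr2; case: k => [|k]; first by rewrite mulr0.
  by rewrite ler_peMr// ler1n.
apply: lerD.
  have -> : expR c0 * expR 1 * eta ^+ 3 = eta * (expR c0 * (expR 1 * eta ^+ 2)) by ring.
  rewrite ler_pM2l// -[leRHS](avg_cst _ S0); apply: avg_le => s.
  rewrite (Ex_prod (wt_exp gX s 2).1 (L1mm s s)).
  apply: ler_pM => //.
  - by apply: Ex_ge0 => x; exact: sqr_ge0.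
  - by apply: Ex_ge0 => x; rewrite -expr2 sqr_ge0.
  - by apply: (le_trans (wc 2 s)); rewrite ler_expR; lra.
have -> : expR (6 * c0) * (42 * expR 6) * eta ^+ 3 =
   eta^-1 * (expR (6 * c0) * (42 * expR 6 * eta ^+ 4)).
  by field; rewrite gt_eqF.
rewrite ler_pM2l ?invr_gt0// -[leRHS](avg_cst _ S0); apply: avg_le => s.
rewrite (Ex_prod (wt_exp gX s 4).1 (L4 s)).
apply: ler_pM => //.
- by apply: Ex_ge0 => x; rewrite exprn_even_ge0.
- by apply: Ex_ge0 => x; rewrite exprn_even_ge0.
- by apply: (le_trans (wc 4 s)); rewrite ler_expR; lra.
Qed.

(** The new field multiplies the weights by independent factors of mean one: the first-order term
    vanishes, and the second depends on the field only through [expR (D s s') - 1]. To compare two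
    small fields is then to compare these kernels. *)
Lemma lindeberg_step :
  `|Ex (P \x Q)%E (fun z => laplace lam (avg (fun s => w s z.1 * m s z.2)))
    - Ex P (fun x => laplace lam (W x))
    - lam ^+ 2 / 2 * Ex P (fun x => laplace lam (W x) *
        avg (fun s => avg (fun s' => w s x * w s' x * (expR (D s s') - 1))))|
  <= (3 + expR 1) * lam ^+ 3 * dcube * eta ^+ 3.
Proof.
have [f1 f2] := first_order; have [s1 s2] := second_order; have [t1 t2] := third_order.
have mlap2 : measurable_fun setT (fun z => laplace lam (W z.1 + Delta z)).
  rewrite /laplace; apply: measurableT_comp; first exact: measurable_expR.
  under eq_fun do rewrite -mulNr.
  apply: measurable_funM; first exact: measurable_cst.
  by apply: measurable_funD => //; exact: measurableT_comp mW measurable_fst.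
have L0 : L1 P (fun x => laplace lam (W x)).
  apply: (@L1_bounded _ _ _ P 1) => // x.
  by rewrite ger0_norm ?expR_ge0 ?lapW_le1.
have WD0 z : 0 <= W z.1 + Delta z.
  by rewrite WD; apply: avg_ge0 => s; rewrite mulr_ge0 ?wt_ge0.
have L2 : L1 (P \x Q)%E (fun z => laplace lam (W z.1 + Delta z)).
  apply: (@L1_bounded _ _ _ _ 1) => // z.
  by rewrite ger0_norm ?expR_ge0// /laplace -expR0 ler_expR oppr_le0 mulr_ge0.
have L0' : L1 (P \x Q)%E (fun z => laplace lam (W z.1)).
  by have := L1_prod L0 (L1_cst Q 1); under eq_fun do rewrite mulr1.
have E0 : Ex (P \x Q)%E (fun z => laplace lam (W z.1)) = Ex P (fun x => laplace lam (W x)).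
  have := Ex_prod L0 (L1_cst Q 1); under eq_fun do rewrite mulr1.
  by rewrite Ex_cst mulr1.
rewrite -s2 -E0.
under eq_fun do rewrite -WD.
have -> : Ex (P \x Q)%E (fun z => laplace lam (W z.1 + Delta z)) -
   Ex (P \x Q)%E (fun z => laplace lam (W z.1)) -
   lam ^+ 2 / 2 * Ex (P \x Q)%E (fun z => laplace lam (W z.1) * Delta z ^+ 2) =
   Ex (P \x Q)%E (fun z => laplace lam (W z.1 + Delta z) - laplace lam (W z.1)
      + lam * (laplace lam (W z.1) * Delta z)
      - lam ^+ 2 / 2 * (laplace lam (W z.1) * Delta z ^+ 2)).
  have a1 := L1B L2 L0'; have a2 := L1D a1 (L1Z lam f1).
  rewrite (ExB a2 (L1Z _ s1)) (ExD a1 (L1Z lam f1)) (ExB L2 L0') !ExZ// f2; ring.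
apply: (@le_trans _ _ (Ex (P \x Q)%E (fun z => (3 + expR 1) * lam ^+ 3 * `|Delta z| ^+ 3))).
  apply: Ex_normr_le; last exact: L1Z.
    exact: (L1_meas (L1B (L1D (L1B L2 L0') (L1Z lam f1)) (L1Z _ s1))).
  move=> z; rewrite /laplace.
  have := @expRN_taylor2 (lam * W z.1) (lam * Delta z) (mulr_ge0 lam0 (W0 z.1)).
  rewrite -mulrDr => /(_ (mulr_ge0 lam0 (WD0 z))).
  rewrite [`|lam * _|]normrM [(_ * `|_|) ^+ 3]exprMn (ger0_norm lam0) [leRHS]mulrA.
  apply: le_trans; rewrite le_eqVlt; apply/orP; left; apply/eqP; congr (`|_|).
  by field.
rewrite ExZ// -[leRHS]mulrA; apply: ler_wpM2l => //.
apply: mulr_ge0; last exact: exprn_ge0.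
by have := expR_ge0 (1 : R); lra.
Qed.

End step.

End lindeberg.

Lemma compare_expansions (R : realDomainType) (x y u a b l D K : R) :
  `|x - u - l * a| <= K -> `|y - u - l * b| <= K -> `|a - b| <= D -> 0 <= l ->
  `|x - y| <= 2 * K + l * D.
Proof.
move=> hx hy hD l0.
have -> : x - y = (x - u - l * a) - (y - u - l * b) + l * (a - b) by ring.
apply: (le_trans (ler_normD _ _)); apply: lerD.
  by apply: (le_trans (ler_normB _ _)); lra.
by rewrite normrM (ger0_norm l0) ler_wpM2l.
Qed.

(** Telescoping over equal steps [h]: errors of order [h^(3/2)] and [h^2] add up to order [sqrt h]
    and vanish as [h] tends to [0], only the term linear in [h] survives. *)
Lemma small_increments (R : realType) (F : R -> R) (Tm A K3 M K4 : R) :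
  0 <= Tm -> 0 < A -> 0 <= M -> 0 <= K4 ->
  (forall t h, 0 <= t -> 0 < h -> t + h <= Tm -> A * h <= 1 ->
    `|F (t + h) - F t| <= K3 * (A * h * Num.sqrt (A * h)) + h * M + h ^+ 2 * K4) ->
  `|F Tm - F 0| <= Tm * M.
Proof.
move=> Tm0 A0 M0 K40 one.
pose bd (h : R) := K3 * (A * h * Num.sqrt (A * h)) + h * M + h ^+ 2 * K4.
have [->|Tmp] := eqVneq Tm 0; first by rewrite subrr normr0 mul0r.
have {Tmp}Tmp : 0 < Tm by rewrite lt_def Tmp.
have all n : A * (Tm / n.+1%:R) <= 1 ->
    `|F Tm - F 0| <= n.+1%:R * bd (Tm / n.+1%:R).
  move=> An; set h : R := Tm / n.+1%:R in An *.
  have n0 : 0 < n.+1%:R :> R by rewrite ltr0n.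
  have h0 : 0 < h by rewrite divr_gt0.
  have nh : n.+1%:R * h = Tm by rewrite /h mulrC divfK// gt_eqF.
  have iter k : (k <= n.+1)%N -> `|F (k%:R * h) - F 0| <= k%:R * bd h.
    elim: k => [|k IH] kn; first by rewrite !mul0r subrr normr0.
    have kS : k.+1%:R * h = k%:R * h + h by rewrite -natr1 mulrDl mul1r.
    have khT : k%:R * h + h <= Tm by rewrite -kS -nh ler_pM2r// ler_nat.
    have kh0 : 0 <= k%:R * h by rewrite mulr_ge0// ltW.
    have H := one _ _ kh0 h0 khT An; rewrite -kS in H.
    have -> : F (k.+1%:R * h) - F 0 = (F (k.+1%:R * h) - F (k%:R * h)) + (F (k%:R * h) - F 0) by ring.
    have -> : k.+1%:R * bd h = bd h + k%:R * bd h by rewrite -natr1 mulrDl mul1r addrC.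
    apply: (le_trans (ler_normD _ _)); apply: lerD => //.
    by apply: IH; exact: ltnW.
  by have := iter n.+1 (leqnn _); rewrite nh.
apply/ler_addgt0Pl => e e0.
pose K5 : R := `|K3| * A * Num.sqrt A * Tm + Tm * K4 + 1.
have K5a : 0 <= `|K3| * A * Num.sqrt A * Tm.
  by rewrite !mulr_ge0 ?sqrtr_ge0// ltW.
have K5b : 0 <= Tm * K4 by exact: mulr_ge0.
have K50 : 0 < K5 by rewrite /K5; lra.
(* The bound [1] gives [h <= sqrt h], [A^-1] gives [A * h <= 1], and the third makes [K5 * sqrt h]
   at most [e]. *)
pose del : R := Num.min 1 (Num.min A^-1 ((e / K5) ^+ 2)).
have del0 : 0 < del by rewrite !lt_min ltr01 invr_gt0 A0 exprn_gt0// divr_gt0.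
pose n := Num.trunc (Tm / del).
have n0 : 0 < n.+1%:R :> R by rewrite ltr0n.
have hd : Tm / n.+1%:R <= del.
  rewrite ler_pdivrMr// -ler_pdivrMl// mulrC; apply/ltW; exact: truncnS_gt.
set h : R := Tm / n.+1%:R in hd.
have h0 : 0 < h by rewrite divr_gt0.
have h1 : h <= 1 by rewrite (le_trans hd)// ge_min lexx.
have hA : A * h <= 1.
  rewrite -(@mulfV _ A) ?gt_eqF// ler_pM2l// (le_trans hd)// ge_min; apply/orP; right.
  by rewrite ge_min lexx.
have hK : h <= (e / K5) ^+ 2.
  by rewrite (le_trans hd)// ge_min; apply/orP; right; rewrite ge_min lexx orbT.
have sh : Num.sqrt h <= e / K5.
  have eK : 0 <= e / K5 by rewrite divr_ge0 ?ltW.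
  by rewrite -(ger0_norm eK) -sqrtr_sqr; exact: ler_wsqrtr.
have hsh : h <= Num.sqrt h.
  by rewrite -{1}(sqr_sqrtr (ltW h0)) expr2 ler_piMl ?sqrtr_ge0// -[leRHS]sqrtr1 ler_wsqrtr.
apply: (le_trans (all n hA)); rewrite -/h.
have nh : n.+1%:R * h = Tm by rewrite /h mulrC divfK// gt_eqF.
have -> : n.+1%:R * bd h = K3 * A * Num.sqrt A * Tm * Num.sqrt h + Tm * K4 * h + Tm * M.
  by rewrite /bd sqrtrM ?ltW// -nh; ring.
rewrite lerD2r; apply: (@le_trans _ _ (K5 * Num.sqrt h)).
  rewrite /K5 !mulrDl mul1r; apply: (@le_trans _ _ (`|K3| * A * Num.sqrt A * Tm * Num.sqrt h +
    Tm * K4 * Num.sqrt h)); last by rewrite lerDl sqrtr_ge0.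
  apply: lerD; last by rewrite ler_wpM2l.
  do 4 (apply: ler_wpM2r; first by rewrite ?sqrtr_ge0 ?ltW).
  exact: ler_norm.
by rewrite mulrC -ler_pdivlMr.
Qed.

(** * Interpolation between the Hamiltonian and a common normal variable *)

Section interpolation.
Context {R : realType} {S : finType}.
Local Notation avg := uniform_mean.
Local Notation gam := (normal_prob 0 1 : probability (measurableTypeR R) R).
Hypothesis S0 : (0 < #|S|)%N.

(** The Laplace transform of a mean of exponentials is the mean of a product over configurations, so
    [gvec_law] applies. This allows the interpolated vector to be replaced at any time by a sum of
    independent pieces of the same total covariance. *)
Lemma laplace_law (E : S -> S -> R) (lam : R)
    d1 (T1 : measurableType d1) (P1 : probability T1 R) (Z1 : S -> T1 -> R)
    d2 (T2 : measurableType d2) (P2 : probability T2 R) (Z2 : S -> T2 -> R) :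
  0 <= lam -> gvec E P1 Z1 -> gvec E P2 Z2 ->
  Ex P1 (fun x => laplace lam (avg (fun s => wt E Z1 s x))) =
  Ex P2 (fun x => laplace lam (avg (fun s => wt E Z2 s x))).
Proof.
move=> lam0 g1 g2.
pose psi s (y : R) := expR (- (lam / #|S|%:R * expR (y - E s s / 2))).
have cpsi s : continuous (psi s).
  move=> y; apply: continuous_cvg; first exact: continuous_expR.
  apply: cvgN; apply: cvgM; first exact: cvg_cst.
  apply: continuous_cvg; first exact: continuous_expR.
  by apply: cvgB; [exact: cvg_id|exact: cvg_cst].
have psi1 s y : `|psi s y| <= 1.
  rewrite ger0_norm ?expR_ge0// /psi -expR0 ler_expR oppr_le0.
  by rewrite mulr_ge0 ?expR_ge0// divr_ge0.
have e d (T : measurableType d) (Z : S -> T -> R) x :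
    laplace lam (avg (fun s => wt E Z s x)) = \prod_s psi s (Z s x).
  rewrite -expR_sum /laplace /uniform_mean; congr expR.
  by rewrite sumrN -mulr_sumr; congr (- _); rewrite /wt; field;
    rewrite pnatr_eq0 -lt0n.
have e1 := funext (e _ _ Z1); have e2 := funext (e _ _ Z2).
by rewrite e1 e2; exact: (gvec_law g1 g2 cpsi psi1).
Qed.

Variables (C : S -> S -> R) (d : measure_display) (T : measurableType d).
Variables (P : probability T R) (X : S -> T -> R) (v : R).
Hypotheses (gX : gvec C P X) (Csym : forall s s', C s s' = C s' s).
Hypotheses (Cv : forall s, C s s = v) (v0 : 0 <= v).
Variables (lam : R) (lam0 : 0 <= lam).

Let Ct (t r : R) : S -> S -> R := fun i j => t * C i j + r.
Let Xt (t r : R) : S -> T * R -> R :=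
  fun s z => Num.sqrt t * X s z.1 + Num.sqrt r * z.2.

Let gtr t r : 0 <= t -> 0 <= r -> gvec (Ct t r) (P \x gam)%E (Xt t r).
Proof.
move=> t0 r0; have := gvecD (gvecZ (Num.sqrt t) gX) (gvecZ (Num.sqrt r) (gvec_gauss S)).
rewrite !sqr_sqrtr//.
have -> : (fun i j : S => t * C i j + r * 1) = Ct t r.
  by apply/funext => i; apply/funext => j; rewrite mulr1.
by [].
Qed.

Definition wtt (t : R) := wt (fun i j => t * C i j) (fun s x => Num.sqrt t * X s x).

Let gt t : 0 <= t -> gvec (fun i j => t * C i j) P (fun s x => Num.sqrt t * X s x).
Proof. by move=> t0; have := gvecZ (Num.sqrt t) gX; rewrite !sqr_sqrtr. Qed.

Definition log_normal (r y : R) := expR (Num.sqrt r * y - r / 2).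

Let wtE t r s z : wt (Ct t r) (Xt t r) s z = wtt t s z.1 * log_normal r z.2.
Proof. by rewrite /wt /wtt /log_normal -expRD; congr expR; rewrite /Ct /Xt; field. Qed.

Let Psi t r := Ex (P \x gam)%E (fun z => laplace lam (avg (fun s => wt (Ct t r) (Xt t r) s z))).

(** A crude bound at fixed size: it only enters errors that vanish with the time step. *)
Let Cm := \sum_s \sum_s' `|C s s'|.

Let CCm s s' : `|C s s'| <= Cm.
Proof.
rewrite /Cm (bigD1 s)//= (bigD1 s')//= -addrA lerDl addr_ge0//.
  by rewrite sumr_ge0.
by rewrite sumr_ge0// => i _; rewrite sumr_ge0.
Qed.

Let Cm0 : 0 <= Cm.
Proof. by rewrite sumr_ge0// => i _; rewrite sumr_ge0. Qed.

Let Ctsym t r i j : Ct t r i j = Ct t r j i.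
Proof. by rewrite /Ct Csym. Qed.

Let dcube (c0 : R) := 2^-1 * (expR c0 * expR 1 + expR (6 * c0) * (42 * expR 6)).

Let D2 (t r h q : R) (z : T * R) : R :=
  avg (fun s => avg (fun s' => wt (Ct t r) (Xt t r) s z * wt (Ct t r) (Xt t r) s' z *
     (expR (h * C s s') - expR q))).

(** From the state [(t, r)], one move runs the Hamiltonian for a further time [h], the other adds a
    common noise of variance [q]. Both are Lindeberg steps from the same vector, so that their
    expansions differ by the second-order terms and the remainders only; the factor [laplace] is
    then bounded by [1]. *)
Let step1 t r h q c0 eta : 0 <= t -> 0 <= r -> 0 <= h -> 0 <= q -> 0 <= c0 ->
  t * v + r <= c0 -> 0 < eta -> eta <= 1 -> h * v <= eta ^+ 2 -> q <= eta ^+ 2 ->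
  `|Psi (t + h) r - Psi t (r + q)| <= 2 * ((3 + expR 1) * lam ^+ 3 * dcube c0 * eta ^+ 3) +
    lam ^+ 2 / 2 * Ex (P \x gam)%E (fun z => `|D2 t r h q z|).
Proof.
move=> t0 r0 h0 q0 c00 tc eta0 eta1 he qe.
have g0 := gtr t0 r0.
have gh : gvec (fun i j => h * C i j) P (fun s x => Num.sqrt h * X s x) by exact: gt.
have gq : gvec (fun _ _ : S => q) gam (fun _ y => Num.sqrt q * y).
  have := gvecZ (Num.sqrt q) (@gvec_gauss R S); rewrite sqr_sqrtr//.
  by under eq_fun do under eq_fun do rewrite mulr1.
have Cd s : Ct t r s s <= c0 by rewrite /Ct Cv.
have hCs s s' : h * C s s' = h * C s' s by rewrite Csym.
have hC0 s : 0 <= h * C s s by rewrite Cv mulr_ge0.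
have hCe s : h * C s s <= eta ^+ 2 by rewrite Cv.
have A := lindeberg_step S0 g0 gh (Ctsym t r) hCs lam0 Cd hC0 hCe eta0 eta1.
have B := lindeberg_step S0 g0 gq (Ctsym t r) (fun _ _ => erefl) lam0 Cd (fun _ => q0) (fun _ => qe) eta0 eta1.
have E1 : Psi (t + h) r = Ex ((P \x gam) \x P)%E (fun z => laplace lam (avg (fun s =>
     wt (Ct t r) (Xt t r) s z.1 * wt (fun i j => h * C i j) (fun s x => Num.sqrt h * X s x) s z.2))).
  rewrite /Psi.
  have := gvecD g0 gh.
  have -> : (fun i j => Ct t r i j + h * C i j) = Ct (t + h) r.
    by apply/funext => i; apply/funext => j; rewrite /Ct; ring.
  move=> g1; rewrite (laplace_law lam0 (gtr (addr_ge0 t0 h0) r0) g1).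
  congr Ex; apply/funext => z; congr (laplace lam _); apply: eq_avg => s.
  by rewrite /wt -expRD /Ct; congr expR; field.
have E2 : Psi t (r + q) = Ex ((P \x gam) \x gam)%E (fun z => laplace lam (avg (fun s =>
     wt (Ct t r) (Xt t r) s z.1 * wt (fun _ _ => q) (fun _ y => Num.sqrt q * y) s z.2))).
  rewrite /Psi.
  have := gvecD g0 gq.
  have -> : (fun i j => Ct t r i j + q) = Ct t (r + q).
    by apply/funext => i; apply/funext => j; rewrite /Ct; ring.
  move=> g1; rewrite (laplace_law lam0 (gtr t0 (addr_ge0 r0 q0)) g1).
  congr Ex; apply/funext => z; congr (laplace lam _); apply: eq_avg => s.
  by rewrite /wt -expRD /Ct; congr expR; field.
rewrite -E1 in A; rewrite -E2 in B.
set U := Ex _ (fun x => laplace lam _) in A B.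
set VA := Ex _ (fun x => laplace lam _ * _) in A.
set VB := Ex _ (fun x => laplace lam _ * _) in B.
have lap1 x : laplace lam (avg (fun s => wt (Ct t r) (Xt t r) s x)) <= 1.
  rewrite /laplace -expR0 ler_expR oppr_le0 mulr_ge0//.
  by apply: avg_ge0 => s; exact: wt_ge0.
have mw s := measurable_wt g0 s.
have mlap : measurable_fun setT (fun x => laplace lam (avg (fun s => wt (Ct t r) (Xt t r) s x))).
  rewrite /laplace; apply: measurableT_comp; first exact: measurable_expR.
  under eq_fun do rewrite -mulNr.
  by apply: measurable_funM; [exact: measurable_cst|exact: measurable_avg].
have Lww (k : S -> S -> R) : L1 (P \x gam)%E (fun x =>
    avg (fun s => avg (fun s' => wt (Ct t r) (Xt t r) s x * wt (Ct t r) (Xt t r) s' x * k s s'))).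
  apply: L1_avg => s; apply: L1_avg => s'; under eq_fun do rewrite mulrC.
  by apply: L1Z; exact: (wt_pair g0 (Ctsym t r) s s').1.
have Llap (f : T * R -> R) : L1 (P \x gam)%E f -> L1 (P \x gam)%E (fun x =>
    laplace lam (avg (fun s => wt (Ct t r) (Xt t r) s x)) * f x).
  move=> f1; apply: (L1_dom _ _ (L1_norm f1)).
    by apply: measurable_funM => //; exact: (L1_meas f1).
  by move=> x; rewrite normrM (ger0_norm (expR_ge0 _)) ler_piMl// lap1.
have VAB : `|VA - VB| <= Ex (P \x gam)%E (fun z => `|D2 t r h q z|).
  rewrite /VA /VB -ExB; [|exact: Llap (Lww _)|exact: Llap (Lww _)].
  apply: Ex_normr_le; last exact/L1_norm/(Lww (fun s s' => expR (h * C s s') - expR q)).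
    by apply: L1_meas (L1B (Llap _ (Lww _)) (Llap _ (Lww _))).
  move=> z; rewrite -mulrBr -avgB.
  have -> : avg (fun s => avg (fun s' => wt (Ct t r) (Xt t r) s z * wt (Ct t r) (Xt t r) s' z *
      (expR (h * C s s') - 1)) - avg (fun s' => wt (Ct t r) (Xt t r) s z * wt (Ct t r) (Xt t r) s' z *
      (expR q - 1))) = D2 t r h q z.
    by apply: eq_avg => s; rewrite -avgB; apply: eq_avg => s'; ring.
  by rewrite normrM (ger0_norm (expR_ge0 _)) ler_piMl// lap1.
have l20 : 0 <= lam ^+ 2 / 2 by rewrite divr_ge0// sqr_ge0.
exact: compare_expansions A B VAB l20.
Qed.

Let L1_wtt2 t (k : S -> S -> R) : 0 <= t -> L1 P (fun x =>
  avg (fun s => avg (fun s' => wtt t s x * wtt t s' x * k s s'))).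
Proof.
move=> t0; apply: L1_avg => s; apply: L1_avg => s'; under eq_fun do rewrite mulrC.
apply: L1Z; apply: (wt_pair (gt t0) _ s s').1 => i j.
by rewrite Csym.
Qed.

(** The noise present at [(t, r)] is shared by both replicas: it factors out as the square of a
    log-normal variable, of mean [expR r]. *)
Let step2 t r h q : 0 <= t -> 0 <= r ->
  Ex (P \x gam)%E (fun z => `|D2 t r h q z|) =
  expR r * Ex P (fun x => `|avg (fun s => avg (fun s' => wtt t s x * wtt t s' x *
     (expR (h * C s s') - expR q)))|).
Proof.
move=> t0 r0.
have ll : L1 gam (fun y => log_normal r y ^+ 2) /\ Ex gam (fun y => log_normal r y ^+ 2) = expR r.
  have [h1 h2] := gauss_expR (2 * Num.sqrt r).
  have e y : log_normal r y ^+ 2 = expR (- r) * expR (2 * Num.sqrt r * y).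
    by rewrite /log_normal -expRM_natl -expRD; congr expR; field.
  under [X in L1 _ X]eq_fun do rewrite e.
  under [X in Ex _ X]eq_fun do rewrite e.
  split; first exact: L1Z.
  rewrite ExZ// h2 -expRD; congr expR.
  by rewrite exprMn sqr_sqrtr//; field.
rewrite -ll.2 mulrC -(Ex_prod (L1_norm (L1_wtt2 (fun s s' => expR (h * C s s') - expR q) t0)) ll.1).
congr Ex; apply/funext => z; rewrite -[X in _ * X]ger0_norm ?sqr_ge0// -normrM; congr (`|_|).
rewrite mulrC -avgZ; apply: eq_avg => s; rewrite -avgZ; apply: eq_avg => s'.
by rewrite !wtE; ring.
Qed.

(** Linearisation: [expR (h C) - expR q] is [h (C - c)] up to order [h^2], and pairs of weights have
    mean at most [expR (Tm * Cm)]. *)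
Let step3 t h q (c K B Tm : R) : 0 <= t -> 0 <= h -> t + h <= Tm ->
  `|expR q - 1 - h * c| <= K * h ^+ 2 ->
  Ex P (fun x => `|avg (fun s => avg (fun s' => wtt t s x * wtt t s' x * (C s s' - c)))|) <= B ->
  Ex P (fun x => `|avg (fun s => avg (fun s' => wtt t s x * wtt t s' x *
     (expR (h * C s s') - expR q)))|) <=
  h * B + h ^+ 2 * ((Cm ^+ 2 * expR (Tm * Cm) + K) * expR (Tm * Cm)).
Proof.
move=> t0 h0 thT qK HB.
pose k s s' := expR (h * C s s') - expR q - h * (C s s' - c).
have tT : t <= Tm by lra.
have hT : h <= Tm by lra.
have kb s s' : `|k s s'| <= h ^+ 2 * (Cm ^+ 2 * expR (Tm * Cm) + K).
  have -> : k s s' = (expR (h * C s s') - 1 - h * C s s') - (expR q - 1 - h * c).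
    by rewrite /k; ring.
  apply: (le_trans (ler_normB _ _)); rewrite mulrDr; apply: lerD; last by rewrite [leRHS]mulrC.
  apply: (le_trans (normr_expRB2_le _)).
  rewrite exprMn -mulrA ler_wpM2l ?sqr_ge0//; apply: ler_pM; rewrite ?sqr_ge0 ?expR_ge0//.
    by rewrite -(real_normK (num_real (C s s'))) lerXn2r ?nnegrE.
  by rewrite ler_expR normrM (ger0_norm h0) ler_pM.
have Lk := L1_wtt2 k t0; have LC := L1_wtt2 (fun s s' => C s s' - c) t0.
apply: (@le_trans _ _ (Ex P (fun x =>
    h * `|avg (fun s => avg (fun s' => wtt t s x * wtt t s' x * (C s s' - c)))| +
    avg (fun s => avg (fun s' => h ^+ 2 * (Cm ^+ 2 * expR (Tm * Cm) + K) * (wtt t s x * wtt t s' x)))))).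
  have L2 : L1 P (fun x => avg (fun s => avg (fun s' => h ^+ 2 * (Cm ^+ 2 * expR (Tm * Cm) + K) * (wtt t s x * wtt t s' x)))).
    by have := L1_wtt2 (fun _ _ => h ^+ 2 * (Cm ^+ 2 * expR (Tm * Cm) + K)) t0;
      under eq_fun do (under eq_avg do (under eq_avg do rewrite mulrC)).
  apply: Ex_le; first exact/L1_norm/L1_wtt2.
    by apply: L1D => //; apply: L1Z; exact: L1_norm.
  move=> x.
  have -> : avg (fun s => avg (fun s' => wtt t s x * wtt t s' x * (expR (h * C s s') - expR q))) =
     h * avg (fun s => avg (fun s' => wtt t s x * wtt t s' x * (C s s' - c))) +
     avg (fun s => avg (fun s' => wtt t s x * wtt t s' x * k s s')).
    rewrite -avgZ -avgD; apply: eq_avg => s; rewrite -avgZ -avgD; apply: eq_avg => s'.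
    by rewrite /k; ring.
  apply: (le_trans (ler_normD _ _)); rewrite normrM (ger0_norm h0) lerD2l.
  apply: (le_trans (normr_avg _)); apply: avg_le => s.
  apply: (le_trans (normr_avg _)); apply: avg_le => s'.
  have w0 : 0 <= wtt t s x * wtt t s' x by rewrite mulr_ge0 ?wt_ge0.
  by rewrite normrM (ger0_norm w0) mulrC ler_wpM2r.
have Lp s s' : L1 P (fun x => wtt t s x * wtt t s' x) /\
    Ex P (fun x => wtt t s x * wtt t s' x) = expR (t * C s s').
  by apply: (wt_pair (gt t0)) => i j; rewrite Csym.
have L2 : L1 P (fun x => avg (fun s => avg (fun s' => h ^+ 2 * (Cm ^+ 2 * expR (Tm * Cm) + K) * (wtt t s x * wtt t s' x)))).
  by apply: L1_avg => s; apply: L1_avg => s'; apply: L1Z; exact: (Lp s s').1.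
rewrite ExD//; last by apply: L1Z; exact: L1_norm.
rewrite ExZ; last exact: L1_norm.
apply: lerD; first by rewrite ler_wpM2l.
rewrite Ex_avg => [|s]; last by apply: L1_avg => s'; apply: L1Z; exact: (Lp s s').1.
rewrite -[leRHS](avg_cst _ S0); apply: avg_le => s.
rewrite Ex_avg => [|s']; last by apply: L1Z; exact: (Lp s s').1.
rewrite -[leRHS](avg_cst _ S0); apply: avg_le => s'.
rewrite ExZ ?(Lp s s').2; last exact: (Lp s s').1.
rewrite mulrA ler_wpM2l//.
  by apply: le_trans (kb s s').
rewrite ler_expR (le_trans (ler_norm _))// normrM (ger0_norm t0) ler_pM//.
Qed.

(** The steps above with [eta = sqrt (A * h)], the smallest value allowed by variances of order [h];
    the Lindeberg error is then of order [h^(3/2)]. *)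
Let increment t h q r c K B Tm A sT : 0 <= t -> 0 < h -> t + h <= Tm -> 0 < A -> v <= A ->
  q <= A * h -> 0 <= q -> 0 <= r -> r <= sT -> A * h <= 1 ->
  `|expR q - 1 - h * c| <= K * h ^+ 2 ->
  Ex P (fun x => `|avg (fun s => avg (fun s' => wtt t s x * wtt t s' x * (C s s' - c)))|) <= B ->
  `|Psi (t + h) r - Psi t (r + q)| <=
  2 * ((3 + expR 1) * lam ^+ 3 * dcube (Tm * v + sT)) * (A * h * Num.sqrt (A * h)) +
  h * (lam ^+ 2 / 2 * expR sT * B) +
  h ^+ 2 * (lam ^+ 2 / 2 * expR sT * ((Cm ^+ 2 * expR (Tm * Cm) + K) * expR (Tm * Cm))).
Proof.
move=> t0 h0 thT A0 vA qA q0 r0 rT Ah qK HB.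
have Ah0 : 0 < A * h := mulr_gt0 A0 h0.
have e2 : Num.sqrt (A * h) ^+ 2 = A * h := sqr_sqrtr (ltW Ah0).
have e0 : 0 < Num.sqrt (A * h) by rewrite sqrtr_gt0.
have e1 : Num.sqrt (A * h) <= 1 by rewrite -[leRHS]sqrtr1; exact: ler_wsqrtr.
have tT : t <= Tm by apply: le_trans thT; rewrite lerDl; exact: ltW.
have T0 : 0 <= Tm := le_trans t0 tT.
have c00 : 0 <= Tm * v + sT by apply: addr_ge0; [exact: mulr_ge0|exact: le_trans rT].
have tv : t * v + r <= Tm * v + sT by apply: lerD => //; exact: ler_wpM2r.
have hv : h * v <= Num.sqrt (A * h) ^+ 2 by rewrite e2 mulrC ler_pM2r.
have qe : q <= Num.sqrt (A * h) ^+ 2 by rewrite e2.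
apply: (le_trans (step1 t0 r0 (ltW h0) q0 c00 tv e0 e1 hv qe)).
rewrite -[leRHS]addrA; apply: lerD.
  rewrite [Num.sqrt _ ^+ 3]exprS e2; move: (dcube _) (expR 1) (Num.sqrt _) => u k4 w.
  by rewrite le_eqVlt; apply/orP; left; apply/eqP; ring.
rewrite step2//.
have -> (u k4 : R) : h * (lam ^+ 2 / 2 * u * B) + h ^+ 2 * (lam ^+ 2 / 2 * u * k4) =
  lam ^+ 2 / 2 * (u * (h * B + h ^+ 2 * k4)) by ring.
apply: ler_wpM2l; first by rewrite divr_ge0// sqr_ge0.
apply: ler_pM; rewrite ?expR_ge0 ?ler_expR//.
  by apply: Ex_ge0 => x; exact: normr_ge0.
exact: (step3 t0 (ltW h0) thT qK HB).
Qed.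

(* At time [t] the Hamiltonian has been run up to [t], and the part of it beyond [t] is
   replaced by an independent normal variable of variance [s Tm - s t]. *)
Theorem interpolation (s c : R -> R) (L K B Tm : R) :
  0 <= Tm -> 0 <= L -> 0 <= K -> s 0 = 0 ->
  (forall t h, 0 <= t -> 0 <= h -> t + h <= Tm -> 0 <= s (t + h) - s t <= L * h) ->
  (forall t h, 0 <= t -> 0 <= h -> t + h <= Tm ->
     `|expR (s (t + h) - s t) - 1 - h * c t| <= K * h ^+ 2) ->
  (forall t, 0 <= t <= Tm ->
     Ex P (fun x => `|avg (fun s' => avg (fun s'' =>
       wtt t s' x * wtt t s'' x * (C s' s'' - c t)))|) <= B) ->
  `|Ex P (fun x => laplace lam (avg (fun s' => wtt Tm s' x))) -
    Ex gam (fun y => laplace lam (log_normal (s Tm) y))| <=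
  lam ^+ 2 / 2 * expR (s Tm) * Tm * B.
Proof.
move=> Tm0 L0 K0 s00 sL sK HB.
have s0 t : 0 <= t <= Tm -> 0 <= s t.
  move=> /andP[t0 tT]; have := sL 0 t (lexx _) t0; rewrite add0r => /(_ tT).
  by rewrite s00 subr0 => /andP[].
have P1 : Psi Tm 0 = Ex P (fun x => laplace lam (avg (fun s' => wtt Tm s' x))).
  rewrite /Psi; pose f x := laplace lam (avg (fun s' => wtt Tm s' x)).
  have Lf : L1 P f.
    apply: (@L1_bounded _ _ _ P 1).
      rewrite /f /laplace; apply: measurableT_comp; first exact: measurable_expR.
      under eq_fun do rewrite -mulNr.
      apply: measurable_funM; first exact: measurable_cst.
      by apply: measurable_avg => s'; exact: (measurable_wt (gt Tm0)).
    move=> x; rewrite ger0_norm ?expR_ge0// /f /laplace -expR0 ler_expR oppr_le0 mulr_ge0//.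
    by apply: avg_ge0 => s'; exact: wt_ge0.
  have := Ex_prod Lf (L1_cst gam 1); rewrite Ex_cst mulr1 => <-.
  congr Ex; apply/funext => z; rewrite mulr1 /f; congr (laplace lam _); apply: eq_avg => s'.
  by rewrite wtE /log_normal sqrtr0 !mul0r subrr expR0 mulr1.
have P2 : Psi 0 (s Tm) = Ex gam (fun y => laplace lam (log_normal (s Tm) y)).
  rewrite /Psi; pose f y := laplace lam (log_normal (s Tm) y).
  have Lf : L1 gam f.
    apply: (@L1_bounded _ _ _ gam 1).
      apply: continuous_measurable_fun => y; rewrite /f /laplace /log_normal.
      apply: continuous_cvg; first exact: continuous_expR.
      apply: cvgN; apply: cvgM; first exact: cvg_cst.
      apply: continuous_cvg; first exact: continuous_expR.
      apply: cvgB; last exact: cvg_cst.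
      by apply: cvgM; [exact: cvg_cst|exact: cvg_id].
    move=> y; rewrite ger0_norm ?expR_ge0// /f /laplace -expR0 ler_expR oppr_le0 mulr_ge0//.
    exact: expR_ge0.
  have := Ex_prod (L1_cst P 1) Lf; rewrite Ex_cst mul1r => <-.
  congr Ex; apply/funext => z; rewrite mul1r /f; congr (laplace lam _).
  rewrite -[RHS](avg_cst _ S0); apply: eq_avg => s'.
  by rewrite wtE /wtt /wt sqrtr0 !mul0r subrr expR0 mul1r.
rewrite -P1 -P2.
(* A single positive rate that dominates both the variance [v] of the Hamiltonian per unit of time
   and the rate [L] of the common noise. *)
have A0 : 0 < L + v + 1 by apply: ltr_wpDl => //; exact: addr_ge0.
have vA : v <= L + v + 1 by rewrite -addrA addrCA lerDl addr_ge0.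
have LA : L <= L + v + 1 by rewrite -addrA lerDl addr_ge0.
move: (L + v + 1) A0 vA LA => A A0 vA LA.
pose c0 := Tm * v + s Tm.
pose K3 := 2 * ((3 + expR 1) * lam ^+ 3 * dcube c0).
pose K4 := (Cm ^+ 2 * expR (Tm * Cm) + K) * expR (Tm * Cm).
have B0 : 0 <= B.
  by apply: le_trans (HB 0 _); [apply: Ex_ge0 => x; exact: normr_ge0|rewrite lexx].
have l20 : 0 <= lam ^+ 2 / 2 by rewrite divr_ge0// sqr_ge0.
have lT0 : 0 <= lam ^+ 2 / 2 * expR (s Tm) by apply: mulr_ge0 => //; exact: expR_ge0.
have K40 : 0 <= K4.
  rewrite /K4 mulr_ge0 ?expR_ge0// addr_ge0// mulr_ge0 ?expR_ge0//; exact: sqr_ge0.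
have FT : Psi Tm (s Tm - s Tm) = Psi Tm 0 := congr1 (Psi Tm) (subrr _).
have F0 : Psi 0 (s Tm - s 0) = Psi 0 (s Tm).
  by apply: (congr1 (Psi 0)); rewrite s00 subr0.
have -> : lam ^+ 2 / 2 * expR (s Tm) * Tm * B = Tm * (lam ^+ 2 / 2 * expR (s Tm) * B).
  by rewrite -mulrA mulrCA.
rewrite -FT -F0.
apply: (@small_increments R (fun t => Psi t (s Tm - s t)) Tm A K3
  (lam ^+ 2 / 2 * expR (s Tm) * B) (lam ^+ 2 / 2 * expR (s Tm) * K4) Tm0 A0
  (mulr_ge0 lT0 B0) (mulr_ge0 lT0 K40)) => t h t0 h0 thT Ah.
have /andP[q0 qL] := sL t h t0 (ltW h0) thT.
have th0 : 0 <= t + h by exact: addr_ge0 t0 (ltW h0).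
have r0 : 0 <= s Tm - s (t + h).
  have e : t + h + (Tm - (t + h)) = Tm by rewrite addrC subrK.
  have := sL (t + h) (Tm - (t + h)); rewrite e => H.
  by have /andP[] := H th0 (etrans (subr_ge0 _ _) thT) (lexx _).
have -> : s Tm - s t = (s Tm - s (t + h)) + (s (t + h) - s t) by ring.
have rT : s Tm - s (t + h) <= s Tm.
  by rewrite lerBlDr lerDl; apply: s0; apply/andP; split.
have tT : t <= Tm by apply: le_trans thT; rewrite lerDl; exact: ltW.
have tb : 0 <= t <= Tm by apply/andP; split.
exact: (increment t0 h0 thT A0 vA (le_trans qL (ler_wpM2r (ltW h0) LA)) q0 r0 rT Ah
  (sK t h t0 (ltW h0) thT) (HB t tb)).
Qed.

End interpolation.

(** * Overlaps of independent replicas *)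

Section limits.
Context {R : realType}.

Lemma cvg_ge_lim (u : nat -> R) (l x : R) : u n @[n --> \oo] --> l -> (\forall n \near \oo, x <= u n) -> x <= l.
Proof.
by move=> c h; have := limr_ge (cvgP _ c) h; rewrite (cvg_lim (@Rhausdorff R) c); exact.
Qed.

Lemma cvg_le_lim (u : nat -> R) (l x : R) : u n @[n --> \oo] --> l -> (\forall n \near \oo, u n <= x) -> l <= x.
Proof.
by move=> c h; have := limr_le (cvgP _ c) h; rewrite (cvg_lim (@Rhausdorff R) c); exact.
Qed.

Lemma cvg_rate (u r : nat -> R) (l C : R) : r n @[n --> \oo] --> 0 ->
  (forall n, `|u n - l| <= C * r n) -> u n @[n --> \oo] --> l.
Proof.
move=> r0 h; apply/cvgrPdist_le => e e0.
have /cvgrPdist_le/(_ e e0) : C * r n @[n --> \oo] --> C * 0.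
  by apply: cvgM => //; exact: cvg_cst.
rewrite mulr0; apply: filterS => n; rewrite sub0r normrN => hn.
by rewrite distrC (le_trans (h n))// (le_trans (ler_norm _)).
Qed.

Lemma cvg_invn : (n.+1%:R^-1 : R) @[n --> \oo] --> 0.
Proof. exact: cvg_harmonic. Qed.

Lemma cvg_invsqrtn : (Num.sqrt n.+1%:R)^-1 @[n --> \oo] --> (0 : R).
Proof.
have -> : (fun n => (Num.sqrt n.+1%:R)^-1 : R) = (fun n => Num.sqrt n.+1%:R^-1).
  by apply/funext => n; rewrite sqrtrV// ler0n.
by rewrite -[X in _ --> X]sqrtr0; apply: continuous_cvg cvg_invn; exact: sqrt_continuous.
Qed.

End limits.

Section power_differences.
Context {R : realFieldType}.
Implicit Types a b m : R.

Lemma normr_exprB_le a b m n : 0 <= a <= m -> 0 <= b <= m ->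
  `|a ^+ n.+1 - b ^+ n.+1| <= n.+1%:R * m ^+ n * `|a - b|.
Proof.
move=> /andP[a0 am] /andP[b0 bm]; elim: n => [|n IH]; first by rewrite !expr1 !mul1r.
have m0 := le_trans a0 am.
have -> : a ^+ n.+2 - b ^+ n.+2 = a ^+ n.+1 * (a - b) + (a ^+ n.+1 - b ^+ n.+1) * b.
  by rewrite [a ^+ n.+2]exprSr [b ^+ n.+2]exprSr; ring.
apply: (le_trans (ler_normD _ _)); rewrite !normrM (ger0_norm b0) (ger0_norm (exprn_ge0 _ a0)).
have -> : n.+2%:R * m ^+ n.+1 * `|a - b| =
    m ^+ n.+1 * `|a - b| + n.+1%:R * m ^+ n * `|a - b| * m.
  by rewrite -[n.+2%:R]natr1 [m ^+ n.+1]exprSr; ring.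
apply: lerD; first by rewrite ler_wpM2r// lerXn2r.
by apply: ler_pM.
Qed.

End power_differences.

(** * The hyperbolic cosine against the Gaussian exponential *)

Section cosh.
Context {R : realType}.
Implicit Types u : R.

Definition cosh u := (expR u + expR (- u)) / 2.

Lemma cosh_gt0 u : 0 < cosh u.
Proof. by rewrite divr_gt0// addr_gt0// expR_gt0. Qed.

Lemma cosh_partial_sum u m :
  \sum_(0 <= n < m.*2) (exp_coeff u n + exp_coeff (- u) n) =
  2 * \sum_(0 <= k < m) (u ^+ 2) ^+ k / (k.*2)`!%:R.
Proof.
elim: m => [|m IH]; first by rewrite !big_geq// mulr0.
rewrite doubleS !big_nat_recr//= IH mulrDr -addrA; congr (_ + _).
have e (w : R) : w ^+ m.*2 = (w ^+ 2) ^+ m by rewrite -mul2n exprM.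
have e1 (w : R) : w ^+ m.*2.+1 = w * (w ^+ 2) ^+ m by rewrite exprS e.
by rewrite /exp_coeff /= !e1 !e sqrrN; move: (_ ^-1) (_ ^-1) (_ ^+ m) => f0 f1 q; ring.
Qed.

Lemma cosh_cvg u :
  (2 * \sum_(0 <= k < m) (u ^+ 2) ^+ k / (k.*2)`!%:R) @[m --> \oo] --> expR u + expR (- u).
Proof.
have d : (m.*2) @[m --> \oo] --> \oo.
  apply/cvgnyPge => A; near=> n; rewrite -addnn.
  apply: leq_trans (leq_addr _ _); near: n; exact: nbhs_infty_ge.
have c : (series (exp_coeff u) n + series (exp_coeff (- u)) n) @[n --> \oo] -->
    expR u + expR (- u).
  by apply: cvgD; exact: is_cvg_series_exp_coeff.
have := cvg_comp _ _ d c.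
apply: cvg_trans; apply: near_eq_cvg; apply: nearW => m /=.
by rewrite -cosh_partial_sum big_split.
Unshelve. all: end_near. Qed.

Lemma fact_double_ge k : (2 ^ k * k`! <= (k.*2)`!)%N.
Proof.
elim: k => // k IH; rewrite doubleS !factS expnS.
apply: (@leq_trans (k.*2.+2 * (2 ^ k * k`!))%N).
  by rewrite -doubleS -mul2n; rewrite -!mulnA leq_mul// mulnCA.
by rewrite leq_mul2l/= (leq_trans IH)// leq_pmull.
Qed.

Lemma cosh_ge u : 1 + u ^+ 2 / 2 <= cosh u.
Proof.
suff : 2 * (1 + u ^+ 2 / 2) <= expR u + expR (- u) by rewrite /cosh; lra.
have := cvg_ge_lim (@cosh_cvg u); apply; near=> m.
have m2 : (2 <= m)%N by near: m; exact: nbhs_infty_ge.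
rewrite ler_pM2l//; move: (m) m2 => [|[|k]]// _.
rewrite !big_nat_recl//= expr0 !expr1 divr1 addrA lerDl.
by apply: sumr_ge0 => i _; rewrite divr_ge0// exprn_ge0// sqr_ge0.
Unshelve. all: end_near. Qed.

(** Term by term comparison of the two series, by [2^k * k! <= (2 k)!]. *)
Lemma cosh_le u : cosh u <= expR (u ^+ 2 / 2).
Proof.
suff : expR u + expR (- u) <= 2 * expR (u ^+ 2 / 2) by rewrite /cosh; lra.
have := cvg_le_lim (@cosh_cvg u); apply; near=> m.
rewrite ler_pM2l//; apply: (@le_trans _ _ (series (exp_coeff (u ^+ 2 / 2)) m)).
  apply: ler_sum => k _; rewrite /exp_coeff /= expr_div_n -mulrA -invfM.
  apply: ler_wpM2l; first by rewrite exprn_ge0// sqr_ge0.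
  rewrite -natrX -natrM lef_pV2 ?posrE ?ltr0n ?muln_gt0 ?expn_gt0 ?fact_gt0//.
  by rewrite ler_nat fact_double_ge.
apply: (nondecreasing_cvgn_le (u_ := series (exp_coeff (u ^+ 2 / 2)))); last exact: is_cvg_series_exp_coeff.
apply: nondecreasing_series => i _ _.
by rewrite /exp_coeff /= divr_ge0// exprn_ge0// divr_ge0// sqr_ge0.
Unshelve. all: end_near. Qed.

(** Since [cosh u] lies between [1 + u^2 / 2] and [expR (u^2 / 2)], the error is at most the
    remainder of the exponential at [u^2 / 2]. *)
Lemma cosh_approx u : `|cosh u - expR (u ^+ 2 / 2)| <= (u ^+ 2 / 2) ^+ 2 * expR (u ^+ 2 / 2).
Proof.
rewrite distrC ger0_norm ?subr_ge0 ?cosh_le//.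
have u0 : 0 <= u ^+ 2 / 2 by rewrite divr_ge0// sqr_ge0.
have := normr_expRB2_le (u ^+ 2 / 2); rewrite (ger0_norm u0) => h.
apply: le_trans h; apply: le_trans (ler_norm _).
by have := cosh_ge u; lra.
Qed.

Lemma cosh_pow_le n th s : 0 <= th -> cosh (Num.sqrt (2 * th / n.+1%:R) * s) ^+ n.+1 <= expR (th * s ^+ 2).
Proof.
move=> th0; have n0 : (n.+1%:R : R) != 0 by rewrite pnatr_eq0.
have -> : expR (th * s ^+ 2) = expR ((Num.sqrt (2 * th / n.+1%:R) * s) ^+ 2 / 2) ^+ n.+1.
  rewrite -expRM_natl; congr expR; rewrite exprMn sqr_sqrtr; last by rewrite divr_ge0// mulr_ge0.
  by field.
by apply: lerXn2r; rewrite ?nnegrE ?expR_ge0 ?cosh_le// ltW// cosh_gt0.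
Qed.

(** Each of the [n + 1] factors errs by the order of [s^4 / n^2], which makes [s^4 / n] in all; the
    power of [s] is absorbed by the larger exponent [ka]. *)
Lemma cosh_pow_approx n th ka s : 0 <= th < ka ->
  `|cosh (Num.sqrt (2 * th / n.+1%:R) * s) ^+ n.+1 - expR (th * s ^+ 2)| <=
  4 * th ^+ 2 / (ka - th) ^+ 2 / n.+1%:R * expR (ka * s ^+ 2).
Proof.
move=> /andP[th0 thka]; have n0 : (n.+1%:R : R) != 0 by rewrite pnatr_eq0.
set v := Num.sqrt _ * s.
have v2 : v ^+ 2 / 2 = th * s ^+ 2 / n.+1%:R.
  rewrite /v exprMn sqr_sqrtr; last by rewrite divr_ge0// mulr_ge0.
  by field.
have e : expR (th * s ^+ 2) = expR (v ^+ 2 / 2) ^+ n.+1.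
  by rewrite -expRM_natl v2; congr expR; field.
have b1 : 0 <= cosh v <= expR (v ^+ 2 / 2) by rewrite ltW ?cosh_gt0// cosh_le.
have b2 : 0 <= expR (v ^+ 2 / 2) <= expR (v ^+ 2 / 2) by rewrite expR_ge0 lexx.
rewrite e; apply: (le_trans (normr_exprB_le n b1 b2)).
apply: (@le_trans _ _ (n.+1%:R * expR (v ^+ 2 / 2) ^+ n * ((v ^+ 2 / 2) ^+ 2 * expR (v ^+ 2 / 2)))).
  by rewrite ler_wpM2l ?mulr_ge0 ?exprn_ge0 ?expR_ge0// cosh_approx.
have -> : n.+1%:R * expR (v ^+ 2 / 2) ^+ n * ((v ^+ 2 / 2) ^+ 2 * expR (v ^+ 2 / 2)) =
   n.+1%:R * (v ^+ 2 / 2) ^+ 2 * expR (th * s ^+ 2).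
  by rewrite e [_ ^+ n.+1 in RHS]exprSr; ring.
have d0 : 0 < ka - th by rewrite subr_gt0.
have s0 : 0 <= (ka - th) * s ^+ 2 by rewrite mulr_ge0 ?sqr_ge0// ltW.
have h := sqr_le_expR s0.
rewrite v2.
have -> : n.+1%:R * (th * s ^+ 2 / n.+1%:R) ^+ 2 * expR (th * s ^+ 2) =
  th ^+ 2 / (ka - th) ^+ 2 / n.+1%:R * (((ka - th) * s ^+ 2) ^+ 2 * expR (th * s ^+ 2)).
  by field; rewrite nat1r n0 gt_eqF.
have -> : 4 * th ^+ 2 / (ka - th) ^+ 2 / n.+1%:R * expR (ka * s ^+ 2) =
  th ^+ 2 / (ka - th) ^+ 2 / n.+1%:R * (4 * expR ((ka - th) * s ^+ 2) * expR (th * s ^+ 2)).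
  rewrite -[4 * _ * expR (th * _)]mulrA -expRD -mulrDl subrK; field.
  by rewrite nat1r n0 gt_eqF.
apply: ler_wpM2l.
  by rewrite divr_ge0// divr_ge0// sqr_ge0.
by rewrite ler_wpM2r ?expR_ge0.
Qed.

End cosh.

Section linearization.
Context {R : realType} {O : finType}.
Local Notation avg := uniform_mean.
Local Notation gam := (normal_prob 0 1 : probability (measurableTypeR R) R).
Variables (n : nat) (S : O -> R).
Hypothesis S_mgf : forall u, avg (fun w => expR (u * S w)) = cosh (u / Num.sqrt n.+1%:R) ^+ n.+1.

Lemma continuous_cosh_pow (u : R) m : continuous (fun y : R => cosh (u * y) ^+ m).
Proof.
move=> y; apply: (@cvg_comp _ _ _ (fun y => cosh (u * y)) (fun z => z ^+ m) _ (nbhs (cosh (u * y)))); last exact: exprn_continuous.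
apply: cvgM; last exact: cvg_cst.
apply: cvgD; first exact: continuous_expRM.
by under eq_fun do rewrite -mulNr; rewrite -[- (u * y)]mulNr; exact: continuous_expRM.
Qed.

Lemma L1_cosh_pow th : 0 <= th < 2^-1 ->
  L1 gam (fun y => cosh (Num.sqrt (2 * th / n.+1%:R) * y) ^+ n.+1).
Proof.
move=> /andP[th0 th1]; apply: (L1_dom _ _ (gauss_expRsqr th1).1).
  by apply: continuous_measurable_fun => y; exact: continuous_cosh_pow.
move=> y; rewrite ger0_norm; last by rewrite exprn_ge0// ltW// cosh_gt0.
exact: cosh_pow_le.
Qed.

(** The Hubbard-Stratonovich identity: [expR (th * S^2)] is the mean of [expR (sqrt (2 th) * S * y)]
    over a standard normal [y], and the mean over [S] is then known by hypothesis. *)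
Lemma avg_expRsqr th : 0 <= th < 2^-1 ->
  avg (fun w => expR (th * S w ^+ 2)) =
  Ex gam (fun y => cosh (Num.sqrt (2 * th / n.+1%:R) * y) ^+ n.+1).
Proof.
move=> /andP[th0 th1].
have e w : expR (th * S w ^+ 2) = Ex gam (fun y => expR (Num.sqrt (2 * th) * S w * y)).
  rewrite (gauss_expR _).2; congr expR; rewrite exprMn sqr_sqrtr ?mulr_ge0//; by field.
under eq_avg do rewrite e.
rewrite -Ex_avg; last by move=> w; exact: (gauss_expR _).1.
congr Ex; apply/funext => y; under eq_avg do rewrite mulrAC.
rewrite S_mgf; congr (cosh _ ^+ _); rewrite [in RHS]sqrtrM ?mulr_ge0// sqrtrV; last by rewrite ler0n.
by rewrite mulrAC.
Qed.

Lemma avg_expRsqr_le th : 0 <= th < 2^-1 -> avg (fun w => expR (th * S w ^+ 2)) <= kth th.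
Proof.
move=> h; have /andP[th0 th1] := h; rewrite avg_expRsqr// -(gauss_expRsqr th1).2.
apply: Ex_le; [exact: L1_cosh_pow|exact: (gauss_expRsqr th1).1|].
by move=> y; exact: cosh_pow_le.
Qed.

Lemma avg_expRsqr_approx th ka : 0 <= th < ka -> ka < 2^-1 ->
  `|avg (fun w => expR (th * S w ^+ 2)) - kth th| <=
  4 * th ^+ 2 / (ka - th) ^+ 2 / n.+1%:R * kth ka.
Proof.
move=> h ka1; have /andP[th0 thka] := h; have th1 := lt_trans thka ka1.
have hh : 0 <= th < 2^-1 by rewrite th0.
rewrite avg_expRsqr// -(gauss_expRsqr th1).2 -(gauss_expRsqr ka1).2.
rewrite -ExB; [|exact: L1_cosh_pow|exact: (gauss_expRsqr th1).1].
rewrite -ExZ; last exact: (gauss_expRsqr ka1).1.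
apply: Ex_normr_le; last exact/L1Z/(gauss_expRsqr ka1).1.
  exact: (L1_meas (L1B (L1_cosh_pow hh) (gauss_expRsqr th1).1)).
by move=> y; exact: cosh_pow_approx.
Qed.

End linearization.

Lemma big_ord6 (V : Type) (idx : V) (op : Monoid.law idx) (F : 'I_6 -> V) :
  \big[op/idx]_e F e = op (op (op (op (op (F 0) (F 1)) (F 2)) (F 3)) (F 4)) (F 5).
Proof.
rewrite !big_ord_recl big_ord0 Monoid.mulm1 !Monoid.mulmA.
have -> : lift ord0 ord0 = 1 :> 'I_6 by exact: val_inj.
have -> : lift ord0 (lift ord0 ord0) = 2 :> 'I_6 by exact: val_inj.
have -> : lift ord0 (lift ord0 (lift ord0 ord0)) = 3 :> 'I_6 by exact: val_inj.
have -> : lift ord0 (lift ord0 (lift ord0 (lift ord0 ord0))) = 4 :> 'I_6 by exact: val_inj.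
have -> : lift ord0 (lift ord0 (lift ord0 (lift ord0 (lift ord0 ord0)))) = 5 :> 'I_6 by exact: val_inj.
by have -> : ord0 = 0 :> 'I_6 by exact: val_inj.
Qed.

Section product_means.
Context {R : realType}.
Local Notation avg := uniform_mean.

Lemma avg_pair (A B : finType) (f : A * B -> R) :
  avg f = avg (fun a => avg (fun b => f (a, b))).
Proof.
rewrite /uniform_mean card_prod natrM invfM -mulr_suml -mulrA [_^-1 * _^-1]mulrC.
by rewrite (pair_big xpredT xpredT (fun a b => f (a, b))) /= ; congr (_ * _); apply: eq_bigr => -[].
Qed.

Lemma avg_ffun (I A : finType) (h : I -> A -> R) :
  avg (fun s : {ffun I -> A} => \prod_i h i (s i)) = \prod_i avg (h i).
Proof.
rewrite /uniform_mean card_ffun -bigA_distr_bigA /= big_split /=; congr (_ * _).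
by rewrite prodr_const natrX exprVn.
Qed.

Lemma avg_bool (f : bool -> R) : avg f = (f true + f false) / 2.
Proof. by rewrite /uniform_mean big_bool card_bool. Qed.

End product_means.

Section overlaps.
Context {R : realType} (n : nat).
Local Notation avg := uniform_mean.
Local Notation spins := {ffun 'I_n -> bool}.
Implicit Types s : spins.

Definition sg (b : bool) : R := (-1) ^+ b.

Lemma normr_sg b : `|sg b| = 1.
Proof. by rewrite /sg normrX normrN1 expr1n. Qed.

Definition ov s s' : R := \sum_i sg (s i) * sg (s' i).

Lemma ov_mgf u s' : avg (fun s => expR (u * ov s s')) = cosh u ^+ n.
Proof.
have e s : expR (u * ov s s') = \prod_i expR (u * (sg (s i) * sg (s' i))).
  by rewrite /ov mulr_sumr expR_sum.
under eq_avg do rewrite e.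
rewrite (avg_ffun (fun i b => expR (u * (sg b * sg (s' i))))).
rewrite -[X in _ = _ ^+ X](card_ord n) -prodr_const; apply: eq_bigr => i _.
rewrite avg_bool /cosh /sg; case: (s' i) => /=; rewrite ?expr1 ?expr0.
  have -> : u * (-1 * -1) = u by ring.
  by have -> : u * (1 * -1) = - u by ring.
have -> : u * (-1 * 1) = - u by ring.
have -> : u * (1 * 1) = u by ring.
by rewrite addrC.
Qed.

Lemma ov_mgf2 u : avg (fun p : spins * spins => expR (u * ov p.1 p.2)) = cosh u ^+ n.
Proof.
rewrite avg_pair avg_exchange /=.
under eq_avg do rewrite ov_mgf.
by rewrite avg_cst// card_ffun card_bool expn_gt0.
Qed.

Lemma normr_ov s s' : `|ov s s'| <= n%:R.
Proof.
apply: (le_trans (ler_norm_sum _ _ _)).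
under eq_bigr do rewrite normrM !normr_sg mulr1.
by rewrite sumr_const card_ord.
Qed.

Lemma ov_diag s : ov s s = n%:R.
Proof.
rewrite /ov; under eq_bigr do rewrite -expr2 /sg sqrr_sign.
by rewrite sumr_const card_ord.
Qed.

Lemma ovC s s' : ov s s' = ov s' s.
Proof. by apply: eq_bigr => i _; rewrite mulrC. Qed.

Definition quadruple : finType := (spins * spins * (spins * spins))%type.

(** The six pairs of four replicas, in the order 12, 34, 14, 23, 13, 24 of the covariances in
    [tilt_quadruple]. The pairs 12 and 34 are those that carry a factor [N * xi R - c] in the square
    of the deviation. *)
Definition edge_ov (e : 'I_6) (w : quadruple) : R :=
  match val e with
  | 0 => ov w.1.1 w.1.2
  | 1 => ov w.2.1 w.2.2
  | 2 => ov w.1.1 w.2.2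
  | 3 => ov w.1.2 w.2.1
  | 4 => ov w.1.1 w.2.1
  | _ => ov w.1.2 w.2.2
  end.

Definition edge_sg (l : 'I_6 -> R) (a b c d : bool) : R :=
  l 0 * (sg a * sg b) + l 1 * (sg c * sg d) + l 2 * (sg a * sg d) +
  l 3 * (sg b * sg c) + l 4 * (sg a * sg c) + l 5 * (sg b * sg d).

Lemma edge_sum (l : 'I_6 -> R) (w : quadruple) :
  \sum_e l e * edge_ov e w =
  \sum_i edge_sg l (w.1.1 i) (w.1.2 i) (w.2.1 i) (w.2.2 i).
Proof.
have o (x : R) s s' : x * ov s s' = \sum_i x * (sg (s i) * sg (s' i)) by rewrite mulr_sumr.
by rewrite big_ord6 /edge_ov /= !o -!big_split /=.
Qed.

Lemma edge_mgf (l : 'I_6 -> R) :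
  avg (fun w : quadruple => expR (\sum_e l e * edge_ov e w)) =
  avg (fun a => avg (fun b => avg (fun c => avg (fun d => expR (edge_sg l a b c d))))) ^+ n.
Proof.
under eq_avg do rewrite edge_sum expR_sum.
rewrite avg_pair avg_pair /=.
under eq_avg do under eq_avg do rewrite avg_pair /=.
under eq_avg => s1.
  under eq_avg => s2.
    under eq_avg => s3.
      rewrite (avg_ffun (fun i d => expR (edge_sg l (s1 i) (s2 i) (s3 i) d))); over.
    rewrite (avg_ffun (fun i c => avg (fun d => expR (edge_sg l (s1 i) (s2 i) c d)))); over.
  rewrite (avg_ffun (fun i b => avg (fun c => avg (fun d => expR (edge_sg l (s1 i) b c d))))); over.
rewrite (avg_ffun (fun _ a => avg (fun b => avg (fun c => avg (fun d => expR (edge_sg l a b c d)))))).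
by rewrite prodr_const card_ord.
Qed.

Lemma edge_mgf1 e u : avg (fun w : quadruple => expR (u * edge_ov e w)) = cosh u ^+ n.
Proof.
have S0 : (0 < #|{: spins}|)%N by rewrite card_ffun card_bool expn_gt0.
have c (x : R) : avg (fun _ : spins => x) = x by apply: avg_cst.
rewrite avg_pair avg_pair /edge_ov /=.
under eq_avg do under eq_avg do rewrite avg_pair /=.
case: e => -[|[|[|[|[|[|]]]]]]//= _.
- under eq_avg do under eq_avg do (under eq_avg do rewrite c; rewrite c).
  rewrite avg_exchange; under eq_avg do rewrite ov_mgf.
  by rewrite c.
- under eq_avg do under eq_avg do (rewrite avg_exchange; under eq_avg do rewrite ov_mgf).
  by under eq_avg do (under eq_avg do rewrite c; rewrite c); rewrite c.
- rewrite avg_exchange; under eq_avg do rewrite avg_exchange.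
  under eq_avg do (under eq_avg do rewrite avg_exchange).
  under eq_avg do under eq_avg do under eq_avg do rewrite ov_mgf.
  by under eq_avg do (under eq_avg do rewrite c; rewrite c); rewrite c.
- under eq_avg do rewrite avg_exchange.
  under eq_avg do under eq_avg do rewrite avg_exchange.
  under eq_avg do under eq_avg do under eq_avg do rewrite ov_mgf.
  by under eq_avg do (under eq_avg do rewrite c; rewrite c); rewrite c.
- rewrite avg_exchange; under eq_avg do rewrite avg_exchange.
  under eq_avg do under eq_avg do (under eq_avg do rewrite c).
  under eq_avg do under eq_avg do rewrite ov_mgf.
  by under eq_avg do rewrite c; rewrite c.
- under eq_avg do rewrite avg_exchange.
  under eq_avg do under eq_avg do rewrite avg_exchange.
  under eq_avg do under eq_avg do under eq_avg do rewrite ov_mgf.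
  by under eq_avg do (under eq_avg do rewrite c; rewrite c); rewrite c.
Qed.

End overlaps.

Section replica_clt.
Context {R : realType}.
Local Notation avg := uniform_mean.

Lemma edge_sg_mean (l : 'I_6 -> R) :
  avg (fun a => avg (fun b => avg (fun c => avg (fun d => edge_sg l a b c d)))) = 0.
Proof.
rewrite !avg_bool /edge_sg /sg /= !expr0 !expr1; by field.
Qed.

(** The six products of two among four independent signs are orthonormal: distinct overlaps are
    uncorrelated, although dependent. *)
Lemma edge_sg_var (l : 'I_6 -> R) :
  avg (fun a => avg (fun b => avg (fun c => avg (fun d => edge_sg l a b c d ^+ 2)))) =
  \sum_e l e ^+ 2.
Proof.
by rewrite !avg_bool /edge_sg /sg /= !expr0 !expr1 big_ord6 /=; field.
Qed.

Lemma edge_sg_norm (l : 'I_6 -> R) a b c d : `|edge_sg l a b c d| <= \sum_e `|l e|.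
Proof.
rewrite big_ord6 /edge_sg /=.
have h (x y z : R) : `|y| = 1 -> `|z| = 1 -> `|x * (y * z)| = `|x|.
  by move=> hy hz; rewrite !normrM hy hz !mulr1.
do 5 (apply: (le_trans (ler_normD _ _)); apply: lerD; last by rewrite h ?normr_sg).
by rewrite h ?normr_sg.
Qed.

(* The limit is the Laplace transform of six independent standard normal variables. *)
Lemma edge_clt (l : 'I_6 -> R) :
  avg (fun w : quadruple n.+1 => expR (\sum_e l e * (edge_ov e w / Num.sqrt n.+1%:R)))
    @[n --> \oo] --> expR ((\sum_e l e ^+ 2) / 2).
Proof.
pose m : R := \sum_e l e ^+ 2; pose G : R := \sum_e `|l e|.
have G0 : 0 <= G by exact: sumr_ge0.
have m0 : 0 <= m by apply: sumr_ge0 => e _; exact: sqr_ge0.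
pose av (f : bool -> bool -> bool -> bool -> R) : R :=
  avg (fun a => avg (fun b => avg (fun c => avg (fun d => f a b c d)))).
pose q (r : R) := av (fun a b c d => expR (r * edge_sg l a b c d)).
have avle f g : (forall a b c d, f a b c d <= g a b c d) -> av f <= av g.
  by move=> fg; do 4 (apply: avg_le => ?).
have avn f : `|av f| <= av (fun a b c d => `|f a b c d|).
  do 3 (apply: (le_trans (normr_avg _)); apply: avg_le => ?).
  exact: normr_avg.
have avc k : av (fun _ _ _ _ => k) = k by rewrite /av !avg_bool; field.
have qr (r : R) : 0 <= r <= 1 -> `|q r - (1 + r ^+ 2 * m / 2)| <= r ^+ 3 * (G ^+ 3 * expR G).
  move=> /andP[r0 r1].
  have -> : q r - (1 + r ^+ 2 * m / 2) = av (fun a b c d =>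
      expR (r * edge_sg l a b c d) - 1 - r * edge_sg l a b c d - (r * edge_sg l a b c d) ^+ 2 / 2).
    have e1 := edge_sg_mean l; have e2 := edge_sg_var l.
    rewrite -/m in e2; rewrite -e2 /q /av -[X in X = _]addr0 -(mulr0 (- r)) -e1.
    by rewrite !avg_bool; field.
  apply: (le_trans (avn _)); rewrite -[leRHS]avc; apply: avle => a b c d.
  apply: (le_trans (normr_expRB3_le _)).
  have h := edge_sg_norm l a b c d; rewrite -/G in h.
  rewrite normrM (ger0_norm r0) exprMn -mulrA ler_wpM2l ?exprn_ge0//.
  apply: ler_pM; rewrite ?exprn_ge0 ?expR_ge0//; first by rewrite lerXn2r ?nnegrE.
  rewrite ler_expR -[leRHS]mul1r; exact: ler_pM.
(* [M] serves three times: both one-site factors are at most [expR (r^2 * M)], and they differ by at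
   most [r^3 * M]. As [r^2 = 1 / (n + 1)], the powers of order [n + 1] then differ by at most a
   multiple of [r]. *)
pose M : R := m / 2 + G ^+ 3 * expR G + m ^+ 2 * expR m.
have M0 : 0 <= G ^+ 3 * expR G by rewrite mulr_ge0 ?exprn_ge0 ?expR_ge0.
have M1 : 0 <= m ^+ 2 * expR m by rewrite mulr_ge0 ?exprn_ge0 ?expR_ge0.
have M2 : 0 <= M by rewrite /M; lra.
have key n : `|q (Num.sqrt n.+1%:R)^-1 ^+ n.+1 - expR (m / 2)| <= expR M * M * (Num.sqrt n.+1%:R)^-1.
  set r : R := (Num.sqrt n.+1%:R)^-1.
  have n0 : (0 : R) < n.+1%:R by rewrite ltr0n.
  have r0 : 0 <= r by rewrite invr_ge0 sqrtr_ge0.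
  have r2 : r ^+ 2 = n.+1%:R^-1 by rewrite /r exprVn sqr_sqrtr ?ltW.
  have r1 : r <= 1.
    by rewrite /r invf_le1 ?sqrtr_gt0// -[leLHS]sqrtr1 ler_wsqrtr// ler1n.
  have rb : 0 <= r <= 1 by rewrite r0.
  have e : expR (m / 2) = expR (r ^+ 2 * m / 2) ^+ n.+1.
    by rewrite -expRM_natl r2; congr expR; field; rewrite nat1r gt_eqF.
  have h1 := qr r rb.
  have y0 : 0 <= r ^+ 2 * m / 2 by rewrite divr_ge0// mulr_ge0// sqr_ge0.
  have r21 : r ^+ 2 <= 1 by rewrite expr_le1.
  have r32 : r ^+ 3 <= r ^+ 2 by rewrite exprSr ler_piMr// sqr_ge0.
  have h2 : `|expR (r ^+ 2 * m / 2) - (1 + r ^+ 2 * m / 2)| <= r ^+ 3 * (m ^+ 2 * expR m).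
    have := normr_expRB2_le (r ^+ 2 * m / 2); rewrite -[_ - 1 - _]addrA -opprD (ger0_norm y0) => h.
    apply: (le_trans h).
    have -> : (r ^+ 2 * m / 2) ^+ 2 = r ^+ 3 * (m ^+ 2 * (r / 4)) by field.
    have k0 : 0 <= r ^+ 3 * m ^+ 2 by rewrite mulr_ge0 ?exprn_ge0 ?sqr_ge0.
    have -> : r ^+ 3 * (m ^+ 2 * (r / 4)) * expR (r ^+ 2 * m / 2) =
      r ^+ 3 * m ^+ 2 * ((r / 4) * expR (r ^+ 2 * m / 2)) by ring.
    rewrite [leRHS]mulrA; apply: (ler_wpM2l k0).
    rewrite -[leRHS]mul1r; apply: ler_pM; rewrite ?expR_ge0//.
    - by rewrite divr_ge0.
    - lra.
    have : r ^+ 2 * m <= m by rewrite ler_piMl.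
    rewrite ler_expR; lra.
  have q0 : 0 <= q r by do 4 (apply: avg_ge0 => ?); exact: expR_ge0.
  have eM : expR (r ^+ 2 * M) ^+ n.+1 = expR M.
    by rewrite -expRM_natl r2; congr expR; field; rewrite nat1r gt_eqF.
  have r20 : 0 <= r ^+ 2 by exact: sqr_ge0.
  have qM : q r <= expR (r ^+ 2 * M).
    apply: le_trans (expR_ge1Dx _); move: h1; rewrite ler_norml => /andP[_ h1].
    have : r ^+ 3 * (G ^+ 3 * expR G) <= r ^+ 2 * (G ^+ 3 * expR G) by rewrite ler_wpM2r.
    have : 0 <= r ^+ 2 * (m ^+ 2 * expR m) by rewrite mulr_ge0.
    rewrite /M; move: (G ^+ 3 * _) (m ^+ 2 * _) h1 => k1 k2; lra.
  have eq : expR (r ^+ 2 * m / 2) <= expR (r ^+ 2 * M).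
    rewrite ler_expR -mulrA ler_wpM2l// /M; lra.
  have b1 : 0 <= q r <= expR (r ^+ 2 * M) by rewrite q0.
  have b2 : 0 <= expR (r ^+ 2 * m / 2) <= expR (r ^+ 2 * M) by rewrite expR_ge0.
  rewrite e; apply: (le_trans (normr_exprB_le n b1 b2)).
  have b3 : expR (r ^+ 2 * M) ^+ n <= expR M.
    by rewrite -eM; apply: ler_weXn2l => //; rewrite -expR0 ler_expR mulr_ge0.
  have h3 : `|q r - expR (r ^+ 2 * m / 2)| <= r ^+ 3 * M.
    have -> : q r - expR (r ^+ 2 * m / 2) = (q r - (1 + r ^+ 2 * m / 2)) -
       (expR (r ^+ 2 * m / 2) - (1 + r ^+ 2 * m / 2)) by ring.
    apply: (le_trans (ler_normB _ _)).
    have : 0 <= r ^+ 3 * m / 2 by rewrite divr_ge0// mulr_ge0// exprn_ge0.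
    rewrite /M; move: h1 h2; move: (G ^+ 3 * _) (m ^+ 2 * _) => k1 k2; lra.
  apply: (@le_trans _ _ (n.+1%:R * expR M * (r ^+ 3 * M))).
    have x0 : 0 <= n.+1%:R * expR (r ^+ 2 * M) ^+ n.
      by apply: mulr_ge0 => //; apply: exprn_ge0; exact: expR_ge0.
    by apply: ler_pM x0 (normr_ge0 _) _ h3; apply: ler_wpM2l.
  rewrite [r ^+ 3]exprSr r2 le_eqVlt; apply/orP; left; apply/eqP.
  by field; rewrite nat1r gt_eqF.
have eq n : avg (fun w : quadruple n.+1 => expR (\sum_e l e * (edge_ov e w / Num.sqrt n.+1%:R))) =
    q (Num.sqrt n.+1%:R)^-1 ^+ n.+1.
  set r := (Num.sqrt n.+1%:R)^-1.
  have e w : \sum_e l e * (edge_ov e w / Num.sqrt n.+1%:R) = \sum_e (fun e => r * l e) e * edge_ov e w :> R.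
    by apply: eq_bigr => i _; rewrite -/r; ring.
  under eq_avg do rewrite e.
  rewrite edge_mgf; congr (_ ^+ _).
  by do 4 (apply: eq_avg => ?); congr expR; rewrite /edge_sg; ring.
under eq_fun do rewrite eq.
exact: cvg_rate cvg_invsqrtn key.
Qed.

End replica_clt.

(** * Approximation by exponential sums relative to a Gaussian weight *)

Section exponential_sums.
Context {R : realType}.
Implicit Types (ka e l G H : R) (f g : nat -> R -> R) (b : seq (R * R)).

Definition expsum b (s : R) : R := \sum_(p <- b) p.1 * expR (p.2 * s).

(* The mean of [expsum b] under the standard normal law. *)
Definition expval b : R := \sum_(p <- b) p.1 * expR (p.2 ^+ 2 / 2).

(* Approximation by exponential sums, uniformly on the range of a normalised overlap and
   relatively to [expR (ka * s ^+ 2)]; [G] is then the limit of the normal means. *)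
Definition expsum_limit ka f G : Prop :=
  (exists C, forall n s, s ^+ 2 <= n.+1%:R -> `|f n s| <= C * expR (ka * s ^+ 2)) /\
  forall e, 0 < e -> exists b, `|expval b - G| <= e /\
    \forall n \near \oo, forall s, s ^+ 2 <= n.+1%:R ->
      `|f n s - expsum b s| <= e * expR (ka * s ^+ 2).

Lemma expR_lin_le l ka s : 0 < ka -> expR (l * s) <= expR (l ^+ 2 / ka) * expR (ka * s ^+ 2).
Proof.
move=> ka0; rewrite -expRD ler_expR.
have : 0 <= (l - ka * s / 2) ^+ 2 / ka + 3 / 4 * (ka * s ^+ 2).
  have k0 := ltW ka0; apply: addr_ge0; first by rewrite divr_ge0// sqr_ge0.
  by apply: mulr_ge0; [rewrite divr_ge0|rewrite mulr_ge0// sqr_ge0].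
have -> : (l - ka * s / 2) ^+ 2 / ka + 3 / 4 * (ka * s ^+ 2) = l ^+ 2 / ka - l * s + ka * s ^+ 2.
  by field; rewrite gt_eqF.
lra.
Qed.

Lemma expsum_limit_exp ka l : 0 < ka ->
  expsum_limit ka (fun _ s => expR (l * s)) (expR (l ^+ 2 / 2)).
Proof.
move=> ka0; split.
  exists (expR (l ^+ 2 / ka)) => n s _.
  by rewrite ger0_norm ?expR_ge0// expR_lin_le.
move=> e e0; exists [:: (1, l)]; split.
  by rewrite /expval big_seq1 /= mul1r subrr normr0 ltW.
apply: nearW => n s _; rewrite /expsum big_seq1 /= mul1r subrr normr0.
by rewrite mulr_ge0 ?expR_ge0// ltW.
Qed.

Lemma expsum_limit_bounded ka f G : expsum_limit ka f G ->
  exists C, 0 <= C /\ forall n s, s ^+ 2 <= n.+1%:R -> `|f n s| <= C * expR (ka * s ^+ 2).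
Proof.
move=> [[C h] _]; exists `|C|; split=> // n s hs; apply: (le_trans (h n s hs)).
by rewrite ler_wpM2r ?expR_ge0// ler_norm.
Qed.

Lemma expsum_limitD ka f g G H : expsum_limit ka f G -> expsum_limit ka g H ->
  expsum_limit ka (fun n s => f n s + g n s) (G + H).
Proof.
move=> fG gH; have [C [_ hC]] := expsum_limit_bounded fG.
have [D [_ hD]] := expsum_limit_bounded gH; split.
  exists (C + D) => n s hs; rewrite mulrDl (le_trans (ler_normD _ _))// lerD//.
    exact: hC.
  exact: hD.
move=> e e0; have e2 : 0 < e / 2 by rewrite divr_gt0.
have [b1 [b1G b1f]] := fG.2 _ e2; have [b2 [b2H b2g]] := gH.2 _ e2.
exists (b1 ++ b2); split.
  rewrite /expval big_cat /= opprD addrACA [e]splitr.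
  by rewrite (le_trans (ler_normD _ _))// lerD.
apply: filterS2 b1f b2g => n h1 h2 s hs.
rewrite /expsum big_cat /= opprD addrACA [e]splitr mulrDl.
by rewrite (le_trans (ler_normD _ _))// lerD//; [exact: h1|exact: h2].
Qed.

Lemma expsum_limitZ ka f G (k : R) : expsum_limit ka f G ->
  expsum_limit ka (fun n s => k * f n s) (k * G).
Proof.
move=> fG; have [C [C0 hC]] := expsum_limit_bounded fG; split.
  exists (`|k| * C) => n s hs; rewrite normrM -mulrA ler_wpM2l//; exact: hC.
move=> e e0.
have k1 : 0 < `|k| + 1 by rewrite ltr_wpDl.
have e2 : 0 < e / (`|k| + 1) by rewrite divr_gt0.
have ke : `|k| * (e / (`|k| + 1)) <= e.
  by rewrite mulrCA ler_piMr ?(ltW e0)// ler_pdivrMr// mul1r lerDl.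
have [b [bG bf]] := fG.2 _ e2.
exists [seq (k * p.1, p.2) | p <- b].
have E s : expsum [seq (k * p.1, p.2) | p <- b] s = k * expsum b s.
  by rewrite /expsum big_map mulr_sumr; apply: eq_bigr => p _; rewrite mulrA.
have V : expval [seq (k * p.1, p.2) | p <- b] = k * expval b.
  by rewrite /expval big_map mulr_sumr; apply: eq_bigr => p _; rewrite mulrA.
split.
  rewrite V -mulrBr normrM; apply: le_trans ke.
  by rewrite ler_wpM2l.
apply: filterS bf => n bf s hs.
rewrite E -mulrBr normrM; apply: (@le_trans _ _ (`|k| * (e / (`|k| + 1) * expR (ka * s ^+ 2)))).
  by rewrite ler_wpM2l// bf.
by rewrite mulrA ler_wpM2r ?expR_ge0.
Qed.

Lemma expsum_limit_lim ka f G C :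
  (forall n s, s ^+ 2 <= n.+1%:R -> `|f n s| <= C * expR (ka * s ^+ 2)) ->
  (forall e, 0 < e -> exists g H, [/\ expsum_limit ka g H, `|H - G| <= e &
    \forall n \near \oo, forall s, s ^+ 2 <= n.+1%:R ->
      `|f n s - g n s| <= e * expR (ka * s ^+ 2)]) ->
  expsum_limit ka f G.
Proof.
move=> hC h; split; first by exists C.
move=> e e0; have e2 : 0 < e / 2 by rewrite divr_gt0.
have [g [H [gH HG fg]]] := h _ e2.
have [b [bH bg]] := gH.2 _ e2.
exists b; split.
  have -> : expval b - G = (expval b - H) + (H - G) by rewrite addrA subrK.
  by rewrite [e]splitr (le_trans (ler_normD _ _))// lerD.
apply: filterS2 fg bg => n h1 h2 s hs.
have -> : f n s - expsum b s = (f n s - g n s) + (g n s - expsum b s) by rewrite addrA subrK.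
rewrite [e]splitr mulrDl (le_trans (ler_normD _ _))// lerD//; first exact: h1.
exact: h2.
Qed.

Lemma cvg_seqsum (I : Type) (r : seq I) (u : nat -> I -> R) (l : I -> R) :
  (forall i, u n i @[n --> \oo] --> l i) ->
  \sum_(i <- r) u n i @[n --> \oo] --> \sum_(i <- r) l i.
Proof.
move=> ul; elim: r => [|i r IH].
  by rewrite big_nil; under eq_fun do rewrite big_nil; exact: cvg_cst.
by rewrite big_cons; under eq_fun do rewrite big_cons; exact: cvgD.
Qed.

Lemma cvg_approx (u : nat -> R) (l M : R) :
  (forall e, 0 < e -> exists (v : nat -> R) (k : R), [/\ v n @[n --> \oo] --> k,
     `|k - l| <= M * e & \forall n \near \oo, `|u n - v n| <= M * e]) ->
  u n @[n --> \oo] --> l.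
Proof.
move=> h; apply/cvgrPdist_le => e e0.
have M0 : 0 < `|M| + 1 by rewrite ltr_wpDl.
have e1 : 0 < e / 3 / (`|M| + 1) by rewrite !divr_gt0.
have Me : M * (e / 3 / (`|M| + 1)) <= e / 3.
  apply: (@le_trans _ _ ((`|M| + 1) * (e / 3 / (`|M| + 1)))).
    by rewrite ler_wpM2r ?(ltW e1)// (le_trans (ler_norm _))// lerDl.
  by rewrite mulrCA divff ?mulr1// gt_eqF.
have [v [k [vk kl uv]]] := h _ e1.
have e3 : 0 < e / 3 by rewrite divr_gt0.
have /cvgrPdist_le/(_ _ e3) vk' := vk.
near=> n.
have -> : l - u n = - (k - l) + (k - v n) - (u n - v n) by ring.
have -> : e = e / 3 + e / 3 + e / 3 by field.
rewrite (le_trans (ler_normB _ _))// lerD//; last first.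
  by apply: le_trans Me; near: n; exact: uv.
rewrite (le_trans (ler_normD _ _))// lerD//; first by rewrite normrN (le_trans kl).
by near: n; exact: vk'.
Unshelve. all: end_near. Qed.

End exponential_sums.

Section edges.
Context {R : realType}.
Local Notation avg := uniform_mean.
Variable ka : R.
Hypotheses (ka0 : 0 < ka) (ka1 : 6 * ka < 2^-1).
Implicit Types (f : 'I_6 -> nat -> R -> R) (G : 'I_6 -> R).

Definition norm_ov n (e : 'I_6) (w : quadruple n.+1) : R := edge_ov e w / Num.sqrt n.+1%:R.

Lemma norm_ov_sqr n e (w : quadruple n.+1) : norm_ov e w ^+ 2 <= n.+1%:R.
Proof.
have n0 : (0 : R) < n.+1%:R by rewrite ltr0n.
rewrite /norm_ov expr_div_n sqr_sqrtr; last exact: ltW.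
rewrite ler_pdivrMr// -expr2.
rewrite -(real_normK (num_real _)) lerXn2r ?nnegrE//.
by rewrite /edge_ov; case: e => -[|[|[|[|[|?]]]]] /= _; exact: normr_ov.
Qed.

Lemma norm_ov_mgf n e u :
  avg (fun w : quadruple n.+1 => expR (u * norm_ov e w)) = cosh (u / Num.sqrt n.+1%:R) ^+ n.+1.
Proof.
rewrite -(edge_mgf1 n.+1 e); apply: eq_avg => w; congr expR.
by rewrite /norm_ov; ring.
Qed.

Lemma quadruple_gt0 n : (0 < #|quadruple n|)%N.
Proof. by rewrite !card_prod card_ffun card_bool !muln_gt0 expn_gt0. Qed.

(** The six overlaps being dependent, the product is bounded by the sixth power of its largest
    factor, hence by the sum of the sixth powers. This is where [6 * ka < 1 / 2] is needed. *)
Lemma edges_weight_le n :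
  avg (fun w : quadruple n.+1 => \prod_e expR (ka * norm_ov e w ^+ 2)) <= 6 * kth (6 * ka).
Proof.
have h : 0 <= 6 * ka < 2^-1 by rewrite mulr_ge0 ?(ltW ka0).
apply: (@le_trans _ _ (avg (fun w : quadruple n.+1 => \sum_e expR (6 * ka * norm_ov e w ^+ 2)))).
  apply: avg_le => w; pose a (e : 'I_6) : R := ka * norm_ov e w ^+ 2.
  have [e _ amax] := @Order.TotalTheory.arg_maxP _ _ _ ord0 xpredT a isT.
  rewrite -expR_sum [leRHS](bigD1 e)//=.
  apply: (@le_trans _ _ (expR (6 * ka * norm_ov e w ^+ 2))); last first.
    by rewrite lerDl sumr_ge0// => i _; exact: expR_ge0.
  rewrite ler_expR -mulrA -/(a e).
  apply: (@le_trans _ _ (\sum_(i < 6) a e)); last by rewrite sumr_const card_ord mulr_natl.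
  by apply: ler_sum => i _; exact: amax.
have -> : avg (fun w : quadruple n.+1 => \sum_e expR (6 * ka * norm_ov e w ^+ 2)) =
   \sum_e avg (fun w : quadruple n.+1 => expR (6 * ka * norm_ov e w ^+ 2)).
  by rewrite /uniform_mean exchange_big /= mulr_suml.
apply: (@le_trans _ _ (\sum_(e < 6) kth (6 * ka))).
  by apply: ler_sum => e _; apply: (avg_expRsqr_le _ h) => u; exact: norm_ov_mgf.
by rewrite sumr_const card_ord -[leLHS]mulr_natl.
Qed.

Let A f n := avg (fun w : quadruple n.+1 => \prod_e f e n (norm_ov e w)).

Let upd f e0 (g : nat -> R -> R) : 'I_6 -> nat -> R -> R := fun e => if e == e0 then g else f e.

Let prod_upd f e0 g n (w : quadruple n.+1) :
  \prod_e upd f e0 g e n (norm_ov e w) =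
  g n (norm_ov e0 w) * \prod_(e | e != e0) f e n (norm_ov e w).
Proof.
rewrite (bigD1 e0)//= /upd eqxx; congr (_ * _); apply: eq_bigr => e ee0.
by rewrite (negbTE ee0).
Qed.

Let A_expsum f e0 b n : A (upd f e0 (fun _ => expsum b)) n =
  \sum_(p <- b) p.1 * A (upd f e0 (fun _ s => expR (p.2 * s))) n.
Proof.
have e (F : (R * R) -> quadruple n.+1 -> R) : \sum_(p <- b) p.1 * avg (F p) =
    avg (fun w => \sum_(p <- b) p.1 * F p w).
  elim: b => [|p b IH]; first by rewrite big_nil; under eq_avg do rewrite big_nil;
    rewrite avg_cst ?quadruple_gt0.
  by rewrite big_cons IH -avgZ -avgD; apply: eq_avg => w; rewrite big_cons.
rewrite /A e; apply: eq_avg => w.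
rewrite prod_upd /expsum mulr_suml; apply: eq_bigr => p _.
by rewrite prod_upd mulrA.
Qed.

(** The functions are replaced by exponential sums one edge at a time, at a cost controlled by
    [edges_weight_le]; once all of them are exponentials, [edge_clt] gives the limit. *)
Lemma edges_limit f G : (forall e, expsum_limit ka (f e) (G e)) ->
  avg (fun w : quadruple n.+1 => \prod_e f e n (norm_ov e w)) @[n --> \oo] --> \prod_e G e.
Proof.
(* Induction on [k], where the edges of index at least [k] already carry a single exponential. An
   exponential sum on the next edge is expanded by multilinearity, and each term falls under the
   induction hypothesis. *)
suff main k : forall f G, (k <= 6)%N -> (forall e, expsum_limit ka (f e) (G e)) ->
    (forall e : 'I_6, (k <= e)%N -> exists l, f e = (fun _ s => expR (l * s)) /\
      G e = expR (l ^+ 2 / 2)) ->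
    A f n @[n --> \oo] --> \prod_e G e.
  move=> fG; apply: (main 6 f G (leqnn _) fG) => e.
  by rewrite leqNgt ltn_ord.
elim: k => [|k IH] {}f {}G k6 fG fexp.
  have [l hl] := choice (fun e => fexp e (leq0n e)).
  under eq_bigr do rewrite (hl _).2.
  rewrite -expR_sum -mulr_suml.
  have -> : A f = fun n => avg (fun w : quadruple n.+1 => expR (\sum_e l e * (edge_ov e w / Num.sqrt n.+1%:R))).
    apply/funext => n; apply: eq_avg => w.
    by rewrite expR_sum; apply: eq_bigr => e _; rewrite (hl e).1.
  exact: edge_clt.
pose e0 : 'I_6 := Ordinal k6.
have [C hC] := choice (fun e => expsum_limit_bounded (fG e)).
pose P := \prod_(e | e != e0) G e; pose Q := \prod_(e | e != e0) C e.
have Q0 : 0 <= Q by apply: prodr_ge0 => e _; exact: (hC e).1.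
have K0 : 0 <= kth (6 * ka) by rewrite invr_ge0 sqrtr_ge0.
apply: (@cvg_approx R _ _ (`|P| + Q * (6 * kth (6 * ka)))) => eps eps0.
have [b [bG bf]] := (fG e0).2 _ eps0.
exists (A (upd f e0 (fun _ => expsum b))), (expval b * P); split.
- have -> : A (upd f e0 (fun _ => expsum b)) =
    fun n => \sum_(p <- b) p.1 * A (upd f e0 (fun _ s => expR (p.2 * s))) n.
    by apply/funext => n; exact: A_expsum.
  rewrite /expval mulr_suml.
  apply: cvg_seqsum => p; rewrite -mulrA; apply: cvgM; first exact: cvg_cst.
  have -> : expR (p.2 ^+ 2 / 2) * P =
      \prod_e (if e == e0 then expR (p.2 ^+ 2 / 2) else G e).
    rewrite (bigD1 e0)//= eqxx; congr (_ * _); apply: eq_bigr => e ee0.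
    by rewrite (negbTE ee0).
  apply: IH => [|e|e ke]; first exact: ltnW.
    by rewrite /upd; case: eqP => // _; exact: expsum_limit_exp.
  rewrite /upd; case: eqP => [_|ee0]; first by exists p.2.
  apply: fexp; rewrite ltn_neqAle ke andbT; apply/eqP => ke'; apply: ee0.
  exact: val_inj.
- rewrite (bigD1 e0)//= -/P -mulrBl normrM mulrDl mulrC -[leLHS]addr0 lerD//.
    by rewrite ler_wpM2l.
  by rewrite !mulr_ge0// ltW.
- apply: filterS bf => n bf; rewrite /A -avgB.
  apply: (@le_trans _ _ (avg (fun w : quadruple n.+1 => eps * Q * \prod_e expR (ka * norm_ov e w ^+ 2)))).
    apply: (le_trans (normr_avg _)); apply: avg_le => w.
    rewrite prod_upd (bigD1 e0)//= -mulrBl normrM [in leRHS](bigD1 e0)//=.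
    rewrite [leRHS]mulrACA; apply: ler_pM => //; first by apply: bf; exact: norm_ov_sqr.
    rewrite normr_prod -big_split /=; apply: ler_prod => e _; rewrite normr_ge0 /=.
    by apply: (hC e).2; exact: norm_ov_sqr.
  rewrite avgZ [leRHS]mulrC mulrDr -[leLHS]add0r lerD//; first by rewrite mulr_ge0// ltW.
  by rewrite -mulrA ler_wpM2l ?(ltW eps0)// ler_wpM2l// edges_weight_le.
Qed.

End edges.

(** * Functions of one overlap as limits of exponential sums *)

Section overlap_limits.
Context {R : realType}.
Local Notation avg := uniform_mean.
Implicit Types (ka th ta : R).

Lemma continuous_kth th : th < 2^-1 -> {for th, continuous (@kth R)}.
Proof.
move=> th1; rewrite /continuous_at /kth.
have h : 0 < 1 - 2 * th by lra.
apply: cvgV; first by rewrite gt_eqF// sqrtr_gt0.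
apply: (@cvg_comp _ _ _ (fun x : R => 1 - 2 * x) Num.sqrt _ (nbhs (1 - 2 * th)));
  last exact: sqrt_continuous.
apply: cvgB; first exact: cvg_cst.
by apply: cvgM; [exact: cvg_cst|exact: cvg_id].
Qed.

Lemma pow4_le_expR (g s : R) : 0 < g -> (s ^+ 2) ^+ 2 <= 4 / g ^+ 2 * expR (g * s ^+ 2).
Proof.
move=> g0; have gs0 : 0 <= g * s ^+ 2 by rewrite mulr_ge0 ?sqr_ge0// ltW.
have h1 := sqr_le_expR gs0.
have -> : (s ^+ 2) ^+ 2 = (g * s ^+ 2) ^+ 2 / g ^+ 2 by field; rewrite gt_eqF.
by rewrite [leRHS]mulrAC ler_wpM2r// invr_ge0 sqr_ge0.
Qed.

Lemma kth_gt0 th : th < 2^-1 -> 0 < kth th.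
Proof. by move=> h; rewrite invr_gt0 sqrtr_gt0; lra. Qed.

Lemma kth_sqr th : th < 2^-1 -> kth th ^+ 2 = (1 - 2 * th)^-1.
Proof. by move=> h; rewrite exprVn sqr_sqrtr//; lra. Qed.

(** The exponential sum is [cosh (c * s) ^+ n.+1], the mean over the hypercube of
    [expR (c * ov s' up * s)]. [cosh_pow_approx] compares it to [expR (th * s^2)], and the
    Hubbard-Stratonovich identity compares its normal mean to [kth th]. *)
Lemma expsum_limit_sqr th ka : 0 <= th < ka -> ka < 2^-1 ->
  expsum_limit ka (fun _ s => expR (th * s ^+ 2)) (kth th).
Proof.
move=> h ka1; have /andP[th0 thka] := h.
split.
  exists 1 => n s _; rewrite mul1r ger0_norm ?expR_ge0// ler_expR.
  by rewrite ler_wpM2r ?sqr_ge0// ltW.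
move=> e e0.
pose K := 4 * th ^+ 2 / (ka - th) ^+ 2.
have K0 : 0 <= K.
  by apply: mulr_ge0; [apply: mulr_ge0 => //; exact: sqr_ge0|rewrite invr_ge0; exact: sqr_ge0].
have k0 := kth_gt0 ka1.
have ev : \forall n \near \oo, K / n.+1%:R <= e /\ K / n.+1%:R * kth ka <= e.
  have c1 : K / n.+1%:R @[n --> \oo] --> (0 : R).
    by rewrite -[X in _ --> X](mulr0 K); apply: cvgM; [exact: cvg_cst|exact: cvg_invn].
  have c2 : K / n.+1%:R * kth ka @[n --> \oo] --> (0 : R).
    by rewrite -[X in _ --> X](mul0r (kth ka)); apply: cvgM => //; exact: cvg_cst.
  by apply: filterS2 (cvgr_le _ c1 _ e0) (cvgr_le _ c2 _ e0) => n; split.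
(* The size of this auxiliary hypercube depends on [e] alone: it is fixed, and unrelated to the
   index along which the limit is taken. *)
have [n0 _ hn0] := ev.
pose n := n0; have [hn1 hn2] := hn0 n (leqnn n).
pose O : finType := {ffun 'I_n.+1 -> bool}.
pose up : O := [ffun=> false].
have O0 : (0 < #|O|)%N by rewrite card_ffun card_bool expn_gt0.
pose c : R := Num.sqrt (2 * th / n.+1%:R).
exists [seq (#|O|%:R^-1, c * ov s up) | s <- enum O].
have E (F : R -> R) : \sum_(p <- [seq (#|O|%:R^-1 : R, c * ov s up) | s <- enum O]) p.1 * F p.2 =
    avg (fun s : O => F (c * ov s up)).
  by rewrite big_map big_enum /= -mulr_sumr mulrC.
split.
  rewrite /expval (E (fun x => expR (x ^+ 2 / 2))).
  apply: le_trans hn2.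
  have mgf (u : R) : avg (fun s : O => expR (u * (ov s up / Num.sqrt n.+1%:R))) = cosh (u / Num.sqrt n.+1%:R) ^+ n.+1.
    by rewrite -(ov_mgf _ up); apply: eq_avg => s; congr expR; ring.
  have := avg_expRsqr_approx (S := fun s : O => ov s up / Num.sqrt n.+1%:R) mgf h ka1; rewrite -/K.
  congr (`|_ - _| <= _); apply: eq_avg => s; congr expR.
  have t0 : 0 <= 2 * th / n.+1%:R by rewrite divr_ge0// mulr_ge0.
  rewrite [in RHS]exprMn (sqr_sqrtr t0) expr_div_n (sqr_sqrtr (ler0n _ _)).
  by field; rewrite nat1r pnatr_eq0.
exists 0%N => // m _ s _.
rewrite /expsum (E (fun x => expR (x * s))).
under eq_avg do rewrite mulrAC.
rewrite ov_mgf distrC; apply: (le_trans (cosh_pow_approx n s h)).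
by rewrite ler_wpM2r ?expR_ge0.
Qed.

Variables (x : nat -> R -> R) (al v1 : R).
Hypotheses (al0 : 0 <= al) (alv : al <= v1).
Hypothesis x_le : forall n s, s ^+ 2 <= n.+1%:R -> `|x n s| <= v1 * s ^+ 2.
Hypothesis x_approx : forall n s, s ^+ 2 <= n.+1%:R ->
  `|x n s - al * s ^+ 2| <= v1 * `|s| ^+ 3 / Num.sqrt n.+1%:R.

Let v10 : 0 <= v1. Proof. exact: le_trans alv. Qed.

(** Only the quadratic part of [x] matters: the rest is of order [|s|^3 / sqrt n], and the gap
    between [ta * v1] and [ka] absorbs the power of [s]. *)
Lemma expsum_limit_expx ta ka : 0 <= ta -> ta * v1 < ka -> ka < 2^-1 ->
  expsum_limit ka (fun n s => expR (ta * x n s)) (kth (ta * al)).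
Proof.
move=> ta0 tka ka1.
have taal : ta * al <= ta * v1 by rewrite ler_wpM2l.
pose g := ka - ta * v1; have g0 : 0 < g by rewrite subr_gt0.
apply: (@expsum_limit_lim R _ _ _ 1) => [n s hs|e e0].
  rewrite mul1r ger0_norm ?expR_ge0// ler_expR.
  apply: (@le_trans _ _ (ta * (v1 * s ^+ 2))).
    by rewrite ler_wpM2l// (le_trans (ler_norm _))// x_le.
  by rewrite mulrA ler_wpM2r ?sqr_ge0// ltW.
exists (fun _ s => expR (ta * al * s ^+ 2)), (kth (ta * al)).
split; last 1 first.
- pose K := 2 * ta * v1 * (1 + 4 / g ^+ 2).
  have c : K * (Num.sqrt n.+1%:R)^-1 @[n --> \oo] --> (0 : R).
    by rewrite -[X in _ --> X](mulr0 K); apply: cvgM; [exact: cvg_cst|exact: cvg_invsqrtn].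
  apply: filterS (cvgr_le _ c _ e0) => n hn s hs.
  apply: (le_trans (normr_expR_sub_le _ _)).
  have s30 : 0 <= `|s| ^+ 3 by rewrite exprn_ge0.
  have r0 : 0 <= (Num.sqrt n.+1%:R)^-1 :> R by rewrite invr_ge0 sqrtr_ge0.
  apply: (@le_trans _ _ ((ta * (v1 * `|s| ^+ 3 / Num.sqrt n.+1%:R)) * (2 * expR (ta * v1 * s ^+ 2)))).
    apply: ler_pM => //.
    - by rewrite -mulrA -mulrBr normrM (ger0_norm ta0) ler_wpM2l// x_approx.
    - rewrite mulr_natl mulr2n; apply: lerD; rewrite ler_expR; last by rewrite ler_wpM2r ?sqr_ge0.
      by rewrite -mulrA ler_wpM2l// (le_trans (ler_norm _))// x_le.
  have s3 : `|s| ^+ 3 <= (1 + 4 / g ^+ 2) * expR (g * s ^+ 2).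
    have gs0 : 0 <= g * s ^+ 2 by rewrite mulr_ge0 ?sqr_ge0// ltW.
    have h2 : 1 <= expR (g * s ^+ 2) by rewrite -expR0 ler_expR.
    have h3 : `|s| ^+ 3 <= 1 + (s ^+ 2) ^+ 2.
      rewrite -(real_normK (num_real s)); have := normr_ge0 s; move: `|s| => t t0; nra.
    apply: (le_trans h3); rewrite mulrDl mul1r; apply: lerD => //.
    exact: pow4_le_expR.
  have -> : expR (ka * s ^+ 2) = expR (g * s ^+ 2) * expR (ta * v1 * s ^+ 2).
    by rewrite -expRD -mulrDl subrK.
  rewrite [leRHS]mulrA.
  have -> : ta * (v1 * `|s| ^+ 3 / Num.sqrt n.+1%:R) * (2 * expR (ta * v1 * s ^+ 2)) =
    (2 * ta * v1 / Num.sqrt n.+1%:R * `|s| ^+ 3) * expR (ta * v1 * s ^+ 2) by ring.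
  apply: ler_wpM2r; first exact: expR_ge0.
  apply: (@le_trans _ _ (2 * ta * v1 / Num.sqrt n.+1%:R * ((1 + 4 / g ^+ 2) * expR (g * s ^+ 2)))).
    by apply: ler_wpM2l => //; rewrite !mulr_ge0.
  rewrite mulrA; apply: ler_wpM2r; first exact: expR_ge0.
  by apply: le_trans hn; rewrite /K mulrAC.
- apply: expsum_limit_sqr => //; rewrite mulr_ge0//=; exact: le_lt_trans tka.
- by rewrite subrr normr0 ltW.
Qed.

(** A closed form of the difference quotient, whose limit as [d] tends to [0] is [kth th ^+ 3]. *)
Lemma kth_slope th d : 0 < d -> th + d < 2^-1 ->
  (kth (th + d) - kth th) / d = 2 * kth th ^+ 2 * kth (th + d) ^+ 2 / (kth th + kth (th + d)).
Proof.
move=> d0 hd; have h : th < 2^-1 by lra.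
have a0 := kth_gt0 h; have b0 := kth_gt0 hd.
have ea := kth_sqr h; have eb := kth_sqr hd.
have k1 : (1 - 2 * th) != 0 by rewrite gt_eqF//; lra.
have k2 : (1 - 2 * (th + d)) != 0 by rewrite gt_eqF//; lra.
have e : kth (th + d) ^+ 2 - kth th ^+ 2 = 2 * d * kth th ^+ 2 * kth (th + d) ^+ 2.
  by rewrite ea eb; field; rewrite k1 k2.
have ab : kth th + kth (th + d) != 0 by rewrite gt_eqF// addr_gt0.
apply: (mulIf ab); rewrite [RHS]mulrVK ?unitfE//.
apply: (mulIf (lt0r_neq0 d0)).
have -> : (kth (th + d) - kth th) / d * (kth th + kth (th + d)) * d =
  kth (th + d) ^+ 2 - kth th ^+ 2 by field; rewrite gt_eqF.
by rewrite e; ring.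
Qed.

(** The derivative in [ta] of the preceding limit, taken through difference quotients:
    [x * expR (ta * x)] is approximated uniformly by quotients of exponentials, and [kth (ta * al)]
    has derivative [al * kth (ta * al) ^+ 3]. *)
Lemma expsum_limit_xexpx ta ka : 0 <= ta -> ta * v1 < ka -> ka < 2^-1 ->
  expsum_limit ka (fun n s => x n s * expR (ta * x n s)) (al * kth (ta * al) ^+ 3).
Proof.
move=> ta0 tka ka1.
(* One half of the gap absorbs the powers of [s], the other half the shift of [ta] by at most
   [d0]. *)
pose g := (ka - ta * v1) / 2; have g0 : 0 < g by rewrite divr_gt0// subr_gt0.
pose d0 := g / (v1 + 1); have v11 : 0 < v1 + 1 by rewrite ltr_wpDl.
have d00 : 0 < d0 by rewrite divr_gt0.
have dv : d0 * v1 <= g.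
  by rewrite /d0 -mulrA ler_piMr ?(ltW g0)// mulrC ler_pdivrMr// mul1r lerDl.
have taal : ta * al <= ta * v1 by rewrite ler_wpM2l.
have s4 (s : R) := pow4_le_expR s g0.
have s2 s : s ^+ 2 <= (1 + 4 / g ^+ 2) * expR (g * s ^+ 2).
  have h1 := s4 s; have h2 : 1 <= expR (g * s ^+ 2) by rewrite -expR0 ler_expR mulr_ge0 ?sqr_ge0// ltW.
  have h3 : s ^+ 2 <= 1 + (s ^+ 2) ^+ 2 by have := sqr_ge0 s; move: (s ^+ 2) => t; nra.
  by apply: (le_trans h3); rewrite mulrDl mul1r lerD.
apply: (@expsum_limit_lim R _ _ _ (v1 * (1 + 4 / g ^+ 2))) => [n s hs|e e0].
  rewrite normrM (ger0_norm (expR_ge0 _)).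
  apply: (@le_trans _ _ (v1 * s ^+ 2 * expR (ta * v1 * s ^+ 2))).
    apply: ler_pM; rewrite ?expR_ge0 ?x_le// ler_expR -mulrA ler_wpM2l//.
    by rewrite (le_trans (ler_norm _))// x_le.
  apply: (@le_trans _ _ (v1 * ((1 + 4 / g ^+ 2) * expR (g * s ^+ 2)) * expR (ta * v1 * s ^+ 2))).
    by rewrite ler_wpM2r ?expR_ge0// ler_wpM2l.
  rewrite mulrA -mulrA -expRD -mulrDl ler_wpM2l ?mulr_ge0//.
    by rewrite addr_ge0// divr_ge0// sqr_ge0.
  rewrite ler_expR ler_wpM2r ?sqr_ge0// /g; lra.
pose dl n := d0 / n.+1%:R.
have dl0 n : 0 < dl n by rewrite divr_gt0.
have dld n : dl n <= d0 by rewrite /dl ler_pdivrMr// ler_peMr ?(ltW d00)// ler1n.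
have dlc : dl n @[n --> \oo] --> (0 : R).
  by rewrite -[X in _ --> X](mulr0 d0); apply: cvgM; [exact: cvg_cst|exact: cvg_invn].
have dlv n : (ta + dl n) * v1 < ka.
  have : dl n * v1 <= g by apply: le_trans dv; rewrite ler_wpM2r.
  by rewrite mulrDl /g; lra.
have thk n : ta * al + dl n * al < 2^-1.
  have := dlv n; have : (ta + dl n) * al <= (ta + dl n) * v1.
    by rewrite ler_wpM2l// addr_ge0// ltW.
  by rewrite mulrDl; lra.
pose H n := (kth (ta * al + dl n * al) - kth (ta * al)) / dl n.
have Hc : H n @[n --> \oo] --> al * kth (ta * al) ^+ 3.
  have tk : ta * al < 2^-1 by lra.
  have k0 := kth_gt0 tk.
  have [al00|alp] := eqVneq al 0.
    rewrite al00 mul0r; have -> : H = fun=> 0; last exact: cvg_cst.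
    by apply/funext => n; rewrite /H al00 !mulr0 addr0 subrr mul0r.
  have {}alp : 0 < al by rewrite lt_def alp.
  have -> : H = fun n => al * (2 * kth (ta * al) ^+ 2 * kth (ta * al + dl n * al) ^+ 2 /
      (kth (ta * al) + kth (ta * al + dl n * al))).
    apply/funext => n; rewrite /H -kth_slope//; last by rewrite mulr_gt0.
    by field; rewrite !gt_eqF.
  have c : kth (ta * al + dl n * al) @[n --> \oo] --> kth (ta * al).
    have c1 : ta * al + dl n * al @[n --> \oo] --> ta * al + 0 * al.
      by apply: cvgD; [exact: cvg_cst|apply: cvgM => //; exact: cvg_cst].
    rewrite mul0r addr0 in c1.
    exact: (cvg_comp _ _ c1 (continuous_kth tk)).
  have -> : al * kth (ta * al) ^+ 3 = al * (2 * kth (ta * al) ^+ 2 * kth (ta * al) ^+ 2 /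
      (kth (ta * al) + kth (ta * al))).
    by field; rewrite -mulr2n mulrn_eq0 /= gt_eqF.
  apply: cvgM; first exact: cvg_cst.
  apply: cvgM.
    by apply: cvgM; [exact: cvg_cst|exact: (cvgM c c)].
  apply: cvgV; first by rewrite gt_eqF// addr_gt0.
  by apply: cvgD => //; exact: cvg_cst.
pose K := v1 ^+ 2 * (4 / g ^+ 2).
have K0 : 0 <= K by rewrite mulr_ge0 ?sqr_ge0// divr_ge0// sqr_ge0.
have [n0 [Hn Kn]] : exists n, `|H n - al * kth (ta * al) ^+ 3| <= e /\ dl n * K <= e.
  have c2 : dl n * K @[n --> \oo] --> (0 : R).
    by rewrite -[X in _ --> X](mul0r K); apply: cvgM => //; exact: cvg_cst.
  have /cvgrPdist_le/(_ _ e0) c1 := Hc.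
  have [m _ hm] := filterI c1 (cvgr_le _ c2 _ e0).
  by exists m; have [h1 h2] := hm m (leqnn m); rewrite distrC.
exists (fun n s => (dl n0)^-1 * (expR ((ta + dl n0) * x n s) + (- 1) * expR (ta * x n s))), (H n0).
split => //.
  have -> : H n0 = (dl n0)^-1 * (kth ((ta + dl n0) * al) + (-1) * kth (ta * al)).
    by rewrite /H mulrC mulN1r mulrDl.
  apply: expsum_limitZ; apply: expsum_limitD; last apply: expsum_limitZ.
    by apply: expsum_limit_expx => //; rewrite addr_ge0// ltW.
  exact: expsum_limit_expx.
exists 0%N => // n _ s hs.
have dn := dl0 n0.
have -> : x n s * expR (ta * x n s) - (dl n0)^-1 * (expR ((ta + dl n0) * x n s) + (-1) * expR (ta * x n s)) =
  - ((dl n0)^-1 * (expR (ta * x n s) * (expR (dl n0 * x n s) - 1 - dl n0 * x n s))).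
  by rewrite mulrDl expRD; field; rewrite gt_eqF.
rewrite normrN !normrM (ger0_norm (expR_ge0 _)) gtr0_norm ?invr_gt0//.
rewrite ler_pdivrMl//.
have b1 := normr_expRB2_le (dl n0 * x n s).
have xs := x_le hs.
have b2 : (dl n0 * x n s) ^+ 2 <= dl n0 ^+ 2 * (v1 ^+ 2 * (s ^+ 2) ^+ 2).
  rewrite exprMn ler_wpM2l ?sqr_ge0// -[leRHS]exprMn -(real_normK (num_real (x n s))).
  by rewrite lerXn2r ?nnegrE// mulr_ge0 ?sqr_ge0.
have b3 : expR (ta * x n s) * expR `|dl n0 * x n s| <= expR ((ka - g) * s ^+ 2).
  rewrite -expRD ler_expR normrM (gtr0_norm dn).
  apply: (@le_trans _ _ (ta * (v1 * s ^+ 2) + d0 * (v1 * s ^+ 2))).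
    apply: lerD; first by rewrite ler_wpM2l// (le_trans (ler_norm _)).
    by apply: ler_pM => //; exact: ltW.
  have kg : ka - g = ta * v1 + g by rewrite /g; field.
  have -> : ta * (v1 * s ^+ 2) + d0 * (v1 * s ^+ 2) = (ta * v1 + d0 * v1) * s ^+ 2 by ring.
  by rewrite kg; apply: ler_wpM2r; rewrite ?sqr_ge0// lerD2l.
apply: (@le_trans _ _ (dl n0 ^+ 2 * (v1 ^+ 2 * (s ^+ 2) ^+ 2) * expR ((ka - g) * s ^+ 2))).
  apply: (@le_trans _ _ (expR (ta * x n s) * (dl n0 ^+ 2 * (v1 ^+ 2 * (s ^+ 2) ^+ 2) * expR `|dl n0 * x n s|))).
    rewrite ler_wpM2l ?expR_ge0//; apply: (le_trans b1).
    by rewrite ler_wpM2r ?expR_ge0.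
  rewrite mulrCA; apply: ler_wpM2l => //.
  by rewrite mulr_ge0 ?sqr_ge0// mulr_ge0 ?sqr_ge0.
apply: (@le_trans _ _ (dl n0 ^+ 2 * (v1 ^+ 2 * (4 / g ^+ 2 * expR (g * s ^+ 2))) * expR ((ka - g) * s ^+ 2))).
  rewrite ler_wpM2r ?expR_ge0// ler_wpM2l ?sqr_ge0// ler_wpM2l ?sqr_ge0//.
have -> : dl n0 ^+ 2 * (v1 ^+ 2 * (4 / g ^+ 2 * expR (g * s ^+ 2))) * expR ((ka - g) * s ^+ 2) =
  dl n0 * (dl n0 * K * expR (ka * s ^+ 2)).
  have -> : ka * s ^+ 2 = g * s ^+ 2 + (ka - g) * s ^+ 2 by ring.
  by rewrite expRD /K; ring.
by rewrite ler_pM2l// ler_wpM2r ?expR_ge0.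
Qed.

End overlap_limits.

(** * Mixtures and tilted weights *)

Section mixture_bounds.
Context {R : realType}.
Variable a : nat -> R.
Hypothesis ha : is_mixture a.

Let a_lt2 p : (p < 2)%N -> a p = 0. Proof. by move=> p2; have [h _ _ _] := ha; exact: h. Qed.
Let a_ge0 p : 0 <= a p. Proof. by have [_ h _ _] := ha. Qed.

Let pseriesE (r : R) n : pseries a r n = \sum_(0 <= p < n) a p * r ^+ p. Proof. by []. Qed.

Let pseries3 (r : R) n :
  pseries a r n.+3 = a 2%N * r ^+ 2 + \sum_(0 <= p < n) a p.+3 * r ^+ p.+3.
Proof.
rewrite pseriesE big_nat_recl// big_nat_recl// big_nat_recl// (@a_lt2 0%N)// (@a_lt2 1%N)//.
by rewrite !mul0r !add0r.
Qed.

Lemma mixture_cvg (r : R) : `|r| <= 1 -> cvgn (pseries a r).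
Proof.
move=> r1; have [_ _ _ /ereal_sup_gt[_ [y /= yc <-]]] := ha.
rewrite lte_fin => y1; apply: (is_cvg_pseries_inside yc).
exact: le_lt_trans y1.
Qed.

Lemma mixture_cvg_to (r : R) : `|r| <= 1 -> pseries a r n @[n --> \oo] --> mixture_fun a r.
Proof. by move=> r1; exact: mixture_cvg. Qed.

Lemma pseries_mixture_le (r : R) n : `|r| <= 1 -> `|pseries a r n| <= pseries a 1 n * r ^+ 2.
Proof.
move=> r1; rewrite !pseriesE mulr_suml.
apply: (le_trans (ler_norm_sum _ _ _)); apply: ler_sum => p _.
rewrite expr1n mulr1 normrM (ger0_norm (a_ge0 p)).
have [p2|p2] := ltnP p 2; first by rewrite a_lt2// !mul0r.
rewrite ler_wpM2l// normrX -(real_normK (num_real r)).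
by apply: ler_wiXn2l.
Qed.

Lemma pseries_mixture_approx (r : R) n : `|r| <= 1 ->
  `|pseries a r n.+3 - a 2%N * r ^+ 2| <= pseries a 1 n.+3 * `|r| ^+ 3.
Proof.
move=> r1; rewrite !pseries3 addrAC subrr add0r.
apply: (@le_trans _ _ (\sum_(0 <= p < n) a p.+3 * `|r| ^+ 3)).
  apply: (le_trans (ler_norm_sum _ _ _)); apply: ler_sum => p _.
  by rewrite normrM (ger0_norm (a_ge0 _)) ler_wpM2l// normrX; apply: ler_wiXn2l.
rewrite -mulr_suml ler_wpM2r ?exprn_ge0// -[leLHS]add0r lerD//.
  by rewrite mulr_ge0 ?exprn_ge0.
by apply: ler_sum => p _; rewrite expr1n mulr1.
Qed.

Lemma mixture_le (r : R) : `|r| <= 1 -> `|mixture_fun a r| <= mixture_fun a 1 * r ^+ 2.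
Proof.
move=> r1; rewrite -subr_ge0.
have c1 := mixture_cvg_to (r := 1); rewrite normr1 in c1; have {}c1 := c1 (lexx _).
have c : pseries a 1 n * r ^+ 2 - `|pseries a r n| @[n --> \oo] -->
    mixture_fun a 1 * r ^+ 2 - `|mixture_fun a r|.
  apply: cvgB; last by apply: cvg_norm; exact: mixture_cvg_to.
  by apply: cvgM => //; exact: cvg_cst.
by apply: (cvg_ge_lim c); apply: nearW => n; rewrite subr_ge0 pseries_mixture_le.
Qed.

Lemma mixture_approx (r : R) : `|r| <= 1 ->
  `|mixture_fun a r - a 2%N * r ^+ 2| <= mixture_fun a 1 * `|r| ^+ 3.
Proof.
move=> r1; rewrite -subr_ge0.
have c1 := mixture_cvg_to (r := 1); rewrite normr1 in c1; have {}c1 := c1 (lexx _).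
have c : pseries a 1 n * `|r| ^+ 3 - `|pseries a r n - a 2%N * r ^+ 2| @[n --> \oo] -->
    mixture_fun a 1 * `|r| ^+ 3 - `|mixture_fun a r - a 2%N * r ^+ 2|.
  apply: cvgB; first by apply: cvgM => //; exact: cvg_cst.
  by apply: cvg_norm; apply: cvgB; [exact: mixture_cvg_to|exact: cvg_cst].
apply: (cvg_ge_lim c); near=> n; rewrite subr_ge0.
have n3 : (3 <= n)%N by near: n; exact: nbhs_infty_ge.
by rewrite -(subnK n3) addn3; exact: pseries_mixture_approx.
Unshelve. all: end_near. Qed.

Lemma mixture_ge_coef2 : a 2%N <= mixture_fun a 1.
Proof.
have c1 := mixture_cvg_to (r := 1); rewrite normr1 in c1; have {}c1 := c1 (lexx _).
apply: (cvg_ge_lim c1); near=> n.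
have n3 : (3 <= n)%N by near: n; exact: nbhs_infty_ge.
rewrite -(subnK n3) addn3 pseries3 expr1n mulr1 lerDl.
by apply: sumr_ge0 => p _; rewrite mulr_ge0 ?exprn_ge0.
Unshelve. all: end_near. Qed.

Lemma pure_mixture1 : (forall p, p != 2%N -> a p = 0) -> mixture_fun a 1 = a 2%N.
Proof.
move=> h; apply: (cvg_lim (@Rhausdorff R)).
apply: cvg_near_cst; near=> n.
have n3 : (3 <= n)%N by near: n; exact: nbhs_infty_ge.
rewrite -(subnK n3) addn3 pseries3 expr1n mulr1 big1 ?addr0// => p _.
by rewrite h// mul0r.
Unshelve. all: end_near. Qed.

(* The covariance of the Hamiltonian in dimension [n.+1], as a function of the
   normalised overlap [s = ov / sqrt n.+1]. *)
Definition xi_fun n (s : R) : R := n.+1%:R * mixture_fun a (s / Num.sqrt n.+1%:R).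

Let div_le1 n (s : R) : s ^+ 2 <= n.+1%:R -> `|s / Num.sqrt n.+1%:R| <= 1.
Proof.
move=> h; have n0 : (0 : R) < n.+1%:R by rewrite ltr0n.
rewrite normrM normfV (ger0_norm (sqrtr_ge0 _)) ler_pdivrMr ?sqrtr_gt0// mul1r.
by rewrite -sqrtr_sqr ler_wsqrtr.
Qed.

Lemma xi_fun_le n (s : R) : s ^+ 2 <= n.+1%:R -> `|xi_fun n s| <= mixture_fun a 1 * s ^+ 2.
Proof.
move=> /div_le1 h; have n0 : (0 : R) < n.+1%:R by rewrite ltr0n.
rewrite /xi_fun normrM (ger0_norm (ltW n0)).
apply: (@le_trans _ _ (n.+1%:R * (mixture_fun a 1 * (s / Num.sqrt n.+1%:R) ^+ 2))).
  by rewrite ler_pM2l// mixture_le.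
rewrite expr_div_n (sqr_sqrtr (ltW n0)) le_eqVlt; apply/orP; left; apply/eqP.
by field; rewrite nat1r gt_eqF.
Qed.

Lemma xi_fun_approx n (s : R) : s ^+ 2 <= n.+1%:R ->
  `|xi_fun n s - a 2%N * s ^+ 2| <= mixture_fun a 1 * `|s| ^+ 3 / Num.sqrt n.+1%:R.
Proof.
move=> /div_le1 h; have n0 : (0 : R) < n.+1%:R by rewrite ltr0n.
have r0 : 0 < Num.sqrt n.+1%:R :> R by rewrite sqrtr_gt0.
have r2 : Num.sqrt n.+1%:R ^+ 2 = n.+1%:R :> R := sqr_sqrtr (ltW n0).
have -> : xi_fun n s - a 2%N * s ^+ 2 =
    n.+1%:R * (mixture_fun a (s / Num.sqrt n.+1%:R) - a 2%N * (s / Num.sqrt n.+1%:R) ^+ 2).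
  by rewrite /xi_fun expr_div_n r2; field; rewrite nat1r gt_eqF.
rewrite normrM (ger0_norm (ltW n0)).
apply: (@le_trans _ _ (n.+1%:R * (mixture_fun a 1 * `|s / Num.sqrt n.+1%:R| ^+ 3))).
  by rewrite ler_pM2l// mixture_approx.
rewrite normrM normfV (ger0_norm (ltW r0)) exprMn exprVn -{1}r2 le_eqVlt; apply/orP; left; apply/eqP.
by field; rewrite gt_eqF.
Qed.

End mixture_bounds.

Section tilts.
Context {R : realType} {S : finType}.
Variables (C : S -> S -> R) (d : measure_display) (T : measurableType d).
Variables (P : probability T R) (X : S -> T -> R).
Hypotheses (gX : gvec C P X) (Csym : forall s s', C s s' = C s' s).

(** The parameter is [z = sqrt t], so that a product of two tilts has mean [expR (z * z' * C s s')],
    a power series in [z * z']. *)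
Definition tilt (z : R) (s : S) (w : T) : R := expR (z * X s w - z ^+ 2 * C s s / 2).

(** The normalisation of each factor cancels the diagonal of the quadratic form, and only the
    covariances of distinct factors remain. *)
Lemma tilt_prod (K : finType) (t : K -> S) (z : K -> R) :
  L1 P (fun w => \prod_k tilt (z k) (t k) w) /\
  Ex P (fun w => \prod_k tilt (z k) (t k) w) =
    expR ((\sum_k \sum_(l | l != k) z k * z l * C (t k) (t l)) / 2).
Proof.
have [h1 h2 _] := (gvec_reindex t gX).2 z.
have e w : \prod_k tilt (z k) (t k) w =
    expR (- ((\sum_k z k ^+ 2 * C (t k) (t k)) / 2)) * expR (\sum_k z k * X (t k) w).
  rewrite -expR_sum -expRD; congr expR.
  by rewrite big_split /= addrC sumrN mulr_suml.
under [X in L1 _ X]eq_fun do rewrite e.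
under [X in Ex _ X]eq_fun do rewrite e.
split; first exact: L1Z.
rewrite ExZ// h2 -expRD; congr expR; rewrite -mulNr -mulrDl; congr (_ / _).
rewrite /quad -sumrN -big_split /=; apply: eq_bigr => k _.
by rewrite [X in _ + X = _](bigD1 k)//= addrA -expr2 addNr add0r.
Qed.

Lemma tilt_pair z z' s s' :
  L1 P (fun w => tilt z s w * tilt z' s' w) /\
  Ex P (fun w => tilt z s w * tilt z' s' w) = expR (z * z' * C s s').
Proof.
have := tilt_prod (fun i : 'I_2 => if i == 0 then s else s') (fun i => if i == 0 then z else z').
under eq_fun do rewrite !big_ord_recl big_ord0 mulr1 /=.
move=> [h ->]; split=> //; congr expR.
rewrite !big_ord_recl !big_ord0 !(big_mkcond (fun l => l != _)) !big_ord_recl !big_ord0 /=.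
by rewrite (Csym s' s); field.
Qed.

Lemma tilt_quadruple z z' s1 s2 s3 s4 :
  L1 P (fun w => tilt z s1 w * tilt z' s2 w * (tilt z s3 w * tilt z' s4 w)) /\
  Ex P (fun w => tilt z s1 w * tilt z' s2 w * (tilt z s3 w * tilt z' s4 w)) =
  expR (z * z' * C s1 s2 + z * z' * C s3 s4 + z * z' * C s1 s4 + z * z' * C s2 s3 +
        z * z * C s1 s3 + z' * z' * C s2 s4).
Proof.
have := tilt_prod (fun i : 'I_4 => match val i with 0 => s1 | 1 => s2 | 2 => s3 | _ => s4 end)
  (fun i => match val i with 0 => z | 1 => z' | 2 => z | _ => z' end).
under eq_fun do rewrite !big_ord_recl big_ord0 mulr1 /= mulrA.
move=> [h ->]; split=> //; congr expR.
rewrite !big_ord_recl !big_ord0 !(big_mkcond (fun l => l != _)) !big_ord_recl !big_ord0 /=.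
by rewrite (Csym s2 s1) (Csym s4 s1) (Csym s4 s3) (Csym s3 s2) (Csym s3 s1) (Csym s4 s2); field.
Qed.

End tilts.

Section second_moment.
Context {R : realType}.
Local Notation avg := uniform_mean.

Section deviation.
Context {S : finType}.
Variables (C : S -> S -> R) (d : measure_display) (T : measurableType d).
Variables (P : probability T R) (X : S -> T -> R).
Hypotheses (gX : gvec C P X) (Csym : forall s s', C s s' = C s' s).

Definition deviation (c z z' : R) (w : T) : R :=
  avg (fun s => avg (fun s' => tilt C X z s w * tilt C X z' s' w * (C s s' - c))).

Lemma L1_deviation c z z' : L1 P (deviation c z z').
Proof.
apply: L1_avg => s; apply: L1_avg => s'; under eq_fun do rewrite mulrC.
by apply: L1Z; exact: (tilt_pair gX Csym z z' s s').1.
Qed.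

Lemma deviation_sqr c z z' :
  L1 P (fun w => deviation c z z' w ^+ 2) /\
  Ex P (fun w => deviation c z z' w ^+ 2) =
  avg (fun s1 => avg (fun s2 => avg (fun s3 => avg (fun s4 =>
    (C s1 s2 - c) * (C s3 s4 - c) *
    expR (z * z' * C s1 s2 + z * z' * C s3 s4 + z * z' * C s1 s4 + z * z' * C s2 s3 +
        z * z * C s1 s3 + z' * z' * C s2 s4))))).
Proof.
have e w : deviation c z z' w ^+ 2 = avg (fun s1 => avg (fun s2 => avg (fun s3 => avg (fun s4 =>
    (C s1 s2 - c) * (C s3 s4 - c) *
    (tilt C X z s1 w * tilt C X z' s2 w * (tilt C X z s3 w * tilt C X z' s4 w)))))).
  rewrite expr2 {1}/deviation mulrC -avgZ; apply: eq_avg => s1.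
  rewrite -avgZ; apply: eq_avg => s2.
  rewrite mulrC /deviation -avgZ; apply: eq_avg => s3.
  rewrite -avgZ; apply: eq_avg => s4; ring.
under [X in L1 _ X]eq_fun do rewrite e.
under [X in Ex _ X]eq_fun do rewrite e.
have L s1 s2 s3 s4 := tilt_quadruple gX Csym z z' s1 s2 s3 s4.
have L4 s1 s2 s3 s4 : L1 P (fun w => (C s1 s2 - c) * (C s3 s4 - c) *
    (tilt C X z s1 w * tilt C X z' s2 w * (tilt C X z s3 w * tilt C X z' s4 w))).
  by apply: L1Z; exact: (L s1 s2 s3 s4).1.
split; first by do 4 (apply: L1_avg => ?); exact: L4.
rewrite Ex_avg => [|s1]; last by do 3 (apply: L1_avg => ?); exact: L4.
apply: eq_avg => s1; rewrite Ex_avg => [|s2]; last by do 2 (apply: L1_avg => ?); exact: L4.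
apply: eq_avg => s2; rewrite Ex_avg => [|s3]; last by apply: L1_avg => ?; exact: L4.
apply: eq_avg => s3; rewrite Ex_avg => [|s4]; last exact: L4.
apply: eq_avg => s4; rewrite ExZ; last exact: (L s1 s2 s3 s4).1.
by rewrite (L s1 s2 s3 s4).2.
Qed.

End deviation.

Variable a : nat -> R.
Hypothesis ha : is_mixture a.
Local Notation al := (a 2%N).
Local Notation v1 := (mixture_fun a 1).

Definition spin_cov n (s s' : {ffun 'I_n.+1 -> bool}) : R := xi_fun a n (ov s s' / Num.sqrt n.+1%:R).

Lemma spin_covC n (s s' : {ffun 'I_n.+1 -> bool}) : spin_cov s s' = spin_cov s' s.
Proof. by rewrite /spin_cov ovC. Qed.

(** The limiting mean of [N * xi R] under the weight [expR (t * N * xi R)]: the ratio of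
    [al * kth (t * al) ^+ 3] to [kth (t * al)]. *)
Definition cbar (t : R) : R := al / (1 - 2 * al * t).

(** The limit is a product over the six edges, and the choice of [cbar] makes the factors of the
    edges 12 and 34 vanish. *)
Lemma deviation_second_moment z z' : 0 <= z -> 0 <= z' ->
  z * z * v1 < 24%:R^-1 -> z * z' * v1 < 24%:R^-1 -> z' * z' * v1 < 24%:R^-1 ->
  avg (fun s1 : {ffun 'I_n.+1 -> bool} => avg (fun s2 => avg (fun s3 => avg (fun s4 =>
    (spin_cov s1 s2 - cbar (z * z')) * (spin_cov s3 s4 - cbar (z * z')) *
    expR (z * z' * spin_cov s1 s2 + z * z' * spin_cov s3 s4 + z * z' * spin_cov s1 s4 +
      z * z' * spin_cov s2 s3 + z * z * spin_cov s1 s3 + z' * z' * spin_cov s2 s4)))))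
  @[n --> \oo] --> 0.
Proof.
move=> z0 z'0 h1 h2 h3.
have al0 : 0 <= al by have [_ h _ _] := ha.
have alv := mixture_ge_coef2 ha.
(* [6 * ka = 1 / 4] leaves room below the [1 / 2] that [edges_limit] requires, and the hypotheses
   are that [ka] dominates the three exponents times [v1]. *)
pose ka : R := 24%:R^-1.
have ka0 : 0 < ka by rewrite invr_gt0.
have ka1 : 6 * ka < 2^-1 by rewrite /ka; lra.
have ka2 : ka < 2^-1 by rewrite /ka; lra.
have xle := @xi_fun_le R a ha; have xap := @xi_fun_approx R a ha.
pose c := cbar (z * z').
pose fx n s := (xi_fun a n s - c) * expR (z * z' * xi_fun a n s).
pose f (e : 'I_6) : nat -> R -> R := match val e with
  | 0 => fx | 1 => fx
  | 2 => fun n s => expR (z * z' * xi_fun a n s)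
  | 3 => fun n s => expR (z * z' * xi_fun a n s)
  | 4 => fun n s => expR (z * z * xi_fun a n s)
  | _ => fun n s => expR (z' * z' * xi_fun a n s)
  end.
pose G (e : 'I_6) : R := match val e with
  | 0 => 0 | 1 => 0
  | 2 => kth (z * z' * al)
  | 3 => kth (z * z' * al)
  | 4 => kth (z * z * al)
  | _ => kth (z' * z' * al)
  end.
have fxl : expsum_limit ka fx 0.
  have t0 : 0 <= z * z' by rewrite mulr_ge0.
  have tk : z * z' * al < 2^-1.
    by apply: le_lt_trans (lt_trans h2 ka2); rewrite ler_wpM2l.
  have -> : 0 = al * kth (z * z' * al) ^+ 3 + (- c) * kth (z * z' * al).
    have -> : c = al * kth (z * z' * al) ^+ 2.
      by rewrite kth_sqr// /c /cbar; congr (_ / (1 - _)); ring.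
    ring.
  have -> : fx = fun n s => xi_fun a n s * expR (z * z' * xi_fun a n s) +
      (- c) * expR (z * z' * xi_fun a n s).
    by apply/funext => n; apply/funext => s; rewrite /fx; ring.
  apply: expsum_limitD; first exact: expsum_limit_xexpx al0 alv xle xap _ _ t0 h2 ka2.
  apply: expsum_limitZ; exact: expsum_limit_expx al0 alv xle xap _ _ t0 h2 ka2.
have fG e : expsum_limit ka (f e) (G e).
  rewrite /f /G; case: e => -[|[|[|[|[|e]]]]] /= _ //;
  by apply: expsum_limit_expx al0 alv xle xap _ _ _ _ ka2 => //; exact: mulr_ge0.
have := edges_limit ka0 ka1 fG.
rewrite [X in _ --> X]big_ord6 {1}/G /= !mul0r.
apply: cvg_trans; apply: near_eq_cvg; apply: nearW => n.
rewrite !avg_pair /=.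
apply: eq_avg => s1; apply: eq_avg => s2; rewrite !avg_pair /=.
apply: eq_avg => s3; apply: eq_avg => s4.
rewrite big_ord6 /f /norm_ov /edge_ov /= /fx /c /spin_cov.
by rewrite !expRD; do 6 (move: (xi_fun a n _) => ?); ring.
Qed.

End second_moment.

(** * Extrapolation to lower temperatures *)

Section quadratic_forms.
Context {R : realType} {I : finType}.
Implicit Types (M : I -> I -> R) (b u v : I -> R).

Definition bilin M u v : R := \sum_i \sum_j u i * v j * M i j.

Lemma quadE M b : quad M b = bilin M b b. Proof. by []. Qed.

Lemma bilinD M u u' v : bilin M (fun i => u i + u' i) v = bilin M u v + bilin M u' v.
Proof.
rewrite /bilin -big_split /=; apply: eq_bigr => i _; rewrite -big_split /=.
by apply: eq_bigr => j _; ring.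
Qed.

Lemma bilinDr M u v v' : bilin M u (fun i => v i + v' i) = bilin M u v + bilin M u v'.
Proof.
rewrite /bilin -big_split /=; apply: eq_bigr => i _; rewrite -big_split /=.
by apply: eq_bigr => j _; ring.
Qed.

Lemma bilinZ M k u v : bilin M (fun i => k * u i) v = k * bilin M u v.
Proof.
rewrite /bilin mulr_sumr; apply: eq_bigr => i _; rewrite mulr_sumr.
by apply: eq_bigr => j _; ring.
Qed.

Lemma bilinZr M k u v : bilin M u (fun i => k * v i) = k * bilin M u v.
Proof.
rewrite /bilin mulr_sumr; apply: eq_bigr => i _; rewrite mulr_sumr.
by apply: eq_bigr => j _; ring.
Qed.

Lemma bilin_shift M u v k : bilin M (fun i => u i + k * v i) (fun i => u i + k * v i) =
  bilin M u u + k * (bilin M v u + bilin M u v) + k ^+ 2 * bilin M v v.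
Proof.
rewrite (bilinD M u (fun i => k * v i)) (bilinDr M u u (fun i => k * v i)).
rewrite (bilinDr M (fun i => k * v i) u (fun i => k * v i)).
by rewrite !(bilinZ M k v) !(bilinZr M k _ v); ring.
Qed.

(* For a positive semidefinite form, Cauchy-Schwarz controls the variation by the
   value at the difference. *)
Lemma quad_variation M u v (e : R) : (forall b, 0 <= quad M b) -> 0 < e ->
  `|quad M u - quad M v| <= e * quad M u + (1 + e^-1) * quad M (fun i => u i - v i).
Proof.
move=> M0 e0.
pose p i := u i - v i.
have qu : quad M u - quad M v = bilin M p u + bilin M u p - quad M p.
  have -> : quad M v = bilin M u u - bilin M p u - bilin M u p + bilin M p p.
    have -> : quad M v = bilin M (fun i => u i + (-1) * p i) (fun i => u i + (-1) * p i).
      by congr (bilin M _ _); apply/funext => i; rewrite /p; ring.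
    by rewrite bilin_shift; ring.
  by rewrite !quadE; ring.
have h (k : R) : 0 <= quad M p + k * (bilin M p u + bilin M u p) + k ^+ 2 * quad M u.
  have -> : quad M p + k * (bilin M p u + bilin M u p) + k ^+ 2 * quad M u =
    quad M (fun i => p i + k * u i); last exact: M0.
  by rewrite !quadE bilin_shift; ring.
have h1 := h e; have h2 := h (- e); have hp := M0 p; have hu := M0 u.
rewrite qu; move: (bilin M p u + bilin M u p) (quad M p) (quad M u) h1 h2 hp hu => B P U.
move=> h1 h2 hp hu.
have i0 : 0 < e^-1 by rewrite invr_gt0.
have k1 : `|B| <= e * U + e^-1 * P.
  rewrite ler_norml; apply/andP; split.
    rewrite -subr_ge0; have -> : B - - (e * U + e^-1 * P) = e^-1 * (P + e * B + e ^+ 2 * U).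
      by field; rewrite gt_eqF.
    by rewrite mulr_ge0// ltW.
  rewrite -subr_ge0; have -> : e * U + e^-1 * P - B = e^-1 * (P + (- e) * B + (- e) ^+ 2 * U).
    by field; rewrite gt_eqF.
  by rewrite mulr_ge0// ltW.
apply: (le_trans (ler_normB _ _)); rewrite (ger0_norm hp) mulrDl mul1r addrCA addrC.
by rewrite lerD2r.
Qed.

End quadratic_forms.

Section kernels.
Context {R : realType} {I : finType}.
Implicit Types (b ze : I -> R) (M : I -> I -> R).

Lemma quad_kernel_cvg (g_ : nat -> R) (g : R -> R) b ze M :
  (forall i j, \sum_(0 <= n < L) g_ n * (ze i * ze j) ^+ n @[L --> \oo] --> g (ze i * ze j)) ->
  \sum_(0 <= n < L) g_ n * quad (fun i j => (ze i * ze j) ^+ n * M i j) b @[L --> \oo] -->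
  quad (fun i j => g (ze i * ze j) * M i j) b.
Proof.
move=> hg.
have -> : (fun L => \sum_(0 <= n < L) g_ n * quad (fun i j => (ze i * ze j) ^+ n * M i j) b) =
  fun L => \sum_i \sum_j b i * b j * ((\sum_(0 <= n < L) g_ n * (ze i * ze j) ^+ n) * M i j).
  apply/funext => L; under eq_bigr do rewrite /quad mulr_sumr.
  rewrite exchange_big /=; apply: eq_bigr => i _.
  under eq_bigr do rewrite mulr_sumr.
  rewrite exchange_big /=; apply: eq_bigr => j _.
  rewrite mulr_suml mulr_sumr; apply: eq_bigr => n _; ring.
apply: cvg_seqsum => i; apply: cvg_seqsum => j.
apply: cvgM; first exact: cvg_cst.
by apply: cvgM => //; exact: cvg_cst.
Qed.

(** A kernel that is a power series in [ze i * ze j] reduces its form to those of the powers. It is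
    applied to the series of [expR] and of [cbar]. *)
Lemma normr_quad_kernel_le (g_ m : nat -> R) (g : R -> R) b ze M B :
  (forall i j, \sum_(0 <= n < L) g_ n * (ze i * ze j) ^+ n @[L --> \oo] --> g (ze i * ze j)) ->
  (forall n, `|quad (fun i j => (ze i * ze j) ^+ n * M i j) b| <= m n) ->
  (forall L, \sum_(0 <= n < L) `|g_ n| * m n <= B) ->
  `|quad (fun i j => g (ze i * ze j) * M i j) b| <= B.
Proof.
move=> hg hm hB; have c := quad_kernel_cvg (b := b) (M := M) hg.
have c' : `|\sum_(0 <= n < L) g_ n * quad (fun i j => (ze i * ze j) ^+ n * M i j) b| @[L --> \oo] -->
    `|quad (fun i j => g (ze i * ze j) * M i j) b| by apply: cvg_norm.
apply: (cvg_le_lim c'); apply: nearW => L; apply: le_trans (hB L).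
apply: (le_trans (ler_norm_sum _ _ _)); apply: ler_sum => n _.
by rewrite normrM ler_wpM2l.
Qed.

(** A power of [ze i * ze j] is a kernel of rank one: its form is the square of a moment of [b]. *)
Lemma quad_powers (n : nat) b ze :
  quad (fun i j => (ze i * ze j) ^+ n) b = (\sum_i b i * ze i ^+ n) ^+ 2.
Proof.
rewrite expr2 mulr_suml; apply: eq_bigr => i _; rewrite mulr_sumr.
by apply: eq_bigr => j _; rewrite exprMn; ring.
Qed.

Lemma cvg_expR_series (t : R) :
  \sum_(0 <= n < L) t ^+ n / n`!%:R @[L --> \oo] --> expR t.
Proof. exact: is_cvg_series_exp_coeff. Qed.

Lemma expR_series_le (t : R) L : 0 <= t -> \sum_(0 <= n < L) t ^+ n / n`!%:R <= expR t.
Proof.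
move=> t0; apply: (cvg_ge_lim (@cvg_expR_series t)); near=> m.
have Lm : (L <= m)%N by near: m; exact: nbhs_infty_ge.
rewrite (big_cat_nat _ Lm)//= lerDl; apply: sumr_ge0 => n _.
by rewrite divr_ge0// exprn_ge0.
Unshelve. all: end_near. Qed.

(** Small moments of [b] make the exponential kernel small whatever [x] is. The extra power [n] is
    for the terms of the series of [cbar]. *)
Lemma quad_expR_le (n : nat) b ze (e rho x : R) : 0 <= e -> 0 <= rho ->
  (forall m, `|\sum_i b i * ze i ^+ m| <= e * rho ^+ m) ->
  `|quad (fun i j => (ze i * ze j) ^+ n * expR (ze i * ze j * x)) b| <=
  e ^+ 2 * (rho ^+ 2) ^+ n * expR (rho ^+ 2 * `|x|).
Proof.
move=> e0 rho0 hb.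
have -> : quad (fun i j => (ze i * ze j) ^+ n * expR (ze i * ze j * x)) b =
   quad (fun i j => (fun t => expR (t * x)) (ze i * ze j) * (ze i * ze j) ^+ n) b.
  by apply: eq_bigr => i _; apply: eq_bigr => j _; rewrite [_ ^+ n * _]mulrC.
apply: (@normr_quad_kernel_le (fun k => x ^+ k / k`!%:R)
   (fun k => e ^+ 2 * (rho ^+ 2) ^+ (k + n)) (fun t => expR (t * x))).
- move=> i j; have := @cvg_expR_series (ze i * ze j * x).
  apply: cvg_trans; apply: near_eq_cvg; apply: nearW => L.
  by apply: eq_bigr => k _; rewrite [in LHS]exprMn; ring.
- move=> k.
  have -> : quad (fun i j => (ze i * ze j) ^+ k * (ze i * ze j) ^+ n) b =
     (\sum_i b i * ze i ^+ (k + n)) ^+ 2.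
    rewrite -quad_powers; apply: eq_bigr => i _; apply: eq_bigr => j _.
    by rewrite -exprD.
  rewrite normrX -[(rho ^+ 2) ^+ _]exprM mulnC exprM -exprMn.
  by rewrite lerXn2r ?nnegrE// mulr_ge0// exprn_ge0.
- move=> L.
  have -> : \sum_(0 <= k < L) `|x ^+ k / k`!%:R| * (e ^+ 2 * (rho ^+ 2) ^+ (k + n)) =
     e ^+ 2 * (rho ^+ 2) ^+ n * \sum_(0 <= k < L) (rho ^+ 2 * `|x|) ^+ k / k`!%:R.
    rewrite mulr_sumr; apply: eq_bigr => k _.
    rewrite normrM normrX normfV (ger0_norm (ler0n _ _)) [(rho ^+ 2) ^+ (k + n)]exprD.
    rewrite [(_ * `|x|) ^+ k]exprMn.
    by move: (_^-1) (`|x| ^+ k) ((rho ^+ 2) ^+ k) => f y r; ring.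
  apply: ler_wpM2l; first by rewrite mulr_ge0 ?sqr_ge0// exprn_ge0 ?sqr_ge0.
  by apply: expR_series_le; rewrite mulr_ge0 ?sqr_ge0.
Qed.

Lemma cvg_geometric_series (q : R) : `|q| < 1 ->
  \sum_(0 <= n < L) q ^+ n @[L --> \oo] --> (1 - q)^-1.
Proof.
move=> q1; have := @cvg_geometric_series R 1 q q1; rewrite mul1r.
apply: cvg_trans; apply: near_eq_cvg; apply: nearW => L.
by apply: eq_bigr => n _; rewrite /geometric /= mul1r.
Qed.

Lemma geometric_sum_le (q : R) L : 0 <= q < 1 -> \sum_(0 <= n < L) q ^+ n <= (1 - q)^-1.
Proof.
move=> /andP[q0 q1]; have q1' : `|q| < 1 by rewrite ger0_norm.
apply: (cvg_ge_lim (cvg_geometric_series q1')); near=> m.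
have Lm : (L <= m)%N by near: m; exact: nbhs_infty_ge.
rewrite (big_cat_nat _ Lm)//= lerDl; apply: sumr_ge0 => n _.
exact: exprn_ge0.
Unshelve. all: end_near. Qed.

End kernels.

Section transport.
Context {R : realType} {S I : finType}.
Local Notation avg := uniform_mean.
Variables (C : S -> S -> R) (d : measure_display) (T : measurableType d).
Variables (P : probability T R) (X : S -> T -> R).
Hypotheses (gX : gvec C P X) (Csym : forall s s', C s s' = C s' s).

(** A characteristic function is at most [1], which gives the sign of its exponent. *)
Lemma gvec_quad_ge0 b : 0 <= quad C b.
Proof.
have [_ _ /(_ 0)] := gX.2 b; rewrite cos0 mulr1 => h.
have : expR (- (quad C b / 2)) <= 1.
  rewrite -h -[leRHS](Ex_cst P); apply: Ex_le; [exact: (L1_cos_lin _ _ _ gX.1)|exact: L1_cst|].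
  by move=> w; exact: (le_trans (ler_norm _) (cos_max _)).
by rewrite -expR0 ler_expR oppr_le0 pmulr_lge0// invr_gt0.
Qed.

Variables (a : nat -> R) (ze : I -> R) (rho : R).
Hypotheses (al0 : 0 <= a 2%N) (zeb : forall i, 0 <= ze i <= rho) (rho0 : 0 <= rho).
Hypothesis (alrho : 2 * a 2%N * rho ^+ 2 < 1).
Local Notation al := (a 2%N).

(** The deviations at all pairs of points form a matrix, split as [dx - dc]. Each part is positive
    semidefinite, which their difference is not. *)
Let dx (w : T) (i j : I) : R :=
  avg (fun s => avg (fun s' => tilt C X (ze i) s w * tilt C X (ze j) s' w * C s s')).
Let W i w : R := avg (fun s => tilt C X (ze i) s w).
Let dc (w : T) (i j : I) : R := cbar a (ze i * ze j) * (W i w * W j w).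

Let dxE w i j : deviation C X (cbar a (ze i * ze j)) (ze i) (ze j) w = dx w i j - dc w i j.
Proof.
rewrite /dc /W avg_mul -avgZ -avgB; apply: eq_avg => s.
by rewrite -avgZ -avgB; apply: eq_avg => s'; ring.
Qed.

Let zz_le i j : 0 <= ze i * ze j <= rho ^+ 2.
Proof.
have /andP[i0 i1] := zeb i; have /andP[j0 j1] := zeb j.
by rewrite mulr_ge0//= expr2 ler_pM.
Qed.

Let c_ n : R := al * (2 * al) ^+ n.

Let c_ge0 n : 0 <= c_ n.
Proof. by rewrite mulr_ge0// exprn_ge0// mulr_ge0. Qed.

Let c_cvg t : 0 <= t <= rho ^+ 2 -> \sum_(0 <= n < L) c_ n * t ^+ n @[L --> \oo] --> cbar a t.
Proof.
move=> /andP[t0 t1].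
have q1 : `|2 * al * t| < 1.
  rewrite ger0_norm ?mulr_ge0//; apply: le_lt_trans alrho.
  by rewrite ler_wpM2l// mulr_ge0.
have -> : (fun L => \sum_(0 <= n < L) c_ n * t ^+ n) =
    fun L => al * \sum_(0 <= n < L) (2 * al * t) ^+ n.
  apply/funext => L; rewrite mulr_sumr; apply: eq_bigr => n _.
  by rewrite /c_ [in RHS]exprMn mulrA.
by apply: cvgM; [exact: cvg_cst|exact: cvg_geometric_series].
Qed.

(** [cbar] is a geometric series with nonnegative coefficients, each term of which is a kernel of
    rank one. *)
Let dc_ge0 w b : 0 <= quad (dc w) b.
Proof.
have c := quad_kernel_cvg (b := b) (M := fun i j => W i w * W j w)
  (fun i j => c_cvg (zz_le i j)).
apply: (cvg_ge_lim c); apply: nearW => L; apply: sumr_ge0 => n _.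
rewrite mulr_ge0//.
have -> : quad (fun i j => (ze i * ze j) ^+ n * (W i w * W j w)) b =
    (\sum_i b i * (ze i ^+ n * W i w)) ^+ 2.
  rewrite expr2 mulr_suml; apply: eq_bigr => i _; rewrite mulr_sumr.
  by apply: eq_bigr => j _; rewrite exprMn; ring.
exact: sqr_ge0.
Qed.

(** Up to normalisation this is the covariance form at the vector [u], the combination of the tilts
    with coefficients [b]. *)
Let dx_ge0 w b : 0 <= quad (dx w) b.
Proof.
pose u s := \sum_i b i * tilt C X (ze i) s w.
have -> : quad (dx w) b = quad C u / (#|S|%:R * #|S|%:R).
  rewrite /quad /dx /uniform_mean.
  have -> : \sum_i \sum_j u i * u j * C i j = \sum_i \sum_j b i * b j *
     (\sum_s \sum_s' tilt C X (ze i) s w * tilt C X (ze j) s' w * C s s').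
    under eq_bigr => s _ do under eq_bigr => s' _ do
      rewrite /u mulr_suml mulr_suml.
    under eq_bigr => s _ do rewrite exchange_big.
    rewrite exchange_big /=; apply: eq_bigr => i _.
    under [RHS]eq_bigr => j _ do rewrite mulr_sumr.
    rewrite [RHS]exchange_big /=; apply: eq_bigr => s _.
    under [RHS]eq_bigr => j _ do rewrite mulr_sumr.
    rewrite [RHS]exchange_big /=; apply: eq_bigr => s' _.
    rewrite mulr_sumr mulr_suml; apply: eq_bigr => j _; ring.
  rewrite mulr_suml; apply: eq_bigr => i _; rewrite mulr_suml; apply: eq_bigr => j _.
  by rewrite -mulr_suml invfM; ring.
by rewrite mulr_ge0 ?gvec_quad_ge0// invr_ge0 mulr_ge0.
Qed.

Let L1_tilt2 (k : S -> S -> R) i j : L1 P (fun w =>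
  avg (fun s => avg (fun s' => tilt C X (ze i) s w * tilt C X (ze j) s' w * k s s'))).
Proof.
apply: L1_avg => s; apply: L1_avg => s'; under eq_fun do rewrite mulrC.
by apply: L1Z; exact: (tilt_pair gX Csym (ze i) (ze j) s s').1.
Qed.

Let Ex_tilt2 (k : S -> S -> R) i j : Ex P (fun w =>
  avg (fun s => avg (fun s' => tilt C X (ze i) s w * tilt C X (ze j) s' w * k s s'))) =
  avg (fun s => avg (fun s' => k s s' * expR (ze i * ze j * C s s'))).
Proof.
have L s s' : L1 P (fun w => tilt C X (ze i) s w * tilt C X (ze j) s' w * k s s').
  under eq_fun do rewrite mulrC.
  by apply: L1Z; exact: (tilt_pair gX Csym (ze i) (ze j) s s').1.
rewrite Ex_avg => [|s]; last by apply: L1_avg => s'; exact: L.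
apply: eq_avg => s; rewrite Ex_avg => [|s']; last exact: L.
apply: eq_avg => s'; under eq_fun do rewrite mulrC.
by rewrite ExZ ?(tilt_pair gX Csym _ _ _ _).2//; exact: (tilt_pair gX Csym _ _ _ _).1.
Qed.

Let WWE i j w : W i w * W j w =
  avg (fun s => avg (fun s' => tilt C X (ze i) s w * tilt C X (ze j) s' w * 1)).
Proof. by rewrite /W avg_mul; apply: eq_avg => s; apply: eq_avg => s'; rewrite mulr1. Qed.

Let L1_dx i j : L1 P (fun w => dx w i j). Proof. exact: L1_tilt2. Qed.

Let L1_dc i j : L1 P (fun w => dc w i j).
Proof. by apply: L1Z; under eq_fun do rewrite WWE; exact: (L1_tilt2 (fun _ _ => 1)). Qed.

Let L1_quad (M : T -> I -> I -> R) b : (forall i j, L1 P (fun w => M w i j)) ->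
  L1 P (fun w => quad (M w) b) /\
  Ex P (fun w => quad (M w) b) = quad (fun i j => Ex P (fun w => M w i j)) b.
Proof.
move=> hM; split; first by do 2 (apply: L1_sum => ?); apply: L1Z.
rewrite Ex_sum => [|i]; last by apply: L1_sum => j; exact: L1Z.
apply: eq_bigr => i _; rewrite Ex_sum => [|j]; last exact: L1Z.
by apply: eq_bigr => j _; rewrite ExZ.
Qed.

(** Every moment of [b] at the points is at most [e] times that of a unit mass at [rho]; all the
    kernels at hand then have small forms at once. *)
Definition approx_null (b : I -> R) (e : R) : Prop :=
  forall m, `|\sum_i b i * ze i ^+ m| <= e * rho ^+ m.

Let Kx := avg (fun s => avg (fun s' => `|C s s'| * expR (rho ^+ 2 * `|C s s'|))).
Let K1 := avg (fun s => avg (fun s' => expR (rho ^+ 2 * `|C s s'|))).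

Let quad_avg (F : S -> S -> I -> I -> R) b :
  quad (fun i j => avg (fun s => avg (fun s' => F s s' i j))) b =
  avg (fun s => avg (fun s' => quad (F s s') b)).
Proof.
have e (J : finType) (h : J -> S -> R) : \sum_j avg (h j) = avg (fun s => \sum_j h j s).
  by rewrite /uniform_mean exchange_big /= mulr_suml.
rewrite /quad.
under eq_bigr => i _ do (under eq_bigr => j _ do (rewrite -avgZ; under eq_avg do rewrite -avgZ); rewrite e; under eq_avg do rewrite e).
by rewrite e; apply: eq_avg => s; rewrite e.
Qed.

(** The mean of [dx] is the exponential kernel in [ze i * ze j] averaged over two replicas, to which
    [quad_expR_le] applies. *)
Let Ex_dx_le b e : 0 <= e -> approx_null b e -> Ex P (fun w => quad (dx w) b) <= e ^+ 2 * Kx.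
Proof.
move=> e0 hb; rewrite (L1_quad b L1_dx).2.
have -> : (fun i j => Ex P (fun w => dx w i j)) =
    fun i j => avg (fun s => avg (fun s' => C s s' * ((ze i * ze j) ^+ 0 * expR (ze i * ze j * C s s')))).
  apply/funext => i; apply/funext => j; rewrite Ex_tilt2.
  by apply: eq_avg => s; apply: eq_avg => s'; rewrite expr0 mul1r.
rewrite quad_avg /Kx -avgZ; apply: avg_le => s; rewrite -avgZ; apply: avg_le => s'.
have -> : quad (fun i j => C s s' * ((ze i * ze j) ^+ 0 * expR (ze i * ze j * C s s'))) b =
   C s s' * quad (fun i j => (ze i * ze j) ^+ 0 * expR (ze i * ze j * C s s')) b.
  rewrite /quad mulr_sumr; apply: eq_bigr => i _; rewrite mulr_sumr; apply: eq_bigr => j _.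
  by rewrite mulrCA.
have h := quad_expR_le 0 (C s s') e0 rho0 hb; rewrite expr0 mulr1 in h.
apply: (le_trans (ler_norm _)); rewrite normrM mulrCA; exact: ler_wpM2l.
Qed.

Let cb0 : 0 <= cbar a (rho ^+ 2).
Proof. by rewrite divr_ge0// subr_ge0 ltW. Qed.

(** [cbar] is expanded in powers and [quad_expR_le] used for each of them; the bounds sum up as a
    geometric series to [cbar a (rho ^+ 2)]. *)
Let Ex_dc_le b e : 0 <= e -> approx_null b e ->
  Ex P (fun w => quad (dc w) b) <= e ^+ 2 * (cbar a (rho ^+ 2) * K1).
Proof.
move=> e0 hb; rewrite (L1_quad b L1_dc).2.
pose M i j := avg (fun s => avg (fun s' => expR (ze i * ze j * C s s'))).
have -> : (fun i j => Ex P (fun w => dc w i j)) = fun i j => cbar a (ze i * ze j) * M i j.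
  apply/funext => i; apply/funext => j.
  have L : L1 P (fun w => W i w * W j w).
    by under eq_fun do rewrite WWE; exact: (L1_tilt2 (fun _ _ => 1)).
  rewrite ExZ//; congr (_ * _); under eq_fun do rewrite WWE.
  rewrite (Ex_tilt2 (fun _ _ => 1)).
  by apply: eq_avg => s; apply: eq_avg => s'; rewrite mul1r.
have K10 : 0 <= K1 by apply: avg_ge0 => s; apply: avg_ge0 => s'; exact: expR_ge0.
apply: (le_trans (ler_norm _)).
apply: (@normr_quad_kernel_le _ _ c_ (fun n => e ^+ 2 * (rho ^+ 2) ^+ n * K1)).
- by move=> i j; exact: c_cvg.
- move=> n.
  have -> : (fun i j => (ze i * ze j) ^+ n * M i j) = fun i j =>
      avg (fun s => avg (fun s' => (ze i * ze j) ^+ n * expR (ze i * ze j * C s s'))).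
    apply/funext => i; apply/funext => j; rewrite -avgZ; apply: eq_avg => s.
    by rewrite -avgZ.
  rewrite quad_avg /K1 -avgZ; apply: (le_trans (normr_avg _)); apply: avg_le => s.
  rewrite -avgZ; apply: (le_trans (normr_avg _)); apply: avg_le => s'.
  exact: quad_expR_le.
- move=> L.
  have -> : \sum_(0 <= n < L) `|c_ n| * (e ^+ 2 * (rho ^+ 2) ^+ n * K1) =
      e ^+ 2 * K1 * al * \sum_(0 <= n < L) (2 * al * rho ^+ 2) ^+ n.
    rewrite mulr_sumr; apply: eq_bigr => n _.
    by rewrite ger0_norm// /c_ [(_ * rho ^+ 2) ^+ n]exprMn; ring.
  have -> : e ^+ 2 * (cbar a (rho ^+ 2) * K1) = e ^+ 2 * K1 * al * (1 - 2 * al * rho ^+ 2)^-1.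
    by rewrite /cbar; ring.
  apply: ler_wpM2l; first by apply: mulr_ge0 => //; apply: mulr_ge0 => //; exact: sqr_ge0.
  by apply: geometric_sum_le; rewrite alrho andbT mulr_ge0 ?sqr_ge0// mulr_ge0.
Qed.

(** The deviation at [i0] is the form [dx - dc] at a unit mass, and replacing the mass by [v] gives
    a combination of the other deviations. [quad_variation] bounds the cost for [dx] and [dc]
    separately, in mean and with two replicas only. *)
Lemma transport i0 v e : 0 < e <= 1 -> approx_null (fun i => (i == i0)%:R - v i) e ->
  Ex P (fun w => `|deviation C X (cbar a (ze i0 * ze i0)) (ze i0) (ze i0) w|) <=
  \sum_i \sum_j `|v i * v j| *
     Ex P (fun w => `|deviation C X (cbar a (ze i * ze j)) (ze i) (ze j) w|) +
  3 * e * (Kx + cbar a (rho ^+ 2) * K1).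
Proof.
move=> /andP[e0 e1] hv.
pose u i : R := (i == i0)%:R.
have only1 (F : I -> R) : (forall i, i != i0 -> F i = 0) -> \sum_i F i = F i0.
  by move=> F0; rewrite (bigD1 i0)//= big1 ?addr0.
have u0 i : i != i0 -> u i = 0 by move=> /negbTE ii0; rewrite /u ii0.
have u1 : u i0 = 1 by rewrite /u eqxx.
have qu M : quad M u = M i0 i0.
  rewrite /quad only1 => [|i ii0]; last by rewrite big1// => j _; rewrite u0// !mul0r.
  by rewrite only1 => [|j ji0]; [rewrite u1 !mul1r|rewrite (u0 j)// mulr0 mul0r].
have hu : approx_null u 1.
  move=> m; rewrite only1 => [|i ii0]; last by rewrite u0// mul0r.
  rewrite u1 !mul1r; have /andP[z0 z1] := zeb i0.
  by rewrite ger0_norm ?exprn_ge0// lerXn2r ?nnegrE.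
have e0' := ltW e0.
have Lx b := (L1_quad b L1_dx).1; have Lc b := (L1_quad b L1_dc).1.
have Ldev i j := L1_deviation gX Csym (cbar a (ze i * ze j)) (ze i) (ze j).
have var (D : T -> I -> I -> R) K : (forall w b, 0 <= quad (D w) b) ->
   (forall b, L1 P (fun w => quad (D w) b)) ->
   (forall b e, 0 <= e -> approx_null b e -> Ex P (fun w => quad (D w) b) <= e ^+ 2 * K) ->
   Ex P (fun w => `|quad (D w) u - quad (D w) v|) <= 3 * e * K.
  move=> D0 LD hD.
  have L2 := L1D (L1Z e (LD u)) (L1Z (1 + e^-1) (LD (fun i => u i - v i))).
  apply: (le_trans (Ex_le (L1_norm (L1B (LD u) (LD v))) L2 (fun w => quad_variation u v (D0 w) e0))).
  rewrite ExD ?ExZ//; [|exact: L1Z|exact: L1Z].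
  have k1 := hD _ _ ler01 hu; rewrite expr1n mul1r in k1.
  have k2 := hD _ _ e0' hv.
  have K0 : 0 <= K by apply: le_trans k1; apply: Ex_ge0 => w; exact: D0.
  apply: (@le_trans _ _ (e * K + (1 + e^-1) * (e ^+ 2 * K))).
    by apply: lerD; apply: ler_wpM2l => //; rewrite addr_ge0// invr_ge0.
  (* The factor [e^-1] of Cauchy-Schwarz is paid by [e^2]: the total [e K + e^2 K + e K] is at most
     [3 e K]. *)
  have -> : (1 + e^-1) * (e ^+ 2 * K) = e * (e * K) + e * K by field; rewrite gt_eqF.
  have : e * (e * K) <= e * K by rewrite ler_wpM2l// ler_piMl.
  lra.
have vx := var dx Kx dx_ge0 Lx Ex_dx_le.
have vc := var dc _ dc_ge0 Lc Ex_dc_le.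
have Lv : L1 P (fun w => quad (fun i j => `|deviation C X (cbar a (ze i * ze j)) (ze i) (ze j) w|) (fun i => `|v i|)).
  by do 2 (apply: L1_sum => ?); apply: L1Z; exact: L1_norm.
have L3 : L1 P (fun w => `|quad (dx w) u - quad (dx w) v| + `|quad (dc w) u - quad (dc w) v|).
  by apply: L1D; apply: L1_norm; apply: L1B.
apply: (@le_trans _ _ (Ex P (fun w =>
   quad (fun i j => `|deviation C X (cbar a (ze i * ze j)) (ze i) (ze j) w|) (fun i => `|v i|) +
   (`|quad (dx w) u - quad (dx w) v| + `|quad (dc w) u - quad (dc w) v|)))).
  apply: Ex_le; [exact: L1_norm|exact: L1D|move=> w].
  rewrite dxE -[dx w i0 i0]qu -[dc w i0 i0]qu.
  have -> : quad (dx w) u - quad (dc w) u = (quad (dx w) v - quad (dc w) v) +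
    ((quad (dx w) u - quad (dx w) v) - (quad (dc w) u - quad (dc w) v)) by ring.
  apply: (le_trans (ler_normD _ _)); apply: lerD; last exact: ler_normB.
  rewrite /quad -sumrB; apply: (le_trans (ler_norm_sum _ _ _)); apply: ler_sum => i _.
  rewrite -sumrB; apply: (le_trans (ler_norm_sum _ _ _)); apply: ler_sum => j _.
  by rewrite -mulrBr -dxE [leLHS]normrM (normrM (v i)).
rewrite ExD//; apply: lerD.
  have Labs i j := L1_norm (Ldev i j).
  rewrite (L1_quad (M := fun w i j => `|deviation C X (cbar a (ze i * ze j)) (ze i) (ze j) w|) (fun i => `|v i|) Labs).2.
  by apply: ler_sum => i _; apply: ler_sum => j _; rewrite normrM.
rewrite ExD; [|by apply: L1_norm; apply: L1B|by apply: L1_norm; apply: L1B].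
by rewrite mulrDr lerD.
Qed.

End transport.

Section lagrange_nodes.
Context {R : realType}.

(* Extrapolation from nodes close to [0]: all the powers of a point [z] of [0, zmax] are
   approximated by the same combination of those of the nodes, up to a geometric error. *)
Lemma lagrange_approx (zmax rho z0 e : R) :
  0 <= zmax < rho -> 0 < z0 <= rho -> 0 < e ->
  exists K (h A : R), [/\ 0 < h, K%:R * h <= z0, 0 <= A &
    forall z, 0 <= z <= zmax -> exists b : 'I_K.+1 -> R,
      (forall j, `|b j| <= A) /\
      forall m, `|z ^+ m - \sum_j b j * (j%:R * h) ^+ m| <= e * rho ^+ m].
Proof.
move=> /andP[zm0 zmr] /andP[z00 z0r] e0.
have r0 : 0 < rho by exact: le_lt_trans zmr.
pose q := zmax / rho.
have q0 : 0 <= q by rewrite divr_ge0// ltW.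
have q1 : q < 1 by rewrite ltr_pdivrMr// mul1r.
have e2 : 0 < e / 2 by rewrite divr_gt0.
(* Interpolation of degree [K] is exact on the powers up to [K]; beyond, [z^m] is already small
   compared to [rho^m]. *)
have [K hK] : exists K, q ^+ K.+1 <= e / 2.
  have c : q ^+ n @[n --> \oo] --> (0 : R) by apply: cvg_expr; rewrite ger0_norm.
  have [K _ hK] := cvgr_le _ c _ e2.
  by exists K; apply: (hK K.+1) => /=.
(* Beyond degree [K] the combination of nodes must be small as well. Its coefficients may reach
   [(rho / h)^K], but the powers of the nodes bring [(K h / rho)^(K + 1)]: there remains
   [K^K * (K h / rho)], which vanishes with [h]. *)
pose B : R := K.+1%:R * K%:R ^+ K + 1.
have B0 : 0 < B by rewrite ltr_wpDl// mulr_ge0// exprn_ge0.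
pose dl := Num.min 1 (e / 2 / B).
have dl0 : 0 < dl by rewrite lt_min ltr01 divr_gt0.
pose h := Num.min (z0 / K.+1%:R) (rho * dl / K.+1%:R).
have K0 : (0 : R) < K.+1%:R by rewrite ltr0n.
have h0 : 0 < h by rewrite lt_min !divr_gt0// mulr_gt0.
have Kh (x : R) : h <= x / K.+1%:R -> K%:R * h <= x.
  move=> hx; apply: (@le_trans _ _ (K.+1%:R * h)).
    by rewrite ler_pM2r// ler_nat.
  by rewrite mulrC -ler_pdivlMr.
have Kh1 : K%:R * h <= z0 by apply: Kh; rewrite ge_min lexx.
have Kh2 : K%:R * h <= rho * dl by apply: Kh; rewrite ge_min lexx orbT.
have Kh0 : 0 <= K%:R * h by rewrite mulr_ge0// ltW.
pose x (j : nat) : R := j%:R * h.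
have xinj : injective x.
  by move=> i j /(mulIf (lt0r_neq0 h0))/eqP; rewrite eqr_nat => /eqP.
have xK (j : 'I_K.+1) : 0 <= x j <= K%:R * h.
  rewrite /x mulr_ge0 ?(ltW h0)//= ler_pM2r// ler_nat -ltnS; exact: ltn_ord.
exists K, h, ((rho / h) ^+ K); split=> //.
  by rewrite exprn_ge0// divr_ge0// ltW.
move=> z /andP[zz0 zzm].
pose b (j : 'I_K.+1) := (tnth (lagrange K.+1 x) j).[z].
(* In the Lagrange polynomial the numerators are at most [rho], as [z] and the nodes lie in
   [[0, rho]], and the denominators at least the spacing [h]. *)
have bA j : `|b j| <= (rho / h) ^+ K.
  rewrite /b (lagrangeE _ xinj)// hornerM hornerC !horner_prod normrM normfV mulrC expr_div_n.
  have cK (c : R) : \prod_(i < K.+1 | i != j) c = c ^+ K.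
    by rewrite prodr_const cardC1 card_ord.
  rewrite !normr_prod; apply: ler_pM => //.
  - by apply: prodr_ge0 => i _.
  - by rewrite invr_ge0; apply: prodr_ge0 => i _.
  - rewrite -cK; apply: ler_prod => i _; rewrite normr_ge0/= hornerXsubC.
    have /andP[x0 x1] := xK i; have x2 := le_trans x1 (le_trans Kh1 z0r).
    have zr := le_trans zzm (ltW zmr).
    by rewrite ler_norml; apply/andP; split; lra.
  - rewrite lef_pV2 ?posrE ?exprn_gt0//; last first.
      apply: prodr_gt0 => i ij; rewrite hornerXsubC normr_gt0 subr_eq0 inj_eq// eq_sym.
      by rewrite -val_eqE /= in ij.
    rewrite -cK; apply: ler_prod => i ij; rewrite (ltW h0)/= hornerXsubC /x -mulrBl normrM (gtr0_norm h0).
    rewrite ler_peMl ?(ltW h0)//.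
    rewrite -val_eqE /= in ij.
    have [lij|lji|eij] := ltngtP i j; last by rewrite eij eqxx in ij.
      rewrite ger0_norm ?subr_ge0 ?ler_nat ?(ltnW lij)// -natrB ?(ltnW lij)// ler1n subn_gt0//.
    rewrite distrC ger0_norm ?subr_ge0 ?ler_nat ?(ltnW lji)// -natrB ?(ltnW lji)// ler1n subn_gt0//.
exists b; split=> // m.
have [mK|Km] := leqP m K.
  have -> : z ^+ m = \sum_j b j * (j%:R * h) ^+ m.
    have := lagrange_gen (ltn0Sn K) xinj (p := 'X^m); rewrite size_polyXn => /(_ mK) e'.
    rewrite -[LHS]hornerXn [in LHS]e' horner_sum; apply: eq_bigr => j _.
    by rewrite hornerM hornerC hornerXn mulrC.
  by rewrite subrr normr0 mulr_ge0 ?(ltW e0)// exprn_ge0// ltW.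
apply: (le_trans (ler_normB _ _)); rewrite [e]splitr mulrDl; apply: lerD.
  rewrite ger0_norm ?exprn_ge0//; apply: (@le_trans _ _ (zmax ^+ m)).
    by rewrite lerXn2r ?nnegrE.
  have -> : zmax = q * rho by rewrite /q divfK// gt_eqF.
  rewrite exprMn ler_wpM2r ?exprn_ge0 ?(ltW r0)//; apply: le_trans hK.
  by apply: ler_wiXn2l => //; exact: ltW.
apply: (le_trans (ler_norm_sum _ _ _)).
apply: (@le_trans _ _ (\sum_(j < K.+1) (rho / h) ^+ K * (K%:R * h) ^+ m)).
  apply: ler_sum => j _; rewrite normrM; apply: ler_pM => //.
  have /andP[x0 x1] := xK j.
  by rewrite ger0_norm ?exprn_ge0// lerXn2r ?nnegrE.
rewrite sumr_const card_ord -[_ *+ _]mulr_natl.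
pose r := K%:R * h / rho.
have r00 : 0 <= r by rewrite divr_ge0// ltW.
have rdl : r <= dl by rewrite ler_pdivrMr// [dl * _]mulrC.
have r1 : r <= 1 by apply: le_trans rdl _; rewrite ge_min lexx.
have -> : (K%:R * h) ^+ m = r ^+ m * rho ^+ m by rewrite -exprMn divfK// gt_eqF.
rewrite !mulrA ler_wpM2r ?exprn_ge0 ?(ltW r0)//.
apply: (@le_trans _ _ (K.+1%:R * (rho / h) ^+ K * r ^+ K.+1)).
  rewrite ler_wpM2l ?mulr_ge0 ?exprn_ge0 ?divr_ge0 ?(ltW r0) ?(ltW h0)//.
  exact: ler_wiXn2l.
have -> : K.+1%:R * (rho / h) ^+ K * r ^+ K.+1 = K.+1%:R * K%:R ^+ K * r.
  rewrite exprSr mulrA -[_ * _ * r ^+ K]mulrA -exprMn /r.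
  by congr (_ * _ ^+ _ * _); field; rewrite !gt_eqF.
apply: (@le_trans _ _ (B * (e / 2 / B))); last by rewrite mulrC divfK// gt_eqF.
apply: ler_pM => //; first by rewrite /B lerDl.
by apply: le_trans rdl _; rewrite ge_min lexx orbT.
Qed.

End lagrange_nodes.

Section uniform_deviation.
Context {R : realType}.
Local Notation avg := uniform_mean.
Variable a : nat -> R.
Hypotheses (ha : is_mixture a) (al_gt0 : 0 < a 2%N).
Local Notation al := (a 2%N).
Local Notation v1 := (mixture_fun a 1).

Let alv : al <= v1. Proof. exact: mixture_ge_coef2. Qed.
Let v1_gt0 : 0 < v1. Proof. exact: lt_le_trans alv. Qed.

Lemma normr_spin_cov n (s s' : {ffun 'I_n.+1 -> bool}) :
  `|spin_cov a s s'| <= v1 * (ov s s' / Num.sqrt n.+1%:R) ^+ 2.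
Proof.
have n0 : (0 : R) < n.+1%:R by rewrite ltr0n.
apply: xi_fun_le => //; rewrite expr_div_n (sqr_sqrtr (ltW n0)) ler_pdivrMr// -expr2.
by rewrite -(real_normK (num_real _)) lerXn2r ?nnegrE// normr_ov.
Qed.

(** Bounded by the square of one normalised overlap, hence by [kth]. The condition [th * v1 < 1 / 2]
    for two replicas is the origin of the threshold on [beta]. *)
Lemma avg_expR_spin_cov n (th : R) : 0 <= th -> th * v1 < 2^-1 ->
  avg (fun s : {ffun 'I_n.+1 -> bool} => avg (fun s' => expR (th * `|spin_cov a s s'|))) <= kth (th * v1).
Proof.
move=> th0 th1.
pose O : finType := ({ffun 'I_n.+1 -> bool} * {ffun 'I_n.+1 -> bool})%type.
pose S (p : O) : R := ov p.1 p.2 / Num.sqrt n.+1%:R.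
have mgf (u : R) : avg (fun p => expR (u * S p)) = cosh (u / Num.sqrt n.+1%:R) ^+ n.+1.
  by rewrite -(ov_mgf2 n.+1); apply: eq_avg => p; congr expR; rewrite /S; ring.
have h : 0 <= th * v1 < 2^-1 by rewrite mulr_ge0 ?(ltW v1_gt0).
apply: le_trans (avg_expRsqr_le mgf h); rewrite avg_pair.
apply: avg_le => s; apply: avg_le => s'.
by rewrite ler_expR -mulrA ler_wpM2l// normr_spin_cov.
Qed.

(** Bounds the constant of [transport] uniformly in the dimension; the factor [|C|] is absorbed by
    [g * |C| <= expR (g * |C|)]. *)
Lemma avg_weights_le n (th g c : R) : 0 <= th -> 0 < g ->
  (th + g) * v1 < 2^-1 -> th * v1 < 2^-1 -> 0 <= c ->
  avg (fun s : {ffun 'I_n.+1 -> bool} => avg (fun s' =>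
    `|spin_cov a s s'| * expR (th * `|spin_cov a s s'|))) +
  c * avg (fun s : {ffun 'I_n.+1 -> bool} => avg (fun s' => expR (th * `|spin_cov a s s'|))) <=
  g^-1 * kth ((th + g) * v1) + c * kth (th * v1).
Proof.
move=> th0 g0 thg thv c0; apply: lerD; last by apply: ler_wpM2l => //; exact: avg_expR_spin_cov.
have thg0 : 0 <= th + g by apply: addr_ge0 => //; exact: ltW.
apply: (le_trans _ (ler_wpM2l _ (avg_expR_spin_cov n thg0 thg))); last by rewrite invr_ge0 ltW.
rewrite -avgZ; apply: avg_le => s; rewrite -avgZ; apply: avg_le => s'.
rewrite mulrDl expRD mulrCA [leLHS]mulrC; apply: ler_wpM2l; first exact: expR_ge0.
by rewrite ler_pdivlMl//; apply: le_trans (expR_ge1Dx _); rewrite lerDr.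
Qed.

Variables (d : nat -> measure_display) (T : forall n, measurableType (d n)).
Variables (P : forall n, probability (T n) R).
Variables (X : forall n, {ffun 'I_n.+1 -> bool} -> T n -> R).
Hypothesis gX : forall n, gvec (@spin_cov R a n) (P n) (@X n).

Let dev n z z' := Ex (P n) (fun w => `|deviation (@spin_cov R a n) (@X n) (cbar a (z * z')) z z' w|).

Lemma deviation_small z z' : 0 <= z -> 0 <= z' ->
  z * z * v1 < 24%:R^-1 -> z * z' * v1 < 24%:R^-1 -> z' * z' * v1 < 24%:R^-1 ->
  dev n z z' @[n --> \oo] --> 0.
Proof.
move=> z0 z'0 h1 h2 h3.
have c := deviation_second_moment ha z0 z'0 h1 h2 h3.
apply/cvgrPdist_le => e e0.
have e2 : 0 < e ^+ 2 by rewrite exprn_gt0.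
apply: filterS (cvgr_le _ c _ e2) => n hn.
have d0 : 0 <= dev n z z' by apply: Ex_ge0 => w; exact: normr_ge0.
rewrite sub0r normrN (ger0_norm d0).
have [L2 E2] := deviation_sqr (gX n) (@spin_covC R a n) (cbar a (z * z')) z z'.
apply: Ex_normr_le_sqrt => //; [|exact: ltW|by rewrite E2].
exact: (L1_deviation (gX n) (@spin_covC R a n)).
Qed.

(** [transport] is applied to the point [z] and nodes close to [0], where [deviation_small] holds.
    Neither the nodes nor the bound [A] on the coefficients depend on [z] or on the dimension:
    finitely many limits yield uniformity in [z]. *)
Lemma deviation_uniform (zmax e : R) : 0 <= zmax -> 2 * zmax ^+ 2 * v1 < 1 -> 0 < e ->
  \forall n \near \oo, forall z, 0 <= z <= zmax -> dev n z z <= e.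
Proof.
move=> zm0 zmv e0.
pose u : R := (2 * v1)^-1; pose t := zmax ^+ 2.
have v2 : 0 < 2 * v1 by rewrite mulr_gt0.
have tu : t < u by rewrite -[u]mul1r ltr_pdivlMr// /t mulrCA mulrA.
have t0 : 0 <= t by exact: sqr_ge0.
have uv : u * v1 = 2^-1 by rewrite /u; field; rewrite gt_eqF.
(* [t], [r2], [r2 + g] and [u] are equally spaced: there is room above [zmax] for the radius [rho],
   then for the factor [|C|], below the threshold [u]. *)
pose r2 := (2 * t + u) / 3; pose g := (u - t) / 3.
have g0 : 0 < g by rewrite divr_gt0// subr_gt0.
have r20 : 0 < r2 by rewrite /r2; lra.
pose rho := Num.sqrt r2.
have rho2 : rho ^+ 2 = r2 by rewrite sqr_sqrtr// ltW.
have rho0 : 0 < rho by rewrite sqrtr_gt0.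
have zr : zmax < rho.
  rewrite -[zmax]ger0_norm// -sqrtr_sqr ltr_sqrt//; rewrite -/t /r2; lra.
have r2u : r2 < u by rewrite /r2; lra.
have r2g : r2 + g < u by rewrite /r2 /g; lra.
have r2v : r2 * v1 < 2^-1 by rewrite -uv ltr_pM2r.
have r2gv : (r2 + g) * v1 < 2^-1 by rewrite -uv ltr_pM2r.
have alr : 2 * al * rho ^+ 2 < 1.
  rewrite rho2; apply: (@le_lt_trans _ _ (2 * (r2 * v1))); last lra.
  by rewrite -mulrA ler_pM2l// mulrC ler_pM2l.
pose B := g^-1 * kth ((r2 + g) * v1) + cbar a r2 * kth (r2 * v1).
have cb0 : 0 <= cbar a (rho ^+ 2).
  by apply: divr_ge0; [exact: ltW|rewrite subr_ge0 ltW].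
have cb0' : 0 <= cbar a r2 by rewrite -rho2.
have B0 : 0 <= B.
  by rewrite addr_ge0// mulr_ge0 ?invr_ge0 ?sqrtr_ge0// ltW.
have B1 : 0 < B + 1 by rewrite ltr_wpDl.
pose ep := Num.min 1 (e / 6 / (B + 1)).
have ep0 : 0 < ep by rewrite lt_min ltr01 !divr_gt0.
have ep1 : 0 < ep <= 1 by rewrite ep0/= ge_min lexx.
have epB : 3 * ep * B <= e / 2.
  have h1 : ep <= e / 6 / (B + 1) by rewrite ge_min lexx orbT.
  have h2 : e / 6 / (B + 1) * B <= e / 6.
    by rewrite mulrAC ler_pdivrMr// ler_wpM2l ?divr_ge0 ?(ltW e0)// lerDl.
  have h3 := ler_wpM2r B0 h1; lra.
have ep3 : 0 <= 3 * ep by apply: mulr_ge0 => //; exact: ltW.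
have bound n := avg_weights_le n (ltW r20) g0 r2gv r2v cb0'.
(* [48] makes [z0^2 * v1] at most half of the [1 / 24] required, strictly, by [deviation_small]. *)
pose z0 := Num.min rho (Num.sqrt (48%:R * v1)^-1).
have v48 : 0 < (48%:R * v1)^-1 by rewrite invr_gt0 mulr_gt0.
have z00 : 0 < z0 by rewrite lt_min rho0 sqrtr_gt0.
have z0r : 0 < z0 <= rho by rewrite z00 ge_min lexx.
have z0v : z0 * z0 * v1 < 24%:R^-1.
  have z0s : z0 <= Num.sqrt (48%:R * v1)^-1 by rewrite ge_min lexx orbT.
  apply: (@le_lt_trans _ _ (Num.sqrt (48%:R * v1)^-1 ^+ 2 * v1)).
    by rewrite ler_pM2r// expr2 ler_pM// ltW.
  rewrite (sqr_sqrtr (ltW v48)).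
  have -> : (48%:R * v1)^-1 * v1 = 48%:R^-1 by field; rewrite gt_eqF.
  lra.
have zmr : 0 <= zmax < rho by rewrite zm0.
have [K [h [A [h0 Kh A0 lag]]]] := lagrange_approx zmr z0r ep0.
have node (j : 'I_K.+1) : 0 <= j%:R * h <= z0.
  rewrite mulr_ge0 ?(ltW h0)//=; apply: le_trans Kh; rewrite ler_pM2r// ler_nat -ltnS.
  exact: ltn_ord.
have nodev (i j : 'I_K.+1) : i%:R * h * (j%:R * h) * v1 < 24%:R^-1.
  apply: le_lt_trans z0v; rewrite ler_pM2r//.
  have /andP[i0 i1] := node i; have /andP[j0 j1] := node j; exact: ler_pM.
pose M : R := K.+2%:R ^+ 2 * A ^+ 2 + 1.
have M0 : 0 < M by rewrite ltr_wpDl// mulr_ge0// exprn_ge0.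
pose eta := e / 2 / M.
have eta0 : 0 < eta by rewrite !divr_gt0.
have all_nodes : \forall n \near \oo, forall ij : 'I_K.+1 * 'I_K.+1,
    dev n (ij.1%:R * h) (ij.2%:R * h) <= eta.
  apply: filter_forall => -[i j] /=.
  have /andP[i0 _] := node i; have /andP[j0 _] := node j.
  exact: (cvgr_le _ (deviation_small i0 j0 (nodev i i) (nodev i j) (nodev j j)) _ eta0).
apply: filterS all_nodes => n hn z hz.
have [b [bA bz]] := lag z hz.
(* The index [ord0] stands for [z] itself, with coefficient [0] in [v], and the others for the
   nodes. *)
pose ze (i : 'I_K.+2) : R := if unlift ord0 i is Some j then j%:R * h else z.
pose v (i : 'I_K.+2) : R := if unlift ord0 i is Some j then b j else 0.
have ze0 : ze ord0 = z by rewrite /ze unlift_none.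
have zeS j : ze (lift ord0 j) = j%:R * h by rewrite /ze liftK.
have v0 : v ord0 = 0 by rewrite /v unlift_none.
have vS j : v (lift ord0 j) = b j by rewrite /v liftK.
have zeb i : 0 <= ze i <= rho.
  rewrite /ze; case: unliftP => [j _|_].
    by have /andP[-> h1] := node j; have /andP[_ h2] := z0r; exact: le_trans h1 h2.
  by have /andP[-> h1] := hz; exact: le_trans h1 (ltW zr).
have hv : approx_null ze rho (fun i => (i == ord0)%:R - v i) ep.
  move=> m; rewrite big_ord_recl ze0 v0 subr0 eqxx mul1r.
  under eq_bigr do rewrite zeS vS [_ == _]eq_sym (negbTE (neq_lift _ _)) sub0r mulNr.
  by rewrite sumrN; exact: bz.
have := transport (gX n) (@spin_covC R a n) (ltW al_gt0) zeb (ltW rho0) alr ep1 hv.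
rewrite ze0 rho2 => tr; apply: (le_trans tr); rewrite [e]splitr; apply: lerD.
  apply: (@le_trans _ _ (\sum_(i < K.+2) \sum_(j < K.+2) A ^+ 2 * eta)).
    apply: ler_sum => i _; apply: ler_sum => j _.
    rewrite /v; case: unliftP => [i' ->|->]; last first.
      by rewrite mul0r normr0 mul0r mulr_ge0 ?sqr_ge0// ltW.
    case: unliftP => [j' ->|->]; last first.
      by rewrite mulr0 normr0 mul0r mulr_ge0 ?sqr_ge0// ltW.
    rewrite !zeS; apply: ler_pM => //.
    - by apply: Ex_ge0 => w; exact: normr_ge0.
    - by rewrite normrM expr2 ler_pM.
    - exact: (hn (i', j')).
  have -> : \sum_(i < K.+2) \sum_(j < K.+2) A ^+ 2 * eta = (K.+2%:R ^+ 2 * A ^+ 2) * eta.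
    rewrite !sumr_const card_ord -mulrnA -[LHS]mulr_natl natrM expr2.
    by move: (K.+2%:R) => k; ring.
  apply: (@le_trans _ _ (M * eta)); first by rewrite ler_wpM2r ?(ltW eta0)// /M lerDl.
  by rewrite mulrC divfK// gt_eqF.
exact: (le_trans (ler_wpM2l ep3 (bound n)) epB).
Qed.

End uniform_deviation.

(** * From Laplace transforms to weak convergence *)

Section laplace_transforms.
Context {R : realType}.
Variables (d : nat -> measure_display) (T : forall n, measurableType (d n)).
Variables (P : forall n, probability (T n) R) (W : forall n, T n -> R).
Variables (d' : measure_display) (T' : measurableType d') (Q : probability T' R) (V : T' -> R).
Hypotheses (mW : forall n, measurable_fun setT (@W n)) (W0 : forall n w, 0 < @W n w).
Hypotheses (mV : measurable_fun setT V) (V0 : forall w, 0 < V w).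
Hypothesis WV : forall k, Ex (P n) (fun w => laplace k%:R (@W n w)) @[n --> \oo] -->
  Ex Q (fun w => laplace k%:R (V w)).

Let lap d1 (T1 : measurableType d1) (P1 : probability T1 R) (Z : T1 -> R) :
  measurable_fun setT Z -> (forall w, 0 < Z w) ->
  [/\ forall w, 0 < laplace 1 (Z w) < 1, measurable_fun setT (fun w => laplace 1 (Z w)) &
      forall k, L1 P1 (fun w => laplace k%:R (Z w))].
Proof.
move=> mZ Z0.
have ml (k : R) : measurable_fun setT (fun w => laplace k (Z w)).
  rewrite /laplace; apply: measurableT_comp; first exact: measurable_expR.
  under eq_fun do rewrite -mulNr.
  by apply: measurable_funM => //; exact: measurable_cst.
split=> [w||k] //.
  by rewrite /laplace mul1r expR_gt0/= -expR0 ltr_expR oppr_lt0.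
apply: (@L1_bounded _ _ _ P1 1) => // w.
by rewrite ger0_norm ?expR_ge0// /laplace -expR0 ler_expR oppr_le0 mulr_ge0// ltW.
Qed.

(** With integer parameters the Laplace transforms are the moments of [u = expR (- W)], hence
    determine the means of polynomials in [u]. *)
Let laplace_pow (k : nat) (x : R) : laplace k%:R x = laplace 1 x ^+ k.
Proof. by rewrite /laplace -expRM_natl mul1r mulrN. Qed.

Let horner_lap d1 (T1 : measurableType d1) (P1 : probability T1 R) (Z : T1 -> R) (p : {poly R}) :
  measurable_fun setT Z -> (forall w, 0 < Z w) ->
  L1 P1 (fun w => p.[laplace 1 (Z w)]) /\ Ex P1 (fun w => p.[laplace 1 (Z w)]) =
    \sum_(k < size p) p`_k * Ex P1 (fun w => laplace k%:R (Z w)).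
Proof.
move=> mZ Z0; have [_ _ L] := lap P1 mZ Z0.
have e w : p.[laplace 1 (Z w)] = \sum_(k < size p) p`_k * laplace k%:R (Z w).
  by rewrite horner_coef; apply: eq_bigr => k _; rewrite laplace_pow.
under [X in L1 _ X]eq_fun do rewrite e.
under [X in Ex _ X]eq_fun do rewrite e.
split; first by apply: L1_sum => k; exact: L1Z.
by rewrite Ex_sum => [|k]; [apply: eq_bigr => k _; rewrite ExZ|exact: L1Z].
Qed.

Let poly_cvg (p : {poly R}) : Ex (P n) (fun w => p.[laplace 1 (@W n w)]) @[n --> \oo] -->
  Ex Q (fun w => p.[laplace 1 (V w)]).
Proof.
rewrite (horner_lap Q p mV V0).2.
under eq_fun => n do rewrite (horner_lap (P n) p (@mW n) (@W0 n)).2.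
by apply: cvg_seqsum => k; apply: cvgM; [exact: cvg_cst|exact: WV].
Qed.

(** A polynomial form of tightness: it tends to [0] at each point of [(0, 1)] but stays close to [1]
    near both ends, so that its mean bounds the probability that [u] is near [0] or [1]. *)
Let tails (k : nat) : {poly R} := (1 - 'X * (1 - 'X)) ^+ k.

Let tails_hornerE k (u : R) : (tails k).[u] = (1 - u * (1 - u)) ^+ k.
Proof. by rewrite /tails !hornerE. Qed.

Let u_bound (u : R) : 0 < u < 1 -> 0 <= 1 - u * (1 - u) < 1.
Proof.
move=> /andP[u0 u1].
have h : 0 < u * (1 - u) by rewrite mulr_gt0// subr_gt0.
by apply/andP; split; nra.
Qed.

Let tails_cvg0 : Ex Q (fun w => (tails k).[laplace 1 (V w)]) @[k --> \oo] --> (0 : R).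
Proof.
have [b _ _] := lap Q mV V0.
rewrite -[X in _ --> X](Ex_cst Q).
apply: (@Ex_dominated _ _ _ Q _ _ (fun=> 1)).
- by move=> k; exact: L1_meas (horner_lap Q (tails k) mV V0).1.
- exact: measurable_cst.
- move=> w; under eq_fun do rewrite tails_hornerE.
  have /andP[h0 h1] := u_bound (b w).
  by apply: cvg_expr; rewrite ger0_norm.
- exact: L1_cst.
- move=> k w; rewrite tails_hornerE; have /andP[h0 h1] := u_bound (b w).
  by rewrite ger0_norm ?exprn_ge0// exprn_ile1// ltW.
Qed.

(** [f (ln W)] is a function of [u = expR (- W)] that may have no limit at [0] or [1]. It is cut off
    near the ends, where [tails] takes over, and approximated by a polynomial elsewhere. *)
Lemma laplace_cvg_ln (f : R -> R) (M : R) : continuous f -> (forall x, `|f x| <= M) ->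
  Ex (P n) (fun w => f (ln (@W n w))) @[n --> \oo] --> Ex Q (fun w => f (ln (V w))).
Proof.
move=> cf fM.
have M0 : 0 <= M by apply: le_trans (fM 0).
apply: (@cvg_approx R _ _ (16 * M + 2)) => e e0.
have [k _ hk] := cvgr_le _ tails_cvg0 _ e0.
have {}hk := hk k (leqnn k).
(* By Bernoulli's inequality [(1 - dl)^k >= 1 / 2], so [tails k] is at least [1 / 2] outside
   [[dl, 1 - dl]]; the crude bound [2 * M] there is at most [4 * M] times its value. *)
pose dl : R := (2 * k.+1%:R)^-1.
have k0 : (0 : R) < k.+1%:R by rewrite ltr0n.
have dl0 : 0 < dl by rewrite invr_gt0 mulr_gt0.
have dl12 : dl <= 2^-1.
  by rewrite /dl invfM ler_piMr// invf_le1// ler1n.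
have dlk : 2^-1 <= (1 - dl) ^+ k.
  have kd : k%:R * dl <= 2^-1.
    rewrite /dl invfM mulrCA ler_piMr// ler_pdivrMr// mul1r ler_nat.
    exact: leqnSn.
  have bern j : 1 - j%:R * dl <= (1 - dl) ^+ j.
    elim: j => [|j IH]; first by rewrite mul0r subr0 expr0.
    have d1 : 0 <= 1 - dl by lra.
    rewrite exprS; apply: le_trans (ler_wpM2l d1 IH).
    have : 0 <= j%:R * dl * dl by rewrite !mulr_ge0// ltW.
    by rewrite -natr1; move: (j%:R : R) => x; nra.
  by apply: le_trans (bern k); lra.
pose clamp (u : R) : R := Num.max dl (Num.min u (1 - dl)).
have clampb u : dl <= clamp u <= 1 - dl.
  rewrite /clamp le_max lexx/= ge_max ge_min lexx orbT andbT; lra.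
have clampE u : dl <= u <= 1 - dl -> clamp u = u.
  by move=> /andP[h1 h2]; rewrite /clamp (min_idPl h2) (max_idPr h1).
pose phi (u : R) : R := f (ln (- ln (clamp u))).
have cphi : continuous phi.
  move=> u; have /andP[c1 c2] := clampb u.
  have cl0 : 0 < clamp u by exact: lt_le_trans c1.
  have l0 : 0 < - ln (clamp u) by rewrite oppr_gt0 ln_lt0// cl0/=; lra.
  have k1 : {for u, continuous clamp}.
    apply: (@continuous_max R R (fun=> dl) (fun u => Num.min u (1 - dl))); first exact: cvg_cst.
    by apply: (@continuous_min R R id (fun=> 1 - dl)); [exact: cvg_id|exact: cvg_cst].
  have k2 : {for u, continuous (@ln R \o clamp)}.
    by apply: continuous_comp; [exact: k1|exact: continuous_ln].
  have k3 : {for u, continuous (fun u => - ln (clamp u))} by exact: (cvgN k2).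
  have k4 : {for u, continuous (@ln R \o (fun u => - ln (clamp u)))}.
    by apply: continuous_comp; [exact: k3|exact: continuous_ln].
  by apply: (@continuous_comp _ _ _ (@ln R \o (fun u => - ln (clamp u))) f); [exact: k4|exact: cf].
have [p hp] := weierstrass cphi e0.
have diff (x : R) : 0 < x ->
    `|f (ln x) - p.[laplace 1 x]| <= 4 * M * (tails k).[laplace 1 x] + e.
  move=> x0; set u := laplace 1 x.
  have ux : x = - ln u by rewrite /u /laplace expRK mul1r opprK.
  have ub : 0 < u < 1 by rewrite /u /laplace mul1r expR_gt0/= -expR0 ltr_expR oppr_lt0.
  have /andP[t0 t1] := u_bound ub; have /andP[u0 u1] := ub.
  have u01 : 0 <= u <= 1 by rewrite !ltW.
  have -> : f (ln x) - p.[u] = (f (ln x) - phi u) - (p.[u] - phi u) by ring.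
  apply: (le_trans (ler_normB _ _)); apply: lerD; last exact: hp.
  rewrite tails_hornerE.
  have [hin|hout] := boolP (dl <= u <= 1 - dl).
    rewrite /phi clampE// -ux subrr normr0.
    by apply: mulr_ge0; [exact: mulr_ge0|exact: exprn_ge0].
  apply: (@le_trans _ _ (4 * M * 2^-1)).
    apply: (le_trans (ler_normB _ _)).
    have := fM (ln x); have := fM (ln (- ln (clamp u))); rewrite /phi; lra.
  apply: ler_wpM2l; first exact: mulr_ge0.
  apply: (le_trans dlk); apply: lerXn2r; rewrite ?nnegrE//; first lra.
  move: hout; rewrite negb_and -!ltNge => /orP[h|h]; nra.
have mf d1 (T1 : measurableType d1) (P1 : probability T1 R) (Z : T1 -> R) :
    measurable_fun setT Z -> L1 P1 (fun w => f (ln (Z w))).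
  move=> mZ; apply: (@L1_bounded _ _ _ P1 M); last by move=> w; exact: fM.
  apply: measurableT_comp; first exact: continuous_measurable_fun.
  by apply: measurableT_comp mZ; exact: measurable_ln.
have dE : forall d2 (T2 : measurableType d2) (P2 : probability T2 R) (Y : T2 -> R),
    measurable_fun setT Y -> (forall w, 0 < Y w) ->
    `|Ex P2 (fun w => f (ln (Y w))) - Ex P2 (fun w => p.[laplace 1 (Y w)])| <=
    4 * M * Ex P2 (fun w => (tails k).[laplace 1 (Y w)]) + e.
  move=> d2 T2 P2 Y mY Y0; have Lf := mf _ _ P2 Y mY.
  have Lp := (horner_lap P2 p mY Y0).1; have Lt := (horner_lap P2 (tails k) mY Y0).1.
  rewrite -ExB// -(ExZ (4 * M) Lt) -[X in _ + X](Ex_cst P2) -ExD; [|exact: L1Z|exact: L1_cst].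
  apply: Ex_normr_le; first exact: L1_meas (L1B Lf Lp).
    by move=> w; exact: diff.
  by apply: L1D; [exact: L1Z|exact: L1_cst].
exists (fun n => Ex (P n) (fun w => p.[laplace 1 (@W n w)])), (Ex Q (fun w => p.[laplace 1 (V w)])).
split; first exact: poly_cvg.
  rewrite distrC; apply: (le_trans (dE _ _ Q V mV V0)).
  have : 4 * M * Ex Q (fun w => (tails k).[laplace 1 (V w)]) <= 4 * M * e.
    by apply: ler_wpM2l => //; exact: mulr_ge0.
  have : 0 <= M * e by rewrite mulr_ge0// ltW.
  rewrite mulrDl; lra.
(* The strict inequality passes from the limit to all large [n]. *)
have e2 : Ex Q (fun w => (tails k).[laplace 1 (V w)]) < 2 * e by lra.
have hc := cvgr_le _ (@poly_cvg (tails k)) _ e2.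
near=> n; have hn : Ex (P n) (fun w => (tails k).[laplace 1 (@W n w)]) <= 2 * e by near: n; exact: hc.
apply: (le_trans (dE _ _ (P n) (@W n) (@mW n) (@W0 n))).
have : 4 * M * Ex (P n) (fun w => (tails k).[laplace 1 (W w)]) <= 4 * M * (2 * e).
  by apply: ler_wpM2l => //; exact: mulr_ge0.
have : 0 <= M * e by rewrite mulr_ge0// ltW.
rewrite mulrDl; lra.
Unshelve. all: end_near. Qed.

End laplace_transforms.

(** * The central limit theorem *)

Section limit_variance.
Context {R : realType}.
Variables (a : nat -> R) (Tm : R).
Local Notation al := (a 2%N).
Hypotheses (al0 : 0 <= al) (Tm0 : 0 <= Tm) (alT : 2 * al * Tm < 1).

(* [lnk t] is the limiting variance [s^2] at inverse temperature [sqrt t]. *)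
Definition lnk (t : R) : R := ln (kth (al * t)).

Let th t : 0 <= t <= Tm -> al * t < 2^-1.
Proof.
move=> /andP[t0 tT]; have h : al * t <= al * Tm by rewrite ler_wpM2l.
have : 2 * (al * Tm) < 1 by rewrite mulrA.
lra.
Qed.

Let kth_le t t' : 0 <= t -> t <= t' -> t' <= Tm -> kth (al * t) <= kth (al * t').
Proof.
move=> t0 tt' t'T.
have h1 := th (t := t'); rewrite (le_trans t0 tt') t'T in h1; have {}h1 := h1 isT.
have h2 : al * t <= al * t' by rewrite ler_wpM2l.
rewrite lef_pV2 ?posrE ?sqrtr_gt0; [|lra|lra].
by apply: ler_wsqrtr; lra.
Qed.

Lemma lnk0 : lnk 0 = 0.
Proof. by rewrite /lnk /kth !mulr0 subr0 sqrtr1 invr1 ln1. Qed.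

Let kmax := kth (al * Tm).

(** From [kth th ^+ 2 = 1 / (1 - 2 th)], an exact identity for increments of [kth], from which the
    regularity of [lnk] follows without differentiation. *)
Let data t h : 0 <= t -> 0 <= h -> t + h <= Tm ->
  [/\ 1 <= kth (al * t), kth (al * t) <= kth (al * (t + h)), kth (al * (t + h)) <= kmax &
   (kth (al * (t + h)) - kth (al * t)) * (kth (al * t) + kth (al * (t + h))) =
   2 * al * h * kth (al * t) ^+ 2 * kth (al * (t + h)) ^+ 2].
Proof.
move=> t0 h0 thT; have tT : t <= Tm by apply: le_trans thT; rewrite lerDl.
have t1 : t <= t + h by rewrite lerDl.
have th0 : 0 <= t + h by exact: addr_ge0.
have b1 : 0 <= t <= Tm by rewrite t0.
have b2 : 0 <= t + h <= Tm by rewrite th0.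
split.
- have := kth_le (lexx 0) t0 tT; by rewrite {1}/kth !mulr0 subr0 sqrtr1 invr1.
- exact: kth_le.
- exact: kth_le.
- have k1 := kth_sqr (th b1); have k2 := kth_sqr (th b2).
  have n1 : 1 - 2 * (al * t) != 0 by rewrite gt_eqF//; have := th b1; lra.
  have n2 : 1 - 2 * (al * (t + h)) != 0 by rewrite gt_eqF//; have := th b2; lra.
  have -> : (kth (al * (t + h)) - kth (al * t)) * (kth (al * t) + kth (al * (t + h))) =
    kth (al * (t + h)) ^+ 2 - kth (al * t) ^+ 2 by ring.
  by rewrite k1 k2; field; rewrite n1 n2.
Qed.

Lemma lnk_increment t h : 0 <= t -> 0 <= h -> t + h <= Tm ->
  0 <= lnk (t + h) - lnk t <= 2 * al * kmax ^+ 2 * h.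
Proof.
move=> t0 h0 thT; have [A1 AB Bk e] := data t0 h0 thT.
rewrite /lnk; move: (kth (al * t)) (kth (al * (t + h))) A1 AB Bk e => A B A1 AB Bk e.
have A0 : 0 < A by exact: lt_le_trans A1.
have B0 : 0 < B by exact: lt_le_trans AB.
have BA0 : 0 < B / A by rewrite divr_gt0.
rewrite -ln_div ?posrE//; apply/andP; split.
  by apply: ln_ge0; rewrite ler_pdivlMr// mul1r.
have := expR_ge1Dx (ln (B / A)); rewrite lnK ?posrE// => h1.
have h2 : B / A - 1 = (B - A) / A by field; rewrite gt_eqF.
have AB0 : 0 < A + B by rewrite addr_gt0.
have h3 : (B - A) / A = 2 * al * h * B ^+ 2 * (A / (A + B)).
  have -> : B - A = 2 * al * h * A ^+ 2 * B ^+ 2 / (A + B).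
    by apply: (mulIf (lt0r_neq0 AB0)); rewrite e divfK// gt_eqF.
  by field; rewrite !gt_eqF.
have c0 : 0 <= 2 * al * h by rewrite !mulr_ge0.
have h4 : A / (A + B) <= 1 by rewrite ler_pdivrMr// mul1r lerDl ltW.
have h5 : B ^+ 2 <= kmax ^+ 2 by rewrite lerXn2r ?nnegrE ?(ltW B0)// (le_trans (ltW B0)).
have h6 : 2 * al * h * B ^+ 2 * (A / (A + B)) <= 2 * al * h * B ^+ 2.
  by rewrite ler_piMr// mulr_ge0// sqr_ge0.
have h7 : 2 * al * h * B ^+ 2 <= 2 * al * h * kmax ^+ 2 by rewrite ler_wpM2l.
rewrite mulrAC; apply: le_trans h7; apply: le_trans h6; rewrite -h3 -h2; lra.
Qed.

Lemma lnk_expansion t h : 0 <= t -> 0 <= h -> t + h <= Tm ->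
  `|expR (lnk (t + h) - lnk t) - 1 - h * cbar a t| <= 6 * al ^+ 2 * kmax ^+ 6 * h ^+ 2.
Proof.
move=> t0 h0 thT; have [A1 AB Bk e] := data t0 h0 thT.
have tb : 0 <= t <= Tm by rewrite t0/=; apply: le_trans thT; rewrite lerDl.
have -> : cbar a t = al * kth (al * t) ^+ 2.
  by rewrite kth_sqr ?th// /cbar mulrA.
rewrite /lnk; move: (kth (al * t)) (kth (al * (t + h))) A1 AB Bk e => A B A1 AB Bk e.
have A0 : 0 < A by exact: lt_le_trans A1.
have B0 : 0 < B by exact: lt_le_trans AB.
have B1 : 1 <= B by exact: le_trans AB.
have BA0 : 0 < B / A by rewrite divr_gt0.
have AB0 : 0 < A + B by rewrite addr_gt0.
rewrite -ln_div ?posrE// lnK ?posrE//.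
have hal : h * (al * A ^+ 2) = (B - A) * (A + B) / (2 * B ^+ 2).
  by rewrite e; field; rewrite gt_eqF.
(* The first-order term cancels exactly and leaves a square. With [B - A <= 2 al h kmax^3] and the
   quotient at most [3 / 2], the constant is [4 * 3 / 2 = 6]. *)
have -> : B / A - 1 - h * (al * A ^+ 2) = (B - A) ^+ 2 * ((A + 2 * B) / (2 * A * B ^+ 2)).
  by rewrite hal; field; rewrite !gt_eqF.
have q0 : 0 <= (A + 2 * B) / (2 * A * B ^+ 2).
  have a0 := ltW A0; have b0 := ltW B0; apply: divr_ge0.
    by apply: addr_ge0 => //; exact: mulr_ge0.
  by apply: mulr_ge0; [exact: mulr_ge0|exact: sqr_ge0].
rewrite ger0_norm; last by rewrite mulr_ge0// sqr_ge0.
have q1 : (A + 2 * B) / (2 * A * B ^+ 2) <= 3 / 2.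
  rewrite ler_pdivrMr; last by rewrite !mulr_gt0// exprn_gt0.
  have -> : 3 / 2 * (2 * A * B ^+ 2) = 3 * (A * (B * B)) by field.
  have : B <= B * B by rewrite ler_peMl// ltW.
  have : B * B <= A * (B * B) by rewrite ler_peMl// mulr_ge0 ?(ltW B0).
  lra.
have c0 : 0 <= 2 * al * h by rewrite !mulr_ge0.
have ba : B - A <= 2 * al * h * kmax ^+ 3.
  have -> : B - A = 2 * al * h * (A ^+ 2 * B ^+ 2 / (A + B)).
    by apply: (mulIf (lt0r_neq0 AB0)); rewrite e; field; rewrite gt_eqF.
  apply: ler_wpM2l => //; rewrite ler_pdivrMr//.
  have k0 : 0 <= kmax by exact: le_trans (ltW B0) Bk.
  have : A ^+ 2 * B ^+ 2 <= kmax ^+ 3 * B.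
    have -> : A ^+ 2 * B ^+ 2 = A ^+ 2 * B * B by ring.
    apply: ler_wpM2r; first exact: ltW.
    rewrite [kmax ^+ 3]exprSr; apply: ler_pM; rewrite ?sqr_ge0 ?(ltW B0)//.
    by rewrite lerXn2r ?nnegrE ?(ltW A0)// (le_trans AB).
  move=> k1; apply: (le_trans k1); apply: ler_wpM2l; first exact: exprn_ge0.
  by rewrite lerDr ltW.
have ba2 : (B - A) ^+ 2 <= (2 * al * h * kmax ^+ 3) ^+ 2.
  have d0 : 0 <= B - A by rewrite subr_ge0.
  by rewrite lerXn2r ?nnegrE// (le_trans d0).
have -> : 6 * al ^+ 2 * kmax ^+ 6 * h ^+ 2 = (2 * al * h * kmax ^+ 3) ^+ 2 * (3 / 2) by field.
by apply: ler_pM => //; exact: sqr_ge0.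
Qed.

Lemma lnkE t : 0 <= t <= Tm -> lnk t = - 2^-1 * ln (1 - 2 * al * t).
Proof.
move=> tb; have h := th tb; have u0 : 0 < 1 - 2 * al * t by rewrite -mulrA; lra.
have s0 : 0 < Num.sqrt (1 - 2 * al * t) by rewrite sqrtr_gt0.
rewrite /lnk /kth mulrA lnV ?posrE// -{2}(sqr_sqrtr (ltW u0)) lnXn// mulr_natl.
by move: (ln _) => y; rewrite -mulr_natl; field.
Qed.

End limit_variance.

Section clt.
Context {R : realType}.
Local Notation avg := uniform_mean.
Local Notation gam := (normal_prob 0 1 : probability (measurableTypeR R) R).
Variable a : nat -> R.
Hypotheses (ha : is_mixture a) (al_gt0 : 0 < a 2%N).
Local Notation al := (a 2%N).
Local Notation v1 := (mixture_fun a 1).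
Variable beta : R.
Hypotheses (beta0 : 0 < beta) (betav : 2 * beta ^+ 2 * v1 < 1).

Let alT : 2 * al * beta ^+ 2 < 1.
Proof.
apply: le_lt_trans betav; rewrite mulrAC; apply: ler_wpM2l; last exact: mixture_ge_coef2.
by apply: mulr_ge0 => //; exact: sqr_ge0.
Qed.

Lemma spin_cov_diag n (s : {ffun 'I_n.+1 -> bool}) : spin_cov a s s = n.+1%:R * v1.
Proof.
have n0 : (0 : R) < n.+1%:R by rewrite ltr0n.
by rewrite /spin_cov /xi_fun ov_diag -mulrA -invfM -expr2 (sqr_sqrtr (ltW n0)) divff//.
Qed.

Variables (d : nat -> measure_display) (T : forall n, measurableType (d n)).
Variables (P : forall n, probability (T n) R).
Variables (X : forall n, {ffun 'I_n.+1 -> bool} -> T n -> R).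
Hypothesis gX : forall n, gvec (@spin_cov R a n) (P n) (@X n).

Let W n (w : T n) : R := avg (fun s => wtt (@spin_cov R a n) (@X n) (beta ^+ 2) s w).

Let wtt_tilt n t s w : 0 <= t ->
  wtt (@spin_cov R a n) (@X n) t s w = tilt (@spin_cov R a n) (@X n) (Num.sqrt t) s w.
Proof. by move=> t0; rewrite /wtt /wt /tilt sqr_sqrtr. Qed.

(** The interpolation bound is linear in the deviation, which [deviation_uniform] makes small for
    large [n] at all [z = sqrt t] up to [beta]. *)
Lemma laplace_limit (lam : R) : 0 <= lam ->
  Ex (P n) (fun w => laplace lam (W w)) @[n --> \oo] -->
  Ex gam (fun y => laplace lam (log_normal (lnk a (beta ^+ 2)) y)).
Proof.
move=> lam0.
have Tm0 : 0 <= beta ^+ 2 by exact: sqr_ge0.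
have b0 := ltW beta0; have al0 := ltW al_gt0.
pose M := lam ^+ 2 / 2 * expR (lnk a (beta ^+ 2)) * beta ^+ 2.
have M0 : 0 <= M.
  by apply: mulr_ge0 => //; apply: mulr_ge0; [rewrite divr_ge0// sqr_ge0|exact: expR_ge0].
apply/cvgrPdist_le => e e0.
have M1 : 0 < M + 1 by rewrite ltr_wpDl.
have e1 : 0 < e / (M + 1) by rewrite divr_gt0.
have du := deviation_uniform ha al_gt0 gX b0 betav e1.
apply: filterS du => n hn.
rewrite distrC.
have S0 : (0 < #|{ffun 'I_n.+1 -> bool}|)%N by rewrite card_ffun card_bool expn_gt0.
have v0 : 0 <= n.+1%:R * v1.
  by rewrite mulr_ge0//; apply: le_trans al0 _; exact: mixture_ge_coef2.
have k0 : 0 <= kth (al * beta ^+ 2) by rewrite invr_ge0 sqrtr_ge0.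
have L0 : 0 <= 2 * al * kth (al * beta ^+ 2) ^+ 2 by rewrite !mulr_ge0.
have K0 : 0 <= 6 * al ^+ 2 * kth (al * beta ^+ 2) ^+ 6.
  by apply: mulr_ge0; [apply: mulr_ge0 => //; exact: sqr_ge0|exact: exprn_ge0].
have HB t : 0 <= t <= beta ^+ 2 -> Ex (P n) (fun x => `|avg (fun s' => avg (fun s'' =>
    wtt (@spin_cov R a n) (@X n) t s' x * wtt (@spin_cov R a n) (@X n) t s'' x *
    (spin_cov a s' s'' - cbar a t)))|) <= e / (M + 1).
  move=> /andP[t0 tb].
  have zb : 0 <= Num.sqrt t <= beta.
    by rewrite sqrtr_ge0/= -[beta]ger0_norm// -sqrtr_sqr ler_wsqrtr.
  apply: le_trans (hn _ zb); rewrite -expr2 sqr_sqrtr//.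
  rewrite le_eqVlt; apply/orP; left; apply/eqP; congr Ex; apply/funext => w; congr (`|_|).
  by apply: eq_avg => s; apply: eq_avg => s'; rewrite !wtt_tilt.
have := interpolation S0 (gX n) (@spin_covC R a n) (@spin_cov_diag n) v0 lam0
  Tm0 L0 K0 (lnk0 a) (lnk_increment al0 alT) (lnk_expansion al0 alT) HB.
move=> h; apply: (le_trans h).
by rewrite -/M mulrCA ler_piMr ?(ltW e0)// ler_pdivrMr// mul1r lerDl.
Qed.

Lemma free_energy_limit (f : R -> R) (M : R) : continuous f -> (forall x, `|f x| <= M) ->
  Ex (P n) (fun w => f (ln (W w))) @[n --> \oo] -->
  Ex (normal_prob (- 2^-1 * lnk a (beta ^+ 2)) (Num.sqrt (lnk a (beta ^+ 2))) :
      probability (measurableTypeR R) R) f.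
Proof.
move=> cf fM.
have Tm0 : 0 <= beta ^+ 2 by exact: sqr_ge0.
have al0 := ltW al_gt0.
have b20 : 0 < beta ^+ 2 by rewrite exprn_gt0.
have s0 : 0 < Num.sqrt (lnk a (beta ^+ 2)).
  rewrite sqrtr_gt0 (lnkE al0 alT) ?Tm0 ?lexx// mulNr oppr_gt0 pmulr_rlt0 ?invr_gt0//.
  have u0 : 0 < 1 - 2 * al * beta ^+ 2 by rewrite subr_gt0.
  by apply: ln_lt0; rewrite u0/= ltrBlDr ltrDl !mulr_gt0.
rewrite (normal_affine_bounded _ s0 cf fM).
have -> : (fun x => f (- 2^-1 * lnk a (beta ^+ 2) + Num.sqrt (lnk a (beta ^+ 2)) * x)) =
    (fun y => f (ln (log_normal (lnk a (beta ^+ 2)) y))).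
  by apply/funext => y; rewrite /log_normal expRK; congr f; field.
apply: (laplace_cvg_ln (P := P) (W := W) (Q := gam) _ _ _ _ _ cf fM).
- move=> n; apply: measurable_avg => s.
  have h := gvecZ (Num.sqrt (beta ^+ 2)) (gX n); rewrite (sqr_sqrtr Tm0) in h.
  exact: (measurable_wt h s).
- move=> n w; have S0 : (0 < #|{ffun 'I_n.+1 -> bool}|)%N by rewrite card_ffun card_bool expn_gt0.
  rewrite /W /uniform_mean divr_gt0 ?ltr0n//.
  rewrite (bigD1 [ffun=> true])//= ltr_pwDl ?expR_gt0//.
  by apply: sumr_ge0 => s _; exact: expR_ge0.
- apply: continuous_measurable_fun => y; rewrite /log_normal.
  apply: continuous_cvg; first exact: continuous_expR.
  apply: cvgB; last exact: cvg_cst.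
  by apply: cvgM; [exact: cvg_cst|exact: cvg_id].
- by move=> y; exact: expR_gt0.
- by move=> k; apply: laplace_limit.
Qed.

End clt.

Section main.
Context {R : realType}.
Local Notation avg := uniform_mean.
Variable a : nat -> R.
Hypotheses (ha : is_mixture a) (al_gt0 : 0 < a 2%N).
Local Notation v1 := (mixture_fun a 1).

Lemma dot_spin_row n (s s' : {ffun 'I_n -> bool}) : dot (spin_row s) (spin_row s') = ov s s' :> R.
Proof. by apply: eq_bigr => i _; rewrite !mxE. Qed.

Lemma spin_covE n (s s' : {ffun 'I_n.+1 -> bool}) :
  n.+1%:R * mixture_fun a (dot (val (spin_point s : sphere R n.+1)) (val (spin_point s' : sphere R n.+1)) / n.+1%:R) =
  spin_cov a s s'.
Proof.
rewrite dot_spin_row /spin_cov /xi_fun -mulrA -invfM -expr2 sqr_sqrtr//.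
Qed.

Lemma small_beta_clt beta : 0 < beta -> 2 * beta ^+ 2 * v1 < 1 -> free_energy_clt a beta.
Proof.
move=> b0 bv d T P H hH s2 f cf [M fM].
have Tm0 : 0 <= beta ^+ 2 by exact: sqr_ge0.
have gX n : gvec (@spin_cov R a n) (P n.+1) (fun s => H n.+1 (spin_point s)).
  have [G E0 EC] := hH n.+1 isT.
  have gp := gvec_process G E0 EC (fun s : {ffun 'I_n.+1 -> bool} => spin_point s).
  have eC := funext (fun s => funext (@spin_covE n s)).
  by rewrite eC in gp.
have lim := free_energy_limit ha al_gt0 b0 bv gX cf fM.
have s2E : s2 = lnk a (beta ^+ 2).
  have alT : 2 * a 2%N * beta ^+ 2 < 1.
    apply: le_lt_trans bv; rewrite mulrAC; apply: ler_wpM2l; last exact: mixture_ge_coef2.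
    by apply: mulr_ge0 => //; exact: sqr_ge0.
  by rewrite (lnkE (ltW al_gt0) alT)// Tm0 lexx.
have mf : measurable_fun setT f by exact: continuous_measurable_fun.
have FE n w : free_energy beta (H n.+1) w - n.+1%:R * (beta ^+ 2 / 2) * v1 =
    ln (avg (fun s => wtt (@spin_cov R a n) (fun s => H n.+1 (spin_point s)) (beta ^+ 2) s w)).
  have -> : avg (fun s => wtt (@spin_cov R a n) (fun s => H n.+1 (spin_point s)) (beta ^+ 2) s w) =
     expR (- (n.+1%:R * (beta ^+ 2 / 2) * v1)) * partition_function beta (H n.+1) w.
    rewrite /partition_function -avgZ; apply: eq_avg => s.
    rewrite /wtt /wt (spin_cov_diag a) sqrtr_sqr gtr0_norm// -expRD; congr expR; ring.
  have Z0 : 0 < partition_function beta (H n.+1) w.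
    rewrite /partition_function /uniform_mean divr_gt0 ?ltr0n ?card_ffun ?card_bool ?expn_gt0//.
    rewrite (bigD1 [ffun=> true])//= ltr_pwDl ?expR_gt0//.
    by apply: sumr_ge0 => s _; exact: expR_ge0.
  by rewrite lnM ?posrE ?expR_gt0// expRK addrC.
have Ef (m : measure_display) (T1 : measurableType m) (P1 : probability T1 R) (Y : T1 -> R) :
    measurable_fun setT Y -> ('E_P1[f \o Y] = (Ex P1 (fun w => f (Y w)))%:E)%E.
  move=> mY; rewrite unlock; apply: Ex_EFin; apply: (@L1_bounded _ _ _ P1 M).
    exact: measurableT_comp mf mY.
  by move=> w; exact: fM.
have EQ (Q : probability (measurableTypeR R) R) : ('E_Q[f] = (Ex Q f)%:E)%E.
  exact: (Ef _ _ Q idfun (@measurable_id _ _ _)).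
(* Dimension [0] is dropped: nothing is assumed there, and the covariances are indexed by [n.+1]. *)
rewrite s2E EQ -cvg_shiftS.
have lim' : (Ex (P n.+1) (fun w => f (ln (avg (fun s => wtt (@spin_cov R a n)
    (fun s => H n.+1 (spin_point s)) (beta ^+ 2) s w)))))%:E @[n --> \oo] -->
    (Ex (normal_prob (- 2^-1 * lnk a (beta ^+ 2)) (Num.sqrt (lnk a (beta ^+ 2))) :
      probability (measurableTypeR R) R) f)%:E.
  by apply: cvg_EFin; [exact: nearW|exact: lim].
apply: cvg_trans lim'; apply: near_eq_cvg; apply: nearW => n /=.
rewrite Ef//; congr (_%:E); congr Ex.
by apply/funext => w; rewrite -FE.
Qed.

End main.

Theorem theorem1p1 (R : realType) (a : nat -> R)
    (ha : is_mixture a) (ha2 : 0 < a 2%N) :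
  (exists beta_xi : R,
      0 < beta_xi <= 1 / Num.sqrt (2 * a 2%N) /\
      forall beta : R, 0 < beta < beta_xi -> free_energy_clt a beta) /\
  ((forall p : nat, p != 2%N -> a p = 0) ->
   forall beta : R, 0 < beta < 1 / Num.sqrt (2 * a 2%N) ->
     free_energy_clt a beta).
Proof.
have alv := mixture_ge_coef2 ha.
have v0 : 0 < mixture_fun a 1 by exact: lt_le_trans alv.
have s0 : 0 < Num.sqrt (2 * mixture_fun a 1) by rewrite sqrtr_gt0 mulr_gt0.
have clt beta : 0 < beta < 1 / Num.sqrt (2 * mixture_fun a 1) -> free_energy_clt a beta.
  move=> /andP[b0 bb]; apply: small_beta_clt => //.
  have -> : 2 * beta ^+ 2 * mixture_fun a 1 = (beta * Num.sqrt (2 * mixture_fun a 1)) ^+ 2.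
    by rewrite exprMn sqr_sqrtr; [ring|rewrite mulr_ge0// ltW].
  rewrite exprn_ilt1//; last by rewrite -ltr_pdivlMr.
  by rewrite mulr_ge0// ltW.
(* For a pure mixture [xi 1] is the coefficient of degree two, so both thresholds coincide. *)
split; last by move=> pure beta; rewrite -(pure_mixture1 ha pure); exact: clt.
exists (1 / Num.sqrt (2 * mixture_fun a 1)); split=> //.
rewrite divr_gt0//= !mul1r lef_pV2 ?posrE//; last by rewrite sqrtr_gt0 mulr_gt0.
by apply: ler_wsqrtr; rewrite ler_pM2l.
Qed.
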